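(* Let $\delta>0$ be sufficiently small (i.e. smaller than some absolute constant). Then there is a constant $c_\delta>0$, depending only on $\delta$, such that for every finite, non-empty set $A\subseteq\mathbb{Z}$ with $|A+A|\le(4+\delta)|A|$, the set $41A-40A$ contains a $d$-dimensional progression $P$ with $d\le2$ and $|P|\ge c_\delta|A|$.
   Context: For $h\in\mathbb{N}$, $hA=\{a_1+\dots+a_h:a_1,\dots,a_h\in A\}$, and $41A-40A=\{x-y:x\in41A,\ y\in40A\}$; $A+A=2A$. For $d\in\mathbb{N}$, a $d$-dimensional progression is a set of the form $\{a_0+l_1a_1+\dots+l_da_d:1\le l_i\le L_i,\ l_i\in\mathbb{Z}\ (1\le i\le d)\}$ with $a_0,\dots,a_d\in\mathbb{Z}$ and $L_1,\dots,L_d\in\mathbb{N}$ (positive integers). *)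

(* Defs.v *)
From HB Require Import structures.
From mathcomp Require Import all_boot all_order all_algebra finmap.
From mathcomp Require Import reals.

Set Implicit Arguments.
Unset Strict Implicit.
Unset Printing Implicit Defensive.

Import Order.TTheory GRing.Theory Num.Theory.

Local Open Scope fset_scope.
Local Open Scope ring_scope.

Definition sumset (A B : {fset int}) : {fset int} :=
  [fset a + b | a in A, b in B].

Definition diffset (A B : {fset int}) : {fset int} :=
  [fset a - b | a in A, b in B].

(* Summands range over the finite type of elements of A, with repetition
   allowed: this is the iterated sumset hA, not the dilate. *)
Definition nfold_sumset (h : nat) (A : {fset int}) : {fset int} :=
  [fset \sum_(i < h) val (a i)
    | a : {ffun 'I_h -> A} in {: {ffun 'I_h -> A}}].

(* The progression is not required to be proper: distinct tuples l may give
   the same element. *)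
Definition is_progression (d : nat) (P : {fset int}) : Prop :=
  exists (a0 : int) (a : 'I_d -> int) (L : 'I_d -> nat),
    (forall i, (0 < L i)%N) /\
    (forall x : int, x \in P <->
       exists l : 'I_d -> int,
         (forall i, 1 <= l i <= (L i)%:Z) /\
         x = a0 + \sum_(i < d) l i * a i).

Lemma nfold_sumset2 (A : {fset int}) : nfold_sumset 2 A = sumset A A.
Proof.
apply/fsetP => x; apply/imfsetP/imfset2P => /= [[a _ ->]|[u uA [v vA ->]]].
  exists (val (a ord0)); first exact: valP.
  exists (val (a (lift ord0 ord0))); first exact: valP.
  by rewrite big_ord_recl big_ord1.
exists [ffun i : 'I_2 => if i == ord0 then [` uA] else [` vA]] => //.
by rewrite big_ord_recl big_ord1 !ffunE.
Qed.

(* Main.v *)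
From HB Require Import structures.
Require Import Defs.
From mathcomp Require Import all_boot all_order all_algebra finmap.
From mathcomp Require Import zify ring lra.
From mathcomp Require Import boolp reals trigo.

Set Implicit Arguments.
Unset Strict Implicit.
Unset Printing Implicit Defensive.

(* Call an integer cheap if it is a bounded sum of elements of A - A. By almost
   periodicity in the style of Croot and Sisask there is a large set S all of
   whose elements have many cheap multiples; let v be the largest |s|, s in S. Cutting A into
   windows of length T v and reducing modulo v, each fibre of the reduction is
   a set on a line and costs a factor 2 in the sumset, so doubling 4.01 of A
   becomes doubling at most 2.01 for some large X in Z/vZ, and whatever is
   cheap for X lifts to integers of size O(v) that are cheap for A.
   Replace X by a subset E none of whose large subsets has smaller doubling. If
   E is dense in the subgroup that it generates, then iterated differences fill
   a subgroup, which is an arithmetic progression. Otherwise some nontrivial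
   character x |-> r x takes more than four fifths of E into a half circle,
   where x |-> (r x, x) is a Freiman isomorphism into Z x Z/vZ, and the first
   step can be repeated in the first coordinate. This leaves doubling < 3/2,
   hence a subgroup; it pulls back to a planar lattice, and a reduced basis of
   that lattice gives a two-dimensional progression. The repetition can fail
   only when r x takes boundedly many values on most of E, and then the sums
   of neighbouring fibres contradict the choice of E. *)

Import Order.TTheory GRing.Theory Num.Theory.
Local Open Scope fset_scope.
Local Open Scope ring_scope.

(** * Counting in finite sets *)

(** The factor 2 of a projection comes from |B + C| >= |B| + |C| - 1 on a line. The losses -1 add up
    to the number of pairs (window, residue) met by sums inside a window. Each such pair can be
    translated by T multiples of v lying in 2A - 2A, so there are at most O(|A| / T) of them. This
    is why long strings of cheap multiples are needed, and why T is fixed before S is found.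
    Margins: 4.01 becomes 4.02 / 2 = 2.01. A Fourier coefficient of squared size 2/5 |E|^2 puts (1 +
    0.63) / 2 = 0.815 of E into a half circle, where the doubling is at most 2.01 / 0.815 < 2.47.
    The second projection leaves 2.48 / 2 = 1.24 < 3/2. A projection needs an integer-valued
    homomorphism to measure length. Z/vZ has none, so the half circle is replaced by its graph in Z
    x Z/vZ. In Z/vZ the dense case uses 2^5 = 32 summands. Lifting to the integers adds one multiple
    of v from 2A - 2A, and 34 is padded to 40. Translation by one element of A gives 41A - 40A. *)

Section Counting.
Variables (I J T : choiceType).
Implicit Types (A : {fset I}) (B : {fset J}) (Z : {fset T}).

Lemma card_le_inj (f : I -> J) A B :
  {in A &, injective f} -> (forall x, x \in A -> f x \in B) ->
  (#|` A| <= #|` B|)%N.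
Proof.
move=> finj fAB; rewrite -(card_in_imfset imfset_key finj).
by apply: fsubset_leq_card; apply/fsubsetP => y /imfsetP[x /= xA ->]; exact: fAB.
Qed.

Lemma card_prod_le (f : I -> J -> T) A B Z :
  (forall i j, i \in A -> j \in B -> f i j \in Z) ->
  (forall i j i' j', i \in A -> j \in B -> i' \in A -> j' \in B ->
    f i j = f i' j' -> i = i' /\ j = j') ->
  (#|` A| * #|` B| <= #|` Z|)%N.
Proof.
move=> fZ finj.
suff <- : #|` [fset f i j | i in A, j in B]| = (#|` A| * #|` B|)%N.
  apply: fsubset_leq_card; apply/fsubsetP => z /imfset2P[i /= iA [j /= jB ->]].
  exact: fZ.
rewrite card_fset_sum1 big_imfset2 /=.
  rewrite [RHS]mulnC (card_fset_sum1 A) big_distrr /=; apply: eq_bigr => i _.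
  by rewrite muln1 card_fset_sum1.
move=> [i j] [i' j']; rewrite !inE /= => /andP[iA jB] /andP[i'A j'B] /finj.
by case=> // -> ->.
Qed.

Definition fiber (f : I -> J) A j := [fset x in A | f x == j].

Lemma in_fiber (f : I -> J) A j x : (x \in fiber f A j) = (x \in A) && (f x == j).
Proof. by rewrite !inE. Qed.

Lemma fiber_sub (f : I -> J) A j : fiber f A j `<=` A.
Proof. by apply/fsubsetP => x; rewrite in_fiber => /andP[]. Qed.

Lemma card_fibers (f : I -> J) A :
  #|` A| = (\sum_(j <- f @` A) #|` fiber f A j|)%N.
Proof.
rewrite card_fset_sum1 (partition_big_imfset _ f); apply: eq_bigr => j _.
by rewrite card_fset_sum1 big_fset.
Qed.

Lemma sum_disjoint_le (K : {fset J}) (F : J -> {fset I}) (f : I -> J) A :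
  (forall j, j \in K -> F j `<=` A) ->
  (forall j x, j \in K -> x \in F j -> f x = j) ->
  (\sum_(j <- K) #|` F j| <= #|` A|)%N.
Proof.
move=> FA fF.
suff -> : (\sum_(j <- K) #|` F j| =
           #|` [fset p.2 | p in [fset ((j, x) : J * I) | j in K, x in F j]]|)%N.
  apply: fsubset_leq_card; apply/fsubsetP => y /imfsetP[p /= /imfset2P[j /= jK]].
  by move=> [x /= xF ->] ->; exact: (fsubsetP (FA j jK)).
rewrite card_in_imfset; last first.
  move=> p q /imfset2P[j /= jK [x /= xF ->]] /imfset2P[j' /= j'K [x' /= xF' ->]] /=.
  by move=> e; rewrite -(fF j x) // -(fF j' x') // e.
rewrite card_fset_sum1 big_imfset2 /=; last by move=> [? ?] [? ?] _ _ /= [-> ->].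
by apply: eq_bigr => j _; rewrite card_fset_sum1.
Qed.

Lemma double_count (R : I -> J -> bool) A B :
  (\sum_(x <- A) #|` [fset y in B | R x y]| =
   \sum_(y <- B) #|` [fset x in A | R x y]|)%N.
Proof.
transitivity (\sum_(x <- A) \sum_(y <- B | R x y) 1)%N.
  by apply: eq_bigr => x _; rewrite card_fset_sum1 big_fset.
rewrite (exchange_big_dep xpredT) //=; apply: eq_bigr => y _.
by rewrite card_fset_sum1 big_fset.
Qed.

End Counting.

(** * Sumsets *)

Section Sumsets.
Variable G : zmodType.
Implicit Types (A B C X : {fset G}) (x y : G).

Definition addS A B : {fset G} := [fset a + b | a in A, b in B].
Definition subS A B : {fset G} := [fset a - b | a in A, b in B].

Lemma addSP A B x :
  reflect (exists a b, [/\ a \in A, b \in B & x = a + b]) (x \in addS A B).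
Proof.
rewrite /addS; apply: (iffP idP) => [/imfset2P[a /= aA [b /= bB ->]]|[a [b [aA bB ->]]]].
  by exists a, b.
by apply/imfset2P; exists a => //; exists b.
Qed.

Lemma subSP A B x :
  reflect (exists a b, [/\ a \in A, b \in B & x = a - b]) (x \in subS A B).
Proof.
rewrite /subS; apply: (iffP idP) => [/imfset2P[a /= aA [b /= bB ->]]|[a [b [aA bB ->]]]].
  by exists a, b.
by apply/imfset2P; exists a => //; exists b.
Qed.

Lemma mem_addS A B a b : a \in A -> b \in B -> a + b \in addS A B.
Proof. by move=> aA bB; apply/addSP; exists a, b. Qed.

Lemma mem_subS A B a b : a \in A -> b \in B -> a - b \in subS A B.
Proof. by move=> aA bB; apply/subSP; exists a, b. Qed.

Lemma addSC A B : addS A B = addS B A.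
Proof.
by apply/fsetP => x; apply/addSP/addSP => -[a [b [? ? ->]]]; exists b, a; rewrite addrC.
Qed.

Lemma addSA A B C : addS A (addS B C) = addS (addS A B) C.
Proof.
apply/fsetP => x; apply/addSP/addSP.
  move=> [a [_ [aA /addSP[b [c [bB cC ->]]] ->]]].
  by exists (a + b), c; rewrite addrA mem_addS.
move=> [_ [c [/addSP[a [b [aA bB ->]]] cC ->]]].
by exists a, (b + c); rewrite addrA mem_addS.
Qed.

Lemma addSS A A' B B' : A `<=` A' -> B `<=` B' -> addS A B `<=` addS A' B'.
Proof.
move=> /fsubsetP sA /fsubsetP sB; apply/fsubsetP => x /addSP[a [b [/sA aA /sB bB ->]]].
exact: mem_addS.
Qed.

Lemma card_translate A x : #|` [fset a + x | a in A]| = #|` A|.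
Proof. by apply: card_imfset; exact: addIr. Qed.

Lemma card_addS_gel A B : B != fset0 -> (#|` A| <= #|` addS A B|)%N.
Proof.
case/fset0Pn => b bB; rewrite -(card_translate A b); apply: fsubset_leq_card.
by apply/fsubsetP => _ /imfsetP[a /= aA ->]; exact: mem_addS.
Qed.

Lemma card_addS_ger A B : A != fset0 -> (#|` B| <= #|` addS A B|)%N.
Proof. by rewrite addSC; exact: card_addS_gel. Qed.

Lemma ruzsa_triangle A B X :
  (#|` subS A B| * #|` X| <= #|` addS X A| * #|` addS X B|)%N.
Proof.
have H d : exists p : G * G, d \in subS A B -> [/\ p.1 \in A, p.2 \in B & d = p.1 - p.2].
  case: (boolP (d \in subS A B)) => [/subSP[a [b ?]]|_]; last by exists (0, 0).
  by exists (a, b).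
have [p pP] := choice H.
have -> : (#|` addS X A| * #|` addS X B| = #|` addS X A `*` addS X B|)%N.
  rewrite [RHS]card_fset_sum1 big_imfset2 /=; last by move=> [? ?] [? ?] _ _ /= [-> ->].
  rewrite mulnC (card_fset_sum1 (addS X A)) big_distrr /=; apply: eq_bigr => i _.
  by rewrite muln1 card_fset_sum1.
apply: (@card_prod_le _ _ _ (fun d x => (x + (p d).1, x + (p d).2))).
  by move=> d x /pP[? ? _] xX; rewrite in_fsetM /= !mem_addS.
move=> d x d' x' dD xX d'D x'X [e1 e2].
have [_ _ ed] := pP _ dD; have [_ _ ed'] := pP _ d'D.
have dd' : d = d'.
  have k (y z w : G) : z - w = (y + z) - (y + w) by rewrite opprD addrACA subrr add0r.
  by rewrite ed (k x) e1 e2 -k -ed'.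
by split=> //; move: e1; rewrite dd' => /addIr.
Qed.

Definition min_ratio A B X :=
  [/\ X `<=` A, X != fset0 & forall Z, Z `<=` X ->
    (#|` addS X B| * #|` Z| <= #|` addS Z B| * #|` X|)%N].

Lemma min_ratio_exists A B : A != fset0 -> exists X,
  min_ratio A B X /\ (#|` addS X B| * #|` A| <= #|` addS A B| * #|` X|)%N.
Proof.
have [n] := ubnP #|` A|; elim: n A => // n IH A An A0.
case: (pselect (exists Z, [/\ Z `<=` A, Z != fset0 & (#|` addS Z B| * #|` A| < #|` addS A B| * #|` Z|)%N])).
  move=> [Z [ZA Z0 lt]].
  have ltZA : (#|` Z| < #|` A|)%N.
    rewrite ltn_neqAle fsubset_leq_card // andbT; apply: contraTneq lt.
    by move=> /(fsubset_cardP) /(_ ZA) /fsetP ->; rewrite ltnn.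
  have [X [[XZ X0 mX] le]] := IH Z (leq_trans ltZA An) Z0.
  exists X; split; first by split=> //; exact: fsubset_trans XZ ZA.
  have Zp : (0 < #|` Z|)%N by rewrite cardfs_gt0.
  rewrite -(leq_pmul2r Zp) -mulnA (mulnC #|` A|) mulnA.
  apply: (leq_trans (leq_mul le (leqnn _))).
  by rewrite mulnAC [leqRHS]mulnAC leq_mul2r ltnW ?orbT.
move=> nex; exists A; split=> //; split=> // Z ZA.
have [->|Z0] := eqVneq Z fset0; first by rewrite cardfs0 muln0.
by rewrite leqNgt; apply/negP => lt; apply: nex; exists Z.
Qed.

(** Petridis's induction, adding one element [c] to [C']. The part [X'] of [X] whose translates by c
    + B are already covered saves |X' + B| sums on the left, and X + C gains at least |X| - |X'|
    elements on the right. Minimality of the ratio of [X] against [X'] balances the two. *)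
Lemma petridis A B X C : min_ratio A B X ->
  (#|` addS (addS X B) C| * #|` X| <= #|` addS X B| * #|` addS X C|)%N.
Proof.
move=> [XA X0 mX]; have [n] := ubnP #|` C|; elim: n C => // n IH C Cn.
have [->|/fset0Pn[c cC]] := eqVneq C fset0.
  rewrite (_ : addS _ fset0 = fset0) ?cardfs0 //.
  by apply/fsetP => x; rewrite inE; apply/negbTE/addSP => -[? [? []]]; rewrite inE.
pose C' := C `\ c.
have eC : #|` C| = #|` C'|.+1 by rewrite (cardfsD1 c) cC.
have {}IH : (#|` addS (addS X B) C'| * #|` X| <= #|` addS X B| * #|` addS X C'|)%N.
  by apply: IH; rewrite -ltnS -eC.
pose X' := [fset x in X | [fset x + c + b | b in B] `<=` addS (addS X B) C'].
have X'X : X' `<=` X by apply/fsubsetP => x; rewrite !inE => /andP[].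
have X'B : addS X' B `<=` addS X B by apply: addSS.
have CE x : x \in C -> x = c \/ x \in C'.
  by rewrite /C' !inE; case: eqP => [->|_]; [left|right].
have h1 : (#|` addS (addS X B) C| + #|` addS X' B| <= #|` addS (addS X B) C'| + #|` addS X B|)%N.
  have s : addS (addS X B) C `<=` addS (addS X B) C' `|` [fset y + c | y in addS X B `\` addS X' B].
    apply/fsubsetP => _ /addSP[y [e [yXB /CE[->|eC'] ->]]]; rewrite inE; last by rewrite mem_addS.
    case: (boolP (y \in addS X' B)) => [/addSP[x [b [xX' bB ->]]]|yn].
      move: xX'; rewrite !inE => /andP[_ /fsubsetP /(_ (x + c + b))].
      rewrite (addrAC x b c) => -> //; apply/imfsetP; exists b => //.
    apply/orP; right; apply/imfsetP; exists y => //.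
    by rewrite inE yn yXB.
  have := leq_trans (fsubset_leq_card s) (leq_card_fsetU _ _).
  rewrite card_translate cardfsDS // => h.
  have := fsubset_leq_card X'B; lia.
have h2 : (#|` addS X C'| + #|` X| <= #|` addS X C| + #|` X'|)%N.
  have d : addS X C' `|` [fset x + c | x in X `\` X'] `<=` addS X C.
    apply/fsubsetP => z; rewrite inE => /orP[|/imfsetP[x /=]].
      by apply/fsubsetP; apply: addSS => //; apply/fsubsetP => y; rewrite !inE => /andP[].
    by rewrite inE => /andP[_ xX] ->; exact: mem_addS.
  have i0 : addS X C' `&` [fset x + c | x in X `\` X'] = fset0.
    apply/fsetP => z; rewrite !inE; apply/negbTE/negP => /andP[zXC' /imfsetP[x /=]].
    rewrite !inE => /andP[+ xX] ez; rewrite xX /= => /negP; apply.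
    apply/fsubsetP => _ /imfsetP[b /= bB ->].
    move: zXC'; rewrite ez => /addSP[x' [c' [x'X c'C ->]]].
    by rewrite addrAC mem_addS // mem_addS.
  have := fsubset_leq_card d; rewrite cardfsU i0 cardfs0 card_translate cardfsDS //.
  have := fsubset_leq_card X'X; lia.
have h3 := mX _ X'X; have := fsubset_leq_card X'X; have := fsubset_leq_card X'B.
move: h1 h2 h3 IH; nia.
Qed.

Definition nS n A : {fset G} := iter n (addS A) [fset 0].

Lemma nSS n A : nS n.+1 A = addS A (nS n A). Proof. by []. Qed.

(** For a subset [X] of minimal ratio, [petridis] makes each further summand [A] cost a factor [K]
    relative to |X|. The triangle inequality through [X] then bounds the difference set. *)
Lemma plunnecke K A n m : A != fset0 -> (#|` addS A A| <= K * #|` A|)%N ->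
  (#|` subS (nS n A) (nS m A)| <= K ^ (n + m) * #|` A|)%N.
Proof.
move=> A0 hA; have [X [mX le]] := min_ratio_exists A A0.
have [XA X0 _] := mX; have Xp : (0 < #|` X|)%N by rewrite cardfs_gt0.
have Ap : (0 < #|` A|)%N by rewrite cardfs_gt0.
have {}le : (#|` addS X A| <= K * #|` X|)%N by rewrite -(leq_pmul2r Ap); nia.
have hn k : (#|` addS X (nS k A)| <= K ^ k * #|` X|)%N.
  elim: k => [|k IH].
    rewrite expn0 mul1n (_ : addS X _ = X) //; apply/fsetP => x.
    apply/addSP/idP => [[a [b [aX + ->]]]|xX]; first by rewrite inE => /eqP ->; rewrite addr0.
    by exists x, 0; rewrite addr0 inE eqxx.
  rewrite nSS addSA expnS -(leq_pmul2r Xp); apply: (leq_trans (petridis _ mX)).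
  have := leq_mul le IH; nia.
have := ruzsa_triangle (nS n A) (nS m A) X; rewrite expnD.
have := leq_mul (hn n) (hn m) => h1 h2; have := fsubset_leq_card XA.
have : (#|` subS (nS n A) (nS m A)| * #|` X| <= K ^ n * K ^ m * #|` X| * #|` X|)%N by nia.
rewrite leq_pmul2r // => h3 h4; apply: (leq_trans h3); rewrite leq_mul2l h4 orbT //.
Qed.

End Sumsets.

(** * Differences of iterated sums *)

Section Dif.
Variable G : zmodType.
Implicit Types (A B : {fset G}) (x y : G).

(** Membership in kA - kA. Lists of summands make sums, negatives and homomorphic images immediate;
    equal lengths allow padding by a - a. *)
Definition dif A k x := exists s t : seq G,
  [/\ size s = k, size t = k, {subset s <= A}, {subset t <= A}
    & x = \sum_(a <- s) a - \sum_(b <- t) b].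

Lemma dif0 A : dif A 0 0.
Proof. by exists [::], [::]; split=> //; rewrite !big_nil subrr. Qed.

Lemma dif1 A a b : a \in A -> b \in A -> dif A 1 (a - b).
Proof.
move=> aA bA; exists [:: a], [:: b]; rewrite !big_seq1.
by split=> // z; rewrite inE => /eqP ->.
Qed.

Lemma difD A k l x y : dif A k x -> dif A l y -> dif A (k + l) (x + y).
Proof.
move=> [s [t [sk tk sA tA ->]]] [s' [t' [sl tl s'A t'A ->]]].
exists (s ++ s'), (t ++ t'); rewrite !size_cat !big_cat /= sk tk sl tl opprD addrACA.
split=> // z; rewrite mem_cat => /orP[]; [exact: sA|exact: s'A|exact: tA|exact: t'A].
Qed.

Lemma difN A k x : dif A k x -> dif A k (- x).
Proof. by move=> [s [t [? ? ? ? ->]]]; exists t, s; rewrite opprB. Qed.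

Lemma dif_n0 A k : A != fset0 -> dif A k 0.
Proof.
case/fset0Pn => a aA; elim: k => [|k IH]; first exact: dif0.
by rewrite -(addr0 0) -addn1; apply: difD => //; rewrite -(subrr a); exact: dif1.
Qed.

Lemma dif_mono A k l x : A != fset0 -> (k <= l)%N -> dif A k x -> dif A l x.
Proof.
by move=> A0 kl /(difD)/(_ (dif_n0 (l - k) A0)); rewrite addr0 subnKC.
Qed.

Lemma dif_sub A B k x : A `<=` B -> dif A k x -> dif B k x.
Proof.
move=> /fsubsetP AB [s [t [? ? sA tA ->]]]; exists s, t; split=> // z.
  by move/sA/AB.
by move/tA/AB.
Qed.

Lemma dif1E A x : dif A 1 x -> x \in subS A A.
Proof.
move=> [[|a [|? ?]] [[|b [|? ?]] []]] //= _ _ sA tA ->; rewrite !big_seq1.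
by apply: mem_subS; [apply: sA|apply: tA]; rewrite inE.
Qed.

Lemma difS A k x : dif A k.+1 x -> exists y z, [/\ dif A k y, dif A 1 z & x = y + z].
Proof.
move=> [[|a s] [[|b t] []]] //= [sk] [tk] sA tA ->.
exists (\sum_(a <- s) a - \sum_(b <- t) b), (a - b); split.
- exists s, t; split=> // z zs; [apply: sA|apply: tA]; rewrite inE zs orbT //.
- by apply: dif1; [apply: sA|apply: tA]; rewrite inE eqxx.
- by rewrite !big_cons opprD addrACA addrC.
Qed.

Lemma nS1 A : nS 1 A = A.
Proof.
apply/fsetP => x; apply/addSP/idP => [[a [b [aA + ->]]]|xA].
  by rewrite inE => /eqP ->; rewrite addr0.
by exists x, 0; rewrite addr0 inE eqxx.
Qed.

Lemma mem_nS (s : seq G) A : {subset s <= A} -> \sum_(a <- s) a \in nS (size s) A.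
Proof.
elim: s => [|a s IH] sA; first by rewrite big_nil inE.
rewrite big_cons nSS; apply: mem_addS; first by apply: sA; rewrite inE eqxx.
by apply: IH => z zs; apply: sA; rewrite inE zs orbT.
Qed.

Lemma dif_nS A k x : dif A k x -> x \in subS (nS k A) (nS k A).
Proof.
move=> [s [t [sk tk sA tA ->]]]; apply: mem_subS; first by rewrite -sk; exact: mem_nS.
by rewrite -tk; exact: mem_nS.
Qed.

End Dif.

Lemma dif_img (G H : zmodType) (f : {additive G -> H}) (A : {fset G}) k x :
  dif A k x -> dif (f @` A) k (f x).
Proof.
move=> [s [t [sk tk sA tA ->]]]; exists (map f s), (map f t).
rewrite !size_map raddfB !raddf_sum !big_map; split=> //.
  by move=> _ /mapP[z /sA zA ->]; apply/imfsetP; exists z.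
by move=> _ /mapP[z /tA zA ->]; apply/imfsetP; exists z.
Qed.

(** * Sets with very small doubling *)

Section SmallDoubling.
Variable G : zmodType.
Implicit Types (X U : {fset G}).

(** Inclusion-exclusion for the translates X + p and X + q inside [U]. When |U| < 3|X|/2, their
    overlap exceeds |X|/2, which makes q - p a popular difference. *)
Lemma popular_translate X U p q :
  (forall x, x \in X -> x + p \in U) -> (forall x, x \in X -> x + q \in U) ->
  (2 * #|` X| <= #|` U| + #|` [fset x in X | (x - (q - p))%R \in X]|)%N.
Proof.
move=> hp hq; pose Xp := [fset x + p | x in X]; pose Xq := [fset x + q | x in X].
have : (#|` Xp `|` Xq| <= #|` U|)%N.
  apply: fsubset_leq_card; apply/fsubsetP => z; rewrite inE.
  by case/orP => /imfsetP[x /= xX ->]; [exact: hp|exact: hq].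
have := cardfsUI Xp Xq; rewrite !card_translate.
suff : (#|` Xp `&` Xq| <= #|` [fset x in X | (x - (q - p))%R \in X]|)%N by lia.
apply: (@card_le_inj _ _ (fun z => z - p)); first by move=> ? ? _ _ /addIr.
move=> z; rewrite inE => /andP[/imfsetP[x /= xX ->] /imfsetP[y /= yX e]].
by rewrite !inE addrK xX /= opprB addrA e addrK.
Qed.

(* Two differences that both have more than |X|/2 representations have
   representations with a common term. *)
Lemma popular_subgroup X :
  (forall d, d \in subS X X -> (#|` X| < 2 * #|` [fset x in X | (x - d)%R \in X]|)%N) ->
  forall d d', d \in subS X X -> d' \in subS X X -> d - d' \in subS X X.
Proof.
move=> H d d' /H h /H h'.
set B := [fset x in X | x - d \in X] in h; set B' := [fset x in X | x - d' \in X] in h'.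
have : (#|` B `|` B'| <= #|` X|)%N.
  by apply: fsubset_leq_card; apply/fsubsetP => x; rewrite !inE => /orP[] /andP[].
have := cardfsUI B B' => e1 e2.
have : (0 < #|` B `&` B'|)%N by lia.
rewrite cardfs_gt0 => /fset0Pn[x]; rewrite !inE => /andP[/andP[_ xd] /andP[_ xd']].
by apply/subSP; exists (x - d'), (x - d); split=> //; rewrite opprB [RHS]addrC addrA subrK.
Qed.

Lemma small_sum_subgroup X : (2 * #|` addS X X| < 3 * #|` X|)%N ->
  forall d d', d \in subS X X -> d' \in subS X X -> d - d' \in subS X X.
Proof.
move=> h; apply: popular_subgroup => d /subSP[a [b [aX bX ->]]].
have := @popular_translate X (addS X X) b a.
by move/(_ (fun x xX => mem_addS xX bX) (fun x xX => mem_addS xX aX)); lia.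
Qed.

Lemma small_diff_subgroup X : (2 * #|` subS X X| < 3 * #|` X|)%N ->
  forall d d', d \in subS X X -> d' \in subS X X -> d - d' \in subS X X.
Proof.
move=> h; apply: popular_subgroup => d /subSP[a [b [aX bX ->]]].
have := @popular_translate X (subS X X) (- a) (- b).
move/(_ (fun x xX => mem_subS xX aX) (fun x xX => mem_subS xX bX)).
have -> : - b - - a = a - b by rewrite opprK addrC.
by lia.
Qed.

End SmallDoubling.

(** * A large set all of whose elements have many multiples in [2A - 2A] *)

Section Sanders.
Variable G : zmodType.
Implicit Types (A B S : {fset G}).

Definition sum_robust A B q N :=
  forall B', B' `<=` B -> (#|` A| <= q * #|` B'|)%N ->
    (N * #|` addS B A| <= N.+1 * #|` addS B' A|)%N.

(** If |A| <= m|B|, the threshold 2 K^2 m^2 is chosen so that differences with fewer than |A| / (2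
    K^2 m^2) representations cover at most half of the pairs of B x B. Each failure of robustness
    replaces [m] by this threshold; the maximum bounds every stage. *)
Fixpoint robust_const (K m n : nat) : nat :=
  if n is n'.+1 then maxn m (robust_const K (2 * K ^ 2 * m ^ 2)%N n') else m.

(* Passing to a subset that violates robustness shrinks [B + A] by a factor
   [N / (N + 1)], which can happen only boundedly often. *)
Lemma exists_robust A K N n m B : A != fset0 -> B `<=` A -> (#|` A| <= m * #|` B|)%N ->
  (#|` addS B A| * N ^ n <= N.+1 ^ n * #|` A|)%N ->
  exists m' B', [/\ (m' <= robust_const K m n)%N, B' `<=` A, (#|` A| <= m' * #|` B'|)%N
    & sum_robust A B' (2 * K ^ 2 * m' ^ 2)%N N].
Proof.
move=> A0; elim: n m B => [|n IH] m B BA Bm.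
  (* With the budget exhausted, |B + A| <= |A|, and no non-empty [B'] has a smaller sumset. *)
  rewrite !expn0 muln1 mul1n => le; exists m, B; split=> // B' B'B qB'.
  have B'0 : B' != fset0.
    by apply: contraNneq A0 => e; move: qB'; rewrite e cardfs0 muln0 leqn0 cardfs_eq0.
  by have := card_addS_ger A B'0; nia.
move=> le; have [rob|] := pselect (sum_robust A B (2 * K ^ 2 * m ^ 2)%N N).
  by exists m, B; split=> //=; rewrite leq_maxl.
move/existsNP => [B' /not_implyP[B'B /not_implyP[qB' /negP]]]; rewrite -ltnNge => lt.
have [|m' [B'' [m'le *]]] := IH (2 * K ^ 2 * m ^ 2)%N B' (fsubset_trans B'B BA) qB'; last first.
  by exists m', B''; split=> //=; rewrite leq_max m'le orbT.
move: le; rewrite !expnS; move: (N ^ n)%N (N.+1 ^ n)%N => x y le.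
rewrite -(leq_pmul2l (ltn0Sn N)) mulnA.
apply: (@leq_trans (N * #|` addS B A| * x)%N); first by rewrite leq_mul2r ltnW ?orbT.
by move: le; lia.
Qed.

(** Each further translation by [s] loses at most |Y| / (N + 1) points, so the losses are linear in
    [j]. *)
Lemma shift_inter_multiples (Y : {fset G}) s N :
  (N * #|` Y| <= N.+1 * #|` [fset y in Y | (y + s)%R \in Y]|)%N ->
  forall j, (j * #|` Y| + N.+1 * #|` [fset y in Y | (y + s *+ j)%R \in Y]| >= N.+1 * #|` Y|)%N.
Proof.
move=> h; elim=> [|j IH].
  rewrite mul0n (_ : [fset _ | _ in _ & _] = Y) //.
  by apply/fsetP => y; rewrite !inE mulr0n addr0 andbb.
set P := [fset y in Y | y + s *+ j \in Y] in IH; set Q := [fset y in Y | y + s \in Y] in h.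
set Q' := [fset y in Y | y + s *+ j.+1 \in Y].
have QY : Q `<=` Y by apply/fsubsetP => y; rewrite !inE => /andP[].
suff : (#|` P| + #|` Q| <= #|` Y| + #|` Q'|)%N by have := fsubset_leq_card QY; nia.
pose Ps : {fset G} := [fset y + s *+ j | y in P].
have eP : #|` Ps| = #|` P| by rewrite card_translate.
have : (#|` Ps `|` Q| <= #|` Y|)%N.
  apply: fsubset_leq_card; rewrite fsubUset QY andbT.
  by apply/fsubsetP => _ /imfsetP[y /= yP ->]; move: yP; rewrite !inE => /andP[].
have := cardfsUI Ps Q; rewrite eP.
suff : (#|` Ps `&` Q| <= #|` Q'|)%N by lia.
apply: (@card_le_inj _ _ (fun z => z - s *+ j)); first by move=> ? ? _ _ /addIr.
move=> z; rewrite inE => /andP[/imfsetP[y /= yP ->]].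
move: yP; rewrite !inE addrK => /andP[-> _] /andP[_]; by rewrite mulrSr addrA.
Qed.

End Sanders.

(** Bernoulli's inequality: (1 + 1/N)^(NK) >= 1 + K. It shows that [N * K] shrinkings exhaust the
    initial bound |A + A| <= K|A|. *)
Lemma expn_ratio K N : (0 < N)%N -> (K * N ^ (N * K) <= N.+1 ^ (N * K))%N.
Proof.
move=> N0; have H n : (N ^ n * (N + n) <= N * N.+1 ^ n)%N.
  by elim: n => [|n IH]; rewrite ?expn0 ?addn0 ?muln1 ?mul1n // !expnS; move: (N ^ n)%N (N.+1 ^ n)%N IH; nia.
have := H (N * K)%N; rewrite -(leq_pmul2l N0); set u := (N ^ _)%N; set w := (N.+1 ^ _)%N.
nia.
Qed.

(* If [B] meets [B + s] in a large set and [B] is robust, then [B + A] is almost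
   invariant under [s], hence meets its translates by all small multiples of
   [s]; popular differences of [B] are such [s]. *)
Lemma many_multiples K T : exists M, forall (G : zmodType) (A : {fset G}),
  A != fset0 -> (#|` addS A A| <= K * #|` A|)%N ->
  exists S : {fset G}, (#|` A| <= M * #|` S|)%N /\
    forall s j, s \in S -> (j <= T)%N -> dif A 2 (s *+ j).
Proof.
pose N := T.+1; exists (2 * robust_const K 1 (N * K)%N)%N => G A A0 hA.
have Ap : (0 < #|` A|)%N by rewrite cardfs_gt0.
have [|||m [B [mM BA Bm rob]]] := @exists_robust G A K N (N * K)%N 1 A A0.
- exact: fsubset_refl.
- by rewrite mul1n.
- apply: (@leq_trans (K * #|` A| * N ^ (N * K))%N); first by rewrite leq_mul2r hA orbT.
  by rewrite mulnAC leq_mul2r expn_ratio ?orbT.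
pose rep s := [fset b in B | b + s \in B].
pose q := (2 * K ^ 2 * m ^ 2)%N.
pose S := [fset s in subS B B | (#|` A| <= q * #|` rep s|)%N].
have Bp : (0 < #|` B|)%N by move: Bm Ap; case: (#|` B|) => //; rewrite muln0; lia.
have eB : (#|` B| * #|` B| = \sum_(s <- subS B B) #|` rep s|)%N.
  transitivity (\sum_(b <- B) #|` [fset s in subS B B | (b + s)%R \in B]|)%N; last first.
    by rewrite (double_count (fun b s => b + s \in B)).
  rewrite {1}card_fset_sum1 big_distrl /= big_seq [RHS]big_seq; apply: eq_bigr => b bB.
  rewrite mul1n; apply/eqP; rewrite eqn_leq; apply/andP; split.
    apply: (@card_le_inj _ _ (fun c => c - b)); first by move=> ? ? _ _ /addIr.
    by move=> c cB; rewrite !inE mem_subS // addrC subrK.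
  apply: (@card_le_inj _ _ (fun s => b + s)); first by move=> ? ? _ _ /addrI.
  by move=> s; rewrite !inE => /andP[].
have hBB : (#|` subS B B| <= K ^ 2 * #|` A|)%N.
  apply: leq_trans (_ : #|` subS A A| <= _)%N.
    apply: fsubset_leq_card; apply/fsubsetP => _ /subSP[a [b [aB bB ->]]].
    by apply: mem_subS; apply: (fsubsetP BA).
  by have := plunnecke 1 1 A0 hA; rewrite !nS1.
have S_sub : S `<=` subS B B by apply/fsubsetP => s; rewrite !inE => /andP[].
(* There are at most K^2 |A| differences in all, and each outside [S] has fewer than |A| / q
   representations. By the choice of [q] these cover at most |B|^2 / 2 pairs, so [S] must cover the
   rest. *)
have hS : (q * (#|` B| * #|` B|) <= q * (#|` S| * #|` B|) + K ^ 2 * #|` A| * #|` A|)%N.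
  rewrite eB (big_fsetID _ (mem S)) /= mulnDr; apply: leq_add.
    rewrite leq_mul2l; apply/orP; right.
    apply: (@leq_trans (\sum_(i <- [fset x in subS B B | x \in S]) #|` B|)%N).
      by apply: leq_sum => s _; apply: fsubset_leq_card; apply/fsubsetP => b; rewrite !inE => /andP[].
    rewrite big_const_seq count_predT iter_addn_0 mulnC leq_mul2r; apply/orP; right.
    by apply: fsubset_leq_card; apply/fsubsetP => s; rewrite !inE => /andP[_ ->].
  rewrite big_distrr /=; apply: (@leq_trans (\sum_(i <- [fset x in subS B B | x \notin S]) #|` A|)%N).
    rewrite big_seq [leqRHS]big_seq; apply: leq_sum => s; rewrite !inE => /andP[sB].
    by rewrite sB /= -ltnNge => /ltnW.
  rewrite big_const_seq count_predT iter_addn_0 mulnC leq_mul2r; apply/orP; right.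
  apply: leq_trans hBB; apply: fsubset_leq_card.
  by apply/fsubsetP => s; rewrite !inE => /andP[].
have K0 : (0 < K)%N.
  by have := card_addS_gel A A0; move: hA; case: (K) => //; rewrite mul0n; lia.
have mp : (0 < m)%N by move: Bm; case: (m) => //; rewrite mul0n; lia.
exists S; split.
  have hB2 : (#|` B| <= 2 * #|` S|)%N.
    have e : (K ^ 2 * #|` A| * #|` A| <= K ^ 2 * m ^ 2 * (#|` B| * #|` B|))%N.
      have := leq_mul Bm Bm; rewrite -!mulnn; nia.
    have cp : (0 < K ^ 2 * m ^ 2 * #|` B|)%N by move: K0 mp Bp; rewrite -!mulnn; nia.
    rewrite -(leq_pmul2l cp); move: hS e; rewrite /q -(mulnA 2).
    by move: (K ^ 2 * m ^ 2)%N (K ^ 2 * _ * _)%N => x y; nia.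
  apply: leq_trans Bm _; rewrite mulnAC mulnC [leqRHS]mulnC.
  by rewrite [leqRHS]mulnC; apply: leq_mul => //; lia.
move=> s j sS jT; set Y := addS B A.
have hY : (N * #|` Y| <= N.+1 * #|` [fset y in Y | (y + s)%R \in Y]|)%N.
  have := rob (rep s); rewrite -/Y; move: sS; rewrite !inE => /andP[_ qs] /(_ _ qs).
  move=> /(_ _) h; apply: leq_trans (h _) _.
    by apply/fsubsetP => b; rewrite !inE => /andP[].
  rewrite leq_mul2l /=; apply: fsubset_leq_card; apply/fsubsetP => _ /addSP[b [a [+ aA ->]]].
  by rewrite !inE => /andP[bB bsB]; rewrite mem_addS //= addrAC mem_addS.
(* Since j <= T < N + 1, some point of B + A stays in B + A after translation by [s *+ j]. This
   writes [s *+ j] as a difference in B - B plus one in A - A. *)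
have := shift_inter_multiples hY j.
set Q := [fset y in Y | _] => hQ.
have Yp : (0 < #|` Y|)%N by apply: leq_trans Bp _; exact: card_addS_gel.
have : (0 < #|` Q|)%N by rewrite /N in hQ; move: hQ Yp jT; case: (#|` Q|) => //; nia.
rewrite cardfs_gt0 => /fset0Pn[y]; rewrite !inE => /andP[/addSP[b [a [bB aA ->]]]].
move=> /addSP[b' [a' [b'B a'A e]]].
have -> : s *+ j = (b' - b) + (a' - a).
  by rewrite addrACA -e -opprD addrAC subrr add0r.
by apply: (@difD _ _ 1 1); apply: dif1 => //; exact: (fsubsetP BA).
Qed.

(** * Quotients by a cyclic subgroup *)

Section Quotient.
Variables (G : zmodType) (q : G -> G).
Hypothesis qD : forall x y, q (q x + y) = q (x + y).

(* The quotient of [G] as the set of values of a choice [q] of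
   representatives. *)
Definition quot (_ : forall x y, q (q x + y) = q (x + y)) := {x : G | q x == x}.
Local Notation Q := (quot qD).
HB.instance Definition _ := Choice.on Q.

Lemma q_idem x : q (q x) == q x.
Proof. by have := qD x 0; rewrite !addr0 => ->. Qed.

Definition quot_pi x : Q := exist _ (q x) (q_idem x).

Lemma quot_val (x : Q) : q (val x) = val x.
Proof. by apply/eqP; exact: valP x. Qed.

Lemma qDr x y : q (x + q y) = q (x + y).
Proof. by rewrite addrC qD addrC. Qed.

Let qadd (x y : Q) := quot_pi (val x + val y).
Let qopp (x : Q) := quot_pi (- val x).

Lemma qaddA : associative qadd.
Proof. by move=> x y z; apply: val_inj; rewrite /= qD qDr addrA. Qed.
Lemma qaddC : commutative qadd.
Proof. by move=> x y; apply: val_inj; rewrite /= addrC. Qed.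
Lemma qadd0 : left_id (quot_pi 0) qadd.
Proof. by move=> x; apply: val_inj; rewrite /= qD add0r quot_val. Qed.
Lemma qaddN : left_inverse (quot_pi 0) qopp qadd.
Proof. by move=> x; apply: val_inj; rewrite /= qD addNr. Qed.

HB.instance Definition _ := GRing.isZmodule.Build Q qaddA qaddC qadd0 qaddN.

Lemma quot_pi_additive : zmod_morphism quot_pi.
Proof.
move=> x y; apply: val_inj; rewrite /= qDr qD.
have := qD y (x - y - q y).
have -> : q y + (x - y - q y) = x - y by rewrite addrC subrK.
by have -> : y + (x - y - q y) = x - q y by rewrite !addrA (addrC y) addrK.
Qed.

End Quotient.

(** Euclidean division of [theta x] by [theta u] selects the representative of x modulo [u], which
    also yields a section with bounded [theta]. *)
Lemma cyclic_quotient (G : zmodType) (theta : {additive G -> int}) (u : G) :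
  0 < theta u -> exists (Q : zmodType) (pi : {additive G -> Q}) (sec : Q -> G),
  [/\ cancel sec pi, forall x y, pi x = pi y <-> exists k : int, x - y = u *~ k
    & forall c, 0 <= theta (sec c) < theta u].
Proof.
move=> u0; pose q x := x - u *~ (theta x %/ theta u)%Z.
have thq x : theta (q x) = (theta x %% theta u)%Z.
  by rewrite raddfB raddfMz -mulrzl intz /modz.
have qD x y : q (q x + y) = q (x + y).
  rewrite /q; set k := (theta x %/ theta u)%Z.
  have -> : theta (x - u *~ k + y) = - k * theta u + theta (x + y).
    by rewrite !raddfD raddfN raddfMz -mulrzl intz; ring.
  by rewrite divzMDl ?gt_eqF // mulrzDr mulrNz opprD opprK addrACA !addrA addrNK addrAC.
pose Q : zmodType := quot qD.
pose pi : G -> Q := quot_pi qD.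
pose mix := GRing.isZmodMorphism.Build G Q pi (quot_pi_additive qD).
pose piA : {additive G -> Q} := HB.pack pi mix.
exists Q, piA, (fun c : Q => val c); split.
- by move=> c; apply: val_inj; rewrite /= quot_val.
- move=> x y; split=> [e|[k e]].
    have : q x = q y by exact: (congr1 val e).
    rewrite /q => e'; exists ((theta x %/ theta u)%Z - (theta y %/ theta u)%Z).
    rewrite mulrzBr; move: e'; set p := u *~ _; set p' := u *~ _ => e'.
    by rewrite -[x](subrK p) e' -(addrA y) addrAC subrr add0r addrC.
  have q0 : q (u *~ k) = q 0.
    have thk : theta (u *~ k) = k * theta u by rewrite raddfMz -mulrzl intz.
    rewrite /q thk mulzK ?gt_eqF // raddf0 div0z subrr.
    by rewrite mulr0z subr0.
  by apply: val_inj => /=; rewrite -[x](subrK y) e -(qD (u *~ k)) q0 qD add0r.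
- move=> c; have -> : val c = q (val c) by rewrite quot_val.
  by rewrite thq modz_ge0 ?gt_eqF // ltz_pmod.
Qed.

(** * Projecting a sumset along the lines of one direction *)

Lemma fset_argmax (I : choiceType) (R : realDomainType) (f : I -> R) (A : {fset I}) :
  A != fset0 -> exists2 x, x \in A & forall y, y \in A -> f y <= f x.
Proof.
case/fset0Pn => a aA; suff [x xA H] : exists2 x, x \in A & forall y, y \in enum_fset A -> f y <= f x.
  by exists x.
suff H (s : seq I) : {subset s <= A} -> exists2 x, x \in A & forall y, y \in s -> f y <= f x.
  by apply: H => y.
elim: s => [|b s IH] sA; first by exists a.
have [y ys|x xA xs] := IH; first by apply: sA; rewrite inE ys orbT.
have bA : b \in A by apply: sA; rewrite inE eqxx.
have [le|/ltW le] := leP (f b) (f x).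
  by exists x => // y; rewrite inE => /orP[/eqP -> //|/xs].
by exists b => // y; rewrite inE => /orP[/eqP -> //|/xs /le_trans]; apply.
Qed.

(** With [m] the minimum of [X] and [M] the maximum of [Y], the translates m + Y and X + M share
    only m + M. *)
Lemma card_addS_int (X Y : {fset int}) : X != fset0 -> Y != fset0 ->
  (#|` X| + #|` Y| <= #|` addS X Y| + 1)%N.
Proof.
move=> X0 Y0; have [M MY hM] := fset_argmax (fun x : int => x) Y0.
have [m mX hm] := fset_argmax (fun x : int => - x) X0.
pose U : {fset int} := [fset x + m | x in Y]; pose W : {fset int} := [fset x + M | x in X].
have eU : #|` U| = #|` Y| by apply: card_imfset; exact: addIr.
have eW : #|` W| = #|` X| by apply: card_imfset; exact: addIr.
have UW : (#|` U `|` W| <= #|` addS X Y|)%N.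
  apply: fsubset_leq_card; apply/fsubsetP => z; rewrite inE => /orP[] /imfsetP[x /= xX ->].
    by rewrite addrC mem_addS.
  exact: mem_addS.
have : (#|` U `&` W| <= #|` [fset (m + M)%R]|)%N.
  apply: fsubset_leq_card; apply/fsubsetP => z; rewrite !inE.
  move=> /andP[/imfsetP[y /= yY ->] /imfsetP[x /= xX e]].
  have := hM y yY; have := hm x xX => /=; lia.
rewrite cardfs1; have := cardfsUI U W; lia.
Qed.

Lemma card_addS_line (G : zmodType) (f : {additive G -> int}) (A B : {fset G}) :
  {in A &, injective f} -> {in B &, injective f} -> A != fset0 -> B != fset0 ->
  (#|` A| + #|` B| <= #|` addS A B| + 1)%N.
Proof.
move=> fA fB A0 B0.
pose FA : {fset int} := [fset f x | x in A]; pose FB : {fset int} := [fset f x | x in B].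
pose FS : {fset int} := [fset f x | x in addS A B].
have eA : #|` FA| = #|` A| by apply: card_in_imfset.
have eB : #|` FB| = #|` B| by apply: card_in_imfset.
have n0 (X : {fset G}) : X != fset0 -> ([fset f x | x in X] : {fset int}) != fset0.
  by case/fset0Pn => x xX; apply/fset0Pn; exists (f x); apply/imfsetP; exists x.
have := card_addS_int (n0 _ A0) (n0 _ B0); rewrite -/FA -/FB eA eB => h.
apply: leq_trans h _; rewrite leq_add2r.
apply: (@leq_trans #|` FS|); last by rewrite /FS; exact: leq_imfset_card.
apply: fsubset_leq_card; apply/fsubsetP => _ /addSP[_ [_ [/imfsetP[a /= aA ->] /imfsetP[b /= bB ->] ->]]].
by apply/imfsetP; exists (a + b); rewrite ?raddfD //= mem_addS.
Qed.

Lemma sum_indicator_le (T n : nat) (P : nat -> bool) :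
  (forall s, s < T -> P s -> s < n)%N -> (\sum_(s < T) P s <= n)%N.
Proof.
move=> H; apply: (@leq_trans (\sum_(s < T) (s < n))%N).
  by apply: leq_sum => s _; case E: (P s) => //; rewrite H.
clear H P; elim: T n => [|T IH] n; first by rewrite big_ord0.
rewrite big_ord_recr /=; case: ltnP => [Tn|nT]; last by rewrite addn0 IH.
apply: (@leq_trans (\sum_(s < T) 1 + 1)%N); last by rewrite sum1_card card_ord addn1.
by rewrite leq_add2r; apply: leq_sum => s _; case: (_ < _)%N.
Qed.

Lemma sum_indicator_lt (T n : nat) : (n <= T)%N -> (\sum_(s < T) (s < n) = n)%N.
Proof.
move=> nT; rewrite -(subnKC nT) big_split_ord /= -[RHS]addn0; congr (_ + _)%N.
  by rewrite (eq_bigr (fun=> 1%N)) ?sum1_card ?card_ord // => i _; rewrite ltn_ord.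
by rewrite big1 // => i _; rewrite ltnNge leq_addr.
Qed.

Lemma card_filter_sum (I : choiceType) (A : {fset I}) (P : pred I) :
  (#|` [fset x in A | P x]| = \sum_(x <- A) P x)%N.
Proof. by rewrite card_fset_sum1 big_fset /= big_mkcond /=; apply: eq_bigr => i _; case: (P i). Qed.

Section Lines.
Variables (G Q : zmodType) (f : {additive G -> int}) (pi : {additive G -> Q}).
Hypothesis fpi : forall x y, pi x = pi y -> f x = f y -> x = y.
Implicit Types (A : {fset G}).

(** Superlevel sets of the fibre size, as in a layer-cake decomposition: they trade one set with
    uneven fibres for a family of sets in [Q] whose sizes sum to |A|. *)
Definition level A s : {fset Q} := [fset y in pi @` A | (s < #|` fiber pi A y|)%N].

Lemma level_lift A s y : y \in level A s -> exists2 a, a \in A & pi a = y.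
Proof. by rewrite !inE => /andP[/imfsetP[a /= aA ->] _]; exists a. Qed.

Lemma card_levels A T : (forall y, #|` fiber pi A y| <= T)%N ->
  (#|` A| = \sum_(s < T) #|` level A s|)%N.
Proof.
move=> hT; rewrite (card_fibers pi A).
transitivity (\sum_(y <- pi @` A) \sum_(s < T) (s < #|` fiber pi A y|))%N.
  by apply: eq_bigr => y _; rewrite sum_indicator_lt.
by rewrite exchange_big; apply: eq_bigr => s _; rewrite card_filter_sum.
Qed.

(* Fibers of sizes more than [s] over [y] and [y'] contribute a fiber of size
   at least [2 s + 1] over [y + y']. *)
Lemma sum_levels_le A T :
  (2 * \sum_(s < T) #|` addS (level A s) (level A s)| <=
   #|` addS A A| + #|` pi @` addS A A|)%N.
Proof.
rewrite (card_fibers pi (addS A A)).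
set Z := pi @` addS A A.
have -> : (\sum_(j <- Z) #|` fiber pi (addS A A) j| + #|` Z| =
           \sum_(z <- Z) (#|` fiber pi (addS A A) z| + 1))%N.
  by rewrite big_split /= -card_fset_sum1.
have -> : (\sum_(s < T) #|` addS (level A s) (level A s)| =
           \sum_(z <- Z) \sum_(s < T) (z \in addS (level A s) (level A s)))%N.
  rewrite exchange_big /=; apply: eq_bigr => s _; rewrite -card_filter_sum.
  congr (#|` _|); apply/fsetP => z; rewrite !inE andbC; case: (boolP (z \in addS _ _)) => //=.
  case/addSP => _ [_ [/level_lift[a aA <-] /level_lift[b bA <-] ->]].
  by apply/esym/imfsetP; exists (a + b); rewrite ?raddfD //= mem_addS.
rewrite big_distrr /=; apply: leq_sum => z _.
set F := #|` _|; have : (\sum_(s < T) (z \in addS (level A s) (level A s)) <= (F + 1) %/ 2)%N.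
  apply: (@sum_indicator_le T _ (fun s => z \in addS (level A s) (level A s))).
  move=> s _ /addSP[y [y' [yL y'L ez]]].
  suff : (2 * (s.+1) <= F + 1)%N by lia.
  have n0 w : w \in level A s -> (s < #|` fiber pi A w|)%N by rewrite !inE => /andP[].
  have inj w : {in fiber pi A w &, injective f}.
    by move=> a b; rewrite !inE => /andP[_ /eqP <-] /andP[_ /eqP eb]; apply: fpi.
  have := @card_addS_line _ f (fiber pi A y) (fiber pi A y') (inj _) (inj _).
  rewrite -!cardfs_gt0 => /(_ (leq_ltn_trans (leq0n s) (n0 _ yL)) (leq_ltn_trans (leq0n s) (n0 _ y'L))).
  have : (#|` addS (fiber pi A y) (fiber pi A y')| <= F)%N.
    apply: fsubset_leq_card; apply/fsubsetP => _ /addSP[a [b [+ + ->]]].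
    rewrite !inE => /andP[aA /eqP ea] /andP[bA /eqP eb].
    by rewrite mem_addS //= raddfD /= ea eb ez.
  move=> hF hl; rewrite mul2n -addnn; apply: (leq_trans (leq_add (n0 _ yL) (n0 _ y'L))).
  by apply: (leq_trans hl); rewrite leq_add2r.
by move: (\sum_(s < T) _)%N => n; lia.
Qed.

End Lines.

(** * Cutting into windows and projecting *)

Lemma card_dep_pairs (I J : choiceType) (K : {fset I}) (F : I -> {fset J}) :
  (#|` [fset ((i, x) : I * J) | i in K, x in F i]| = \sum_(i <- K) #|` F i|)%N.
Proof.
rewrite card_fset_sum1 big_imfset2 /=; last by move=> [? ?] [? ?] _ _ /= [-> ->].
by apply: eq_bigr => j _; rewrite card_fset_sum1.
Qed.

Definition iotaS (T : nat) : {fset nat} := [fset x in iota 0 T].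

Lemma in_iotaS T x : (x \in iotaS T) = (x < T)%N.
Proof. by rewrite !inE mem_iota. Qed.

Lemma card_iotaS T : #|` iotaS T| = T.
Proof. by rewrite card_fseq undup_id ?iota_uniq // size_iota. Qed.

Lemma divz_window (x w i : int) : 0 < w -> (x %/ w)%Z = i <-> i * w <= x < i * w + w.
Proof.
move=> w0; have e := divz_eq x w; have h := ltz_pmod x w0.
have h' := modz_ge0 x (lt0r_neq0 w0).
split=> [<-|/andP[h1 h2]]; first by lia.
nia.
Qed.

Section Windows.
Variables (G Q : zmodType) (theta : {additive G -> int}) (pi : {additive G -> Q}).
Variables (u : G) (T : nat).
Hypothesis u0 : 0 < theta u.
Hypothesis T0 : (0 < T)%N.
Hypothesis piE : forall x y, pi x = pi y <-> exists k : int, x - y = u *~ k.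
Implicit Types (A S : {fset G}).

Let tau := theta u.
Let w := T%:Z * tau.

Let w0 : 0 < w. Proof. by rewrite /w mulr_gt0. Qed.

Definition win (x : G) : int := (theta x %/ w)%Z.
Definition cell A i := fiber win A i.

Lemma winP x i : win x = i <-> i * w <= theta x < i * w + w.
Proof. exact: divz_window. Qed.

Lemma cell_bound A i x : x \in cell A i -> i * w <= theta x < i * w + w.
Proof. by rewrite in_fiber => /andP[_ /eqP /winP]. Qed.

Lemma theta_mul k : theta (u *~ k) = k * tau.
Proof. by rewrite raddfMz -mulrzl intz. Qed.

Lemma pi_theta_inj x y : pi x = pi y -> theta x = theta y -> x = y.
Proof.
case/piE => k e th; have : theta (x - y) = 0 by rewrite raddfB th subrr.
rewrite e theta_mul => /eqP; rewrite mulf_eq0 (gt_eqF u0) orbF => /eqP k0.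
by apply/eqP; rewrite -subr_eq0 e k0 mulr0z.
Qed.

(** Distinct points of one fibre differ by multiples of [u], so each of the [T] subintervals of
    length [tau] of the window holds at most one. *)
Lemma card_fiber_cell A i y : (#|` fiber pi (cell A i) y| <= T)%N.
Proof.
rewrite -[leqRHS]card_iotaS.
apply: (@card_le_inj _ _ (fun x => `|((theta x - i * w) %/ tau)%Z|%N)); last first.
  move=> x; rewrite in_fiber => /andP[/cell_bound h _]; rewrite in_iotaS.
  set d := theta x - i * w; have d0 : 0 <= d by rewrite /d; lia.
  have dw : d < w by rewrite /d; lia.
  have : (d %/ tau)%Z < T by rewrite ltz_divLR.
  have : 0 <= (d %/ tau)%Z by rewrite divz_ge0.
  by move: (d %/ tau)%Z => k; lia.
move=> x x'; rewrite in_fiber => /andP[/cell_bound hx /eqP <-].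
rewrite in_fiber => /andP[/cell_bound hx' /eqP e] h.
have /piE[k ek] := e.
have ge y0 : i * w <= theta y0 -> 0 <= ((theta y0 - i * w) %/ tau)%Z.
  by move=> hy; rewrite divz_ge0 // subr_ge0.
have {}h : ((theta x - i * w) %/ tau)%Z = ((theta x' - i * w) %/ tau)%Z.
  move: h (ge x) (ge x'); have [hx1 _] := andP hx; have [hx1' _] := andP hx'.
  by move=> h /(_ hx1) g1 /(_ hx1') g2; lia.
apply: pi_theta_inj; first by rewrite e.
have : theta (x' - x) = k * tau by rewrite ek theta_mul.
rewrite raddfB => hk.
move: h; rewrite (_ : theta x' - i * w = k * tau + (theta x - i * w)); last by rewrite -hk; ring.
rewrite divzMDl ?gt_eqF //; move: (_ %/ _)%Z => D hD.
have k0 : k = 0 by lia.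
by move/eqP: hk; rewrite k0 mul0r subr_eq0 => /eqP ->.
Qed.

(** Sums of two points of window i have [theta] in the i-th interval of length 2w, so the doubled
    cells are disjoint. *)
Lemma sum_cells_le A :
  (\sum_(i <- win @` A) #|` addS (cell A i) (cell A i)| <= #|` addS A A|)%N.
Proof.
apply: (@sum_disjoint_le _ _ _ (fun i => addS (cell A i) (cell A i))
          (fun z => (theta z %/ (2 * w))%Z)).
  by move=> i _; apply: addSS; exact: fiber_sub.
move=> i z _ /addSP[x [y [/cell_bound hx /cell_bound hy ->]]].
by apply/divz_window; rewrite ?raddfD /=; lia.
Qed.

Lemma card_cells A : (#|` A| = \sum_(i <- win @` A) #|` cell A i|)%N.
Proof. exact: card_fibers. Qed.

(** One representative is taken for each pair (window, residue) and translated by [u *+ j] for j <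
    T. The residue is unchanged and [theta] moves by less than w, so the sum stays in its doubled
    window or enters the next one. A boolean records which, hence the factor 2. *)
Lemma card_proj_cells A : A != fset0 -> (forall j, (j < T)%N -> dif A 2 (u *+ j)) ->
  (T * \sum_(i <- win @` A) #|` (pi @` addS (cell A i) (cell A i) : {fset Q})| <=
   2 * #|` subS (nS 4 A) (nS 2 A)|)%N.
Proof.
move=> A0 hu; pose F i : {fset Q} := pi @` addS (cell A i) (cell A i).
rewrite -[in leqLHS](card_dep_pairs _ F); set P := [fset _ | i in _, x in _].
have H (p : int * Q) : exists x, p \in P -> x \in addS (cell A p.1) (cell A p.1) /\ pi x = p.2.
  case: (boolP (p \in P)) => [/imfset2P[i /= _ [y /= /imfsetP[x /= xS ->] ->]]|_]; last by exists 0.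
  by exists x.
have [r hr] := choice H.
pose B2 : {fset bool} := [fset true; false].
pose U := subS (nS 4 A) (nS 2 A).
have eU : #|` U `*` B2| = (2 * #|` U|)%N.
  rewrite card_dep_pairs (eq_bigr (fun=> 2%N)) => [|i _]; last by rewrite cardfs2.
  by rewrite big_const_seq count_predT iter_addn_0.
rewrite -/U -eU -{1}(card_iotaS T).
pose g (j : nat) (p : int * Q) : G * bool :=
  (r p + u *+ j, (theta (r p + u *+ j) %/ (2 * w))%Z == p.1).
have rb p : p \in P -> p.1 * (2 * w) <= theta (r p) < p.1 * (2 * w) + 2 * w.
  move=> /hr[/addSP[x [y [/cell_bound hx /cell_bound hy ->]]] _]; rewrite raddfD /=; lia.
have jb j : (j < T)%N -> 0 <= theta (u *+ j) < w.
  move=> jT; rewrite raddfMn -mulr_natr natz /w /tau; move: u0 jT.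
  by move: (theta u) => t t0 jT; nia.
apply: (@card_prod_le _ _ _ g).
  move=> j p jT pP; rewrite in_fsetM /=; apply/andP; split; last by move: (_ == p.1) => -[]; rewrite !inE.
  move: jT; rewrite in_iotaS => /hu /dif_nS /subSP[v [v' [vA v'A ->]]].
  have [/addSP[x [y [xA yA ->]]] _] := hr p pP.
  rewrite addrA; apply: mem_subS => //.
  have -> : nS 4 A = addS A (addS A (nS 2 A)) by [].
  rewrite -addrA; apply: mem_addS; first exact: (fsubsetP (fiber_sub _ _ _)) xA.
  by apply: mem_addS => //; exact: (fsubsetP (fiber_sub _ _ _)) yA.
move=> j p j' p' jT pP j'T p'P; rewrite /g => -[e1 e2].
move: jT j'T; rewrite !in_iotaS => jT j'T.
have [_ e2p] := hr p pP; have [_ e2p'] := hr p' p'P.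
have pu k : pi (u *+ k) = 0.
  have -> : 0 = pi 0 by rewrite raddf0.
  by apply/piE; exists k%:Z; rewrite subr0 pmulrn.
have ep2 : p.2 = p'.2.
  by rewrite -e2p -e2p' -[LHS]addr0 -(pu j) -raddfD /= e1 raddfD /= pu addr0.
have ep1 : p.1 = p'.1.
  have := rb p pP; have := rb p' p'P; have := jb j jT; have := jb j' j'T.
  move: e2; rewrite -e1; set z := theta (r p + _).
  have -> : theta (r p) = z - theta (u *+ j) by rewrite /z raddfD addrK.
  have -> : theta (r p') = z - theta (u *+ j') by rewrite /z e1 raddfD addrK.
  move=> e2 h1 h2 h3 h4.
  have w2 : 0 < 2 * w by rewrite mulr_gt0.
  have c q : (z %/ (2 * w))%Z == q <-> q * (2 * w) <= z < q * (2 * w) + 2 * w.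
    by split=> [/eqP/divz_window h|h]; [apply: h|apply/eqP/divz_window].
  case: (boolP ((z %/ (2 * w))%Z == p.1)) e2 => [E /esym E'|nE /esym /negbT nE'].
    by rewrite -(eqP E) -(eqP E').
  have h5 : p.1 * (2 * w) + 2 * w <= z.
    by rewrite leNgt; apply: contra nE => lt; apply/c; rewrite lt andbT; lia.
  have h6 : p'.1 * (2 * w) + 2 * w <= z.
    by rewrite leNgt; apply: contra nE' => lt; apply/c; rewrite lt andbT; case/andP: h3 => h3 _; case/andP: h1 => h1 _; apply: le_trans h3 _; rewrite gerBl.
  have q1 : (p.1 - p'.1) * (2 * w) < 1 * (2 * w).
    move: h5 h6 h1 h2 h3 h4; rewrite mulrBl mul1r.
    move: (p.1 * _) (p'.1 * _) (theta (u *+ j)) (theta (u *+ j')) => a b c1 c2.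
    by clear; move: w; lia.
  have q2 : (p'.1 - p.1) * (2 * w) < 1 * (2 * w).
    move: h5 h6 h1 h2 h3 h4; rewrite mulrBl mul1r.
    move: (p.1 * _) (p'.1 * _) (theta (u *+ j)) (theta (u *+ j')) => a b c1 c2.
    by clear; move: w; lia.
  move: q1 q2; rewrite !ltr_pM2r //; clear; lia.
have ep : p = p' by move: ep1 ep2; case: (p) (p') => ? ? [? ?] /= -> ->.
split=> //; move: e1; rewrite ep => /addrI /(congr1 theta).
by rewrite !raddfMn; apply: mulrIn; rewrite gt_eqF.
Qed.

(** Adding [S] to one representative per window moves it by at most tau <= w, that is, by at most
    one window. The pair (sum, shift of window in -1, 0, 1) determines both the window and the
    element of [S]. *)
Lemma card_win_le A S : (forall s, s \in S -> dif A 2 s) ->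
  (forall s, s \in S -> `|theta s| <= tau) ->
  (#|` win @` A| * #|` S| <= 3 * #|` subS (nS 3 A) (nS 2 A)|)%N.
Proof.
move=> S2 Sb; set U := subS _ _.
have H i : exists x, i \in win @` A -> x \in A /\ win x = i.
  case: (boolP (i \in win @` A)) => [/imfsetP[x /= xA ->]|_]; last by exists 0.
  by exists x.
have [r hr] := choice H.
pose C3 : {fset int} := [fset x in [:: -1; 0; 1]].
have C3c : (#|` C3| <= 3)%N by rewrite card_fseq (leq_trans (size_undup _)).
apply: (@leq_trans #|` U `*` C3|); last first.
  rewrite card_dep_pairs big_const_seq count_predT iter_addn_0.
  by apply: leq_mul.
pose g (i : int) (s : G) := (r i + s, win (r i + s) - i).
apply: (@card_prod_le _ _ _ g).
  move=> i s iW sS; have [rA ri] := hr i iW.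
  rewrite in_fsetM /=; apply/andP; split.
    have /subSP[v [v' [vA v'A ->]]] := dif_nS (S2 s sS).
    by rewrite addrA; apply: mem_subS => //; rewrite (nSS 2); apply: mem_addS.
  have /winP hi := ri; have hs := Sb s sS.
  have tw : tau <= w by rewrite /w; nia.
  have /winP := erefl (win (r i + s)); rewrite raddfD /=; set k := win _ => hk.
  have hk1 : k < i + 2 by nia.
  have hk2 : i - 2 < k by nia.
  rewrite !inE; lia.
move=> i s i' s' iW _ i'W _ [e1 e2].
have ei : i = i' by move: e2; rewrite e1; lia.
by split=> //; move: e1; rewrite ei => /addrI.
Qed.

End Windows.

(** The sets of size below N / M have total size at most nTN / M, too little to bridge the gap
    between the average ratio (a + 1/2) / b and (a + 1) / b. *)
Lemma averaging (I : choiceType) (W : {fset I}) (T M a b N n : nat)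
    (l d : I -> nat -> nat) :
  (N = \sum_(i <- W) \sum_(s < T) l i s)%N ->
  (2 * (b * \sum_(i <- W) \sum_(s < T) d i s) <= (2 * a + 1) * N)%N ->
  (#|` W| <= n)%N -> (2 * (n * T * a.+1) < M)%N -> (0 < N)%N ->
  exists i s, [/\ i \in W, (s < T)%N, (N <= M * l i s)%N & (b * d i s <= a.+1 * l i s)%N].
Proof.
move=> eN hd hn hM N0; apply: contrapT => H.
have light i s : i \in W -> (s < T)%N -> (M * (a.+1 * l i s) <= M * (b * d i s) + a.+1 * N)%N.
  move=> iW sT; case: (leqP N (M * l i s)%N) => [hv|lt]; last first.
    by apply: (@leq_trans (a.+1 * N)%N); [rewrite mulnCA leq_mul2l ltnW ?orbT|exact: leq_addl].
  apply: leq_trans (leq_addr _ _); rewrite leq_mul2l; apply/orP; right.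
  by rewrite leqNgt; apply/negP => lt; apply: H; exists i, s; split=> //; exact: ltnW.
have : (M * (a.+1 * N) <= M * (b * \sum_(i <- W) \sum_(s < T) d i s) + n * T * a.+1 * N)%N.
  rewrite [in leqLHS]eN !big_distrr /=.
  have -> : (n * T * a.+1 * N = n * (T * (a.+1 * N)))%N by rewrite !mulnA.
  apply: (@leq_trans (\sum_(i <- W) (M * (b * \sum_(s < T) d i s) + T * (a.+1 * N)))%N); last first.
    rewrite big_split /= leq_add2l big_const_seq count_predT iter_addn_0 mulnC.
    by rewrite leq_mul2r hn orbT.
  rewrite big_seq [leqRHS]big_seq; apply: leq_sum => i iW; rewrite !big_distrr /=.
  have -> : (T * (a.+1 * N) = \sum_(s < T) a.+1 * N)%N.
    by rewrite sum_nat_const card_ord.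
  by rewrite -big_split /=; apply: leq_sum => s _; exact: light.
move: hd hM N0; set D := (\sum_(i <- W) _)%N; set c := (n * T * a.+1)%N => hd hM N0 h.
have h1 : (M * (2 * (b * D)) <= M * ((2 * a + 1) * N))%N by rewrite leq_mul2l hd orbT.
have h2 : (M * N <= 2 * c * N)%N by move: h h1; nia.
by move: h2; rewrite leq_pmul2r // leqNgt hM.
Qed.

(** Doubling a/b upstairs becomes (a + 1) / (2b) for a large level set of one window; [K] is only
    the crude bound fed to [plunnecke]. [T] precedes [MS] because the density of [S] depends on how
    many multiples its elements must have. *)
Lemma window_step (K a b : nat) : exists T, (0 < T)%N /\ forall MS, exists M,
  forall (G : zmodType) (theta : {additive G -> int}) (A S : {fset G}) (u : G),
  A != fset0 -> (#|` addS A A| <= K * #|` A|)%N -> (b * #|` addS A A| <= a * #|` A|)%N ->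
  (#|` A| <= MS * #|` S|)%N -> (forall s, s \in S -> dif A 2 s) ->
  (forall j, (j < T)%N -> dif A 2 (u *+ j)) -> 0 < theta u ->
  (forall s, s \in S -> `|theta s| <= theta u) ->
  exists (Q : zmodType) (pi : {additive G -> Q}) (sec : Q -> G) (X : {fset Q}),
  [/\ [/\ cancel sec pi, forall x y, pi x = pi y <-> exists k : int, x - y = u *~ k
          & forall c, 0 <= theta (sec c) < theta u],
      (#|` A| <= M * #|` X|)%N, (2 * b * #|` addS X X| <= a.+1 * #|` X|)%N
    & forall y, y \in subS X X -> exists x x', [/\ x \in A, x' \in A, pi (x - x') = y
        & `|theta (x - x')| < T%:Z * theta u]].
Proof.
(* The fibres of the doubled cells number at most 2 K^6 |A| / T; this [T] makes 2b times that number
   at most |A|. *)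
pose T := (4 * b * K ^ 6).+1; exists T; split=> // MS.
exists (2 * (3 * K ^ 5 * MS * T * a.+1)).+1 => G theta A S u A0 hK hab hMS S2 hu u0 Sb.
have T0 : (0 < T)%N by [].
have [Q [pi [sec [secK piE secb]]]] := cyclic_quotient u0.
have Ap : (0 < #|` A|)%N by rewrite cardfs_gt0.
pose W : {fset int} := win theta u T @` A.
pose C i := cell theta u T A i.
pose L i s := level pi (C i) s.
have fpi := pi_theta_inj u0 piE.
have hN : (#|` A| = \sum_(i <- W) \sum_(s < T) #|` L i s|)%N.
  rewrite (card_cells theta u T); apply: eq_bigr => i _.
  by apply: card_levels => y; exact: card_fiber_cell.
have hd : (2 * (2 * b * \sum_(i <- W) \sum_(s < T) #|` addS (L i s) (L i s)|) <=
          (2 * a + 1) * #|` A|)%N.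
  set D := (\sum_(i <- W) _)%N.
  pose Er := (\sum_(i <- W) #|` (pi @` addS (C i) (C i) : {fset Q})|)%N.
  have h1 : (2 * D <= #|` addS A A| + Er)%N.
    apply: leq_trans (leq_add (sum_cells_le u0 T0 A) (leqnn Er)).
    rewrite -big_split /= big_distrr /=; apply: leq_sum => i _.
    exact: (sum_levels_le fpi).
  have h2 : (T * Er <= 2 * (K ^ 6 * #|` A|))%N.
    apply: leq_trans (card_proj_cells u0 T0 piE A0 hu) _.
    by rewrite leq_mul2l /=; exact: (plunnecke 4 2 A0 hK).
  have h3 : (2 * b * Er <= #|` A|)%N.
    rewrite -(leq_pmul2l T0) mulnCA; apply: (@leq_trans (2 * b * (2 * (K ^ 6 * #|` A|)))%N).
      by rewrite leq_mul2l h2 orbT.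
    by rewrite /T; move: (K ^ 6)%N => k; nia.
  by move: {h2} h1 h3 hab; move: D Er => D Er; nia.
have S0 : (0 < #|` S|)%N by move: Ap hMS; case: #|` S|; rewrite ?muln0 //; lia.
have hW : (#|` W| <= 3 * K ^ 5 * MS)%N.
  rewrite -(leq_pmul2r S0); apply: leq_trans (card_win_le u0 T0 S2 Sb) _.
  have := plunnecke 3 2 A0 hK => h.
  apply: (@leq_trans (3 * (K ^ 5 * #|` A|))%N); first by rewrite leq_mul2l.
  by rewrite -!mulnA !leq_mul2l hMS !orbT.
have [i [s [iW sT hX hXX]]] :=
  @averaging _ W T _ a (2 * b)%N _ _ (fun i s => #|` L i s|)
    (fun i s => #|` addS (L i s) (L i s)|) hN hd hW (leqnn _) Ap.
exists Q, pi, sec, (L i s); split=> //.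
move=> _ /subSP[y [y' [/level_lift[x xC <-] /level_lift[x' x'C <-] ->]]].
have xA := fsubsetP (fiber_sub _ _ _) _ xC; have x'A := fsubsetP (fiber_sub _ _ _) _ x'C.
exists x, x'; rewrite raddfB; split=> //.
have := cell_bound u0 T0 xC; have := cell_bound u0 T0 x'C.
rewrite raddfB ltr_norml => /andP[h1 h2] /andP[h3 h4]; apply/andP; split.
  by rewrite ltrBrDl; apply: lt_le_trans h3; rewrite ltrBlDr.
by rewrite ltrBlDl; apply: lt_le_trans h4 _; rewrite lerD2r.
Qed.

(** * Fourier analysis modulo v *)

Section Angles.
Variables (R : realType) (v : nat).
Hypothesis v0 : (0 < v)%N.
Local Notation pi := (@pi R).

Definition ang (n : int) : R := 2 * pi * n%:~R / v%:R.

Let vR : (v%:R : R) != 0. Proof. by rewrite pnatr_eq0 -lt0n. Qed.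

Lemma angD m n : ang (m + n) = ang m + ang n.
Proof. by rewrite /ang rmorphD /= mulrDr mulrDl. Qed.

Lemma angN n : ang (- n) = - ang n.
Proof. by rewrite /ang rmorphN /= mulrN mulNr. Qed.

Lemma angM m n : ang (m * n) = m%:~R * ang n.
Proof. by rewrite /ang rmorphM /=; field. Qed.

Lemma ang_v : ang v = pi *+ 2.
Proof. by rewrite /ang -pmulrn -mulrA divff // mulr1 mulr_natl. Qed.

Lemma cos_period (x : R) (k : int) : cos (x + pi *+ 2 *~ k) = cos x.
Proof.
case: k => k; first by rewrite -pmulrn (periodicn (@cosD2pi R)).
rewrite NegzE mulrNz -pmulrn -[in RHS](subrK (pi *+ 2 *+ k.+1) x).
by rewrite (periodicn (@cosD2pi R)).
Qed.

Lemma sin_period (x : R) (k : int) : sin (x + pi *+ 2 *~ k) = sin x.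
Proof.
case: k => k; first by rewrite -pmulrn (periodicn (@sinD2pi R)).
rewrite NegzE mulrNz -pmulrn -[in RHS](subrK (pi *+ 2 *+ k.+1) x).
by rewrite (periodicn (@sinD2pi R)).
Qed.

Lemma ang_dvd m n : (v%:Z %| m - n)%Z ->
  cos (ang m) = cos (ang n) /\ sin (ang m) = sin (ang n).
Proof.
case/dvdzP => k e; have -> : m = n + k * v by rewrite -e; ring.
by rewrite angD angM ang_v mulrzl cos_period sin_period.
Qed.

(** 2 sin t cos(2rt) = sin((2r + 1)t) - sin((2r - 1)t) telescopes; the division by sin t is
    postponed. *)
Lemma sum_cos_telescope (t : R) (N : nat) :
  2 * sin t * \sum_(r < N) cos (r%:R * (2 * t)) = sin ((2 * N%:R - 1) * t) + sin t.
Proof.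
elim: N => [|N IH].
  by rewrite big_ord0 mulr0 mulr0 sub0r mulN1r sinN addNr.
rewrite big_ord_recr /= mulrDr IH.
have -> : (2 * N.+1%:R - 1) * t = N%:R * (2 * t) + t by rewrite -natr1; ring.
have -> : (2 * N%:R - 1) * t = N%:R * (2 * t) - t by ring.
by rewrite !sinD sinN cosN; ring.
Qed.

Lemma sum_cos (n : int) :
  \sum_(r < v) cos (ang (r%:Z * n)) = if (v%:Z %| n)%Z then v%:R else 0.
Proof.
case: ifP => [vn|/negbT vn].
  rewrite (eq_bigr (fun=> 1)); first by rewrite sumr_const card_ord.
  move=> r _; have [|-> _] := @ang_dvd (r%:Z * n) 0; first by rewrite subr0 dvdz_mull.
  by rewrite /ang mulr0 mul0r cos0.
pose m := (n %% v%:Z)%Z.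
have m0 : 0 < m.
  rewrite lt_neqAle eq_sym modz_ge0 ?andbT; last by rewrite -lt0n.
  by apply: contra vn => /eqP e; apply/dvdz_mod0P.
have mv : m < v%:Z by rewrite ltz_pmod // ltz_nat.
pose t : R := pi * m%:~R / v%:R.
have st : 0 < sin t.
  apply: sin_gt0_pi; rewrite /t !(divr_gt0, mulr_gt0) ?pi_gt0 ?ltr0z ?ltr0n //=.
  by rewrite ltr_pdivrMr ?ltr0n // ltr_pM2l ?pi_gt0 // -[v%:R]/(v%:Z%:~R) ltr_int.
have -> : \sum_(r < v) cos (ang (r%:Z * n)) = \sum_(r < v) cos (r%:R * (2 * t)).
  apply: eq_bigr => r _; have [|-> _] := @ang_dvd (r%:Z * n) (r%:Z * m).
    by rewrite -mulrBr dvdz_mull // /m {1}(divz_eq n v) addrK dvdz_mull.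
  by rewrite angM -pmulrn /ang /t; congr cos; ring.
have := sum_cos_telescope t v; have -> : (2 * v%:R - 1) * t = - t + pi *+ 2 *~ m.
  by rewrite -mulrzl -mulr_natl /t; field.
rewrite sin_period sinN addNr => /eqP; rewrite mulf_eq0 => /orP[|/eqP //].
by rewrite mulf_eq0 pnatr_eq0 /= gt_eqF.
Qed.

End Angles.

Section Fourier.
Variables (R : realType) (v : nat) (C : zmodType) (k : C -> int).
Hypothesis v0 : (0 < v)%N.
Hypothesis kD : forall x y, (v%:Z %| k (x + y) - (k x + k y))%Z.
Hypothesis kinj : forall x y, (v%:Z %| k x - k y)%Z -> x = y.
Implicit Types (E K : {fset C}) (r : nat).

Definition chc r (x : C) : R := cos (ang R v (r%:Z * k x)).
Definition chs r (x : C) : R := sin (ang R v (r%:Z * k x)).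

(** Squared modulus of the Fourier coefficient at frequency [r] of the weight [w] on [E], in real
    and imaginary parts. *)
Definition power (w : C -> R) E r :=
  (\sum_(x <- E) w x * chc r x) ^+ 2 + (\sum_(x <- E) w x * chs r x) ^+ 2.

Lemma power_ge0 w E r : 0 <= power w E r.
Proof. by rewrite addr_ge0 ?sqr_ge0. Qed.

Lemma parseval w E : \sum_(r < v) power w E r = v%:R * \sum_(x <- E) w x ^+ 2.
Proof.
have e r : power w E r =
    \sum_(x <- E) \sum_(y <- E) w x * w y * cos (ang R v (r%:Z * (k x - k y))).
  rewrite /power !expr2 !big_distrl -big_split /=; apply: eq_bigr => x _.
  rewrite !big_distrr -big_split /=; apply: eq_bigr => y _.
  by rewrite mulrBr angD angN cosB /chc /chs; ring.
under eq_bigr => r _ do rewrite e.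
rewrite exchange_big /= big_distrr /=.
rewrite big_seq [RHS]big_seq; apply: eq_bigr => x xE.
rewrite exchange_big /= (big_fsetD1 x) //= subrr -big_distrr /= sum_cos // dvdz0.
rewrite big_seq big1 ?addr0 1?mulrC ?expr2 // => y; rewrite !inE => /andP[yx _].
rewrite -big_distrr /= sum_cos //; case: ifP => [/kinj exy|_]; last by rewrite mulr0.
by rewrite exy eqxx in yx.
Qed.

Lemma chc_dvd r x : (v%:Z %| r%:Z * k x)%Z -> chc r x = 1.
Proof.
move=> h; have [|e _] := @ang_dvd R v v0 (r%:Z * k x) 0; first by rewrite subr0.
by rewrite /chc e /ang mulr0 mul0r cos0.
Qed.

(** Each frequency in [B] contributes |K|^2 to the Parseval sum, whose total is v|K|. *)
Lemma card_trivial_characters K (B : {set 'I_v}) :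
  (forall (r : 'I_v) x, r \in B -> x \in K -> (v%:Z %| r%:Z * k x)%Z) ->
  (#|B| * #|` K| <= v)%N.
Proof.
move=> h; have [->|K0] := eqVneq K fset0; first by rewrite cardfs0 muln0.
have Kp : (0 < #|` K|)%N by rewrite cardfs_gt0.
have := parseval (fun=> 1) K.
have -> : \sum_(x <- K) (1 : R) ^+ 2 = #|` K|%:R.
  by rewrite expr1n big_const_seq count_predT iter_addr_0.
move=> e; have : \sum_(r in B) (#|` K|%:R ^+ 2 : R) <= v%:R * #|` K|%:R.
  rewrite -e [leRHS](bigID (mem B)) /= -[leLHS]addr0; apply: lerD; last first.
    by apply: sumr_ge0 => r _; exact: power_ge0.
  apply: ler_sum => r rB; rewrite /power.
  have -> : \sum_(x <- K) 1 * chc r x = #|` K|%:R.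
    rewrite big_seq (eq_bigr (fun=> 1)) => [|x xK]; last by rewrite mul1r chc_dvd ?h.
    by rewrite -big_seq big_const_seq count_predT iter_addr_0.
  by rewrite lerDl sqr_ge0.
rewrite sumr_const -[_ *+ #|_|]mulr_natl expr2 mulrA ler_pM2r ?ltr0n //.
by rewrite -natrM ler_nat.
Qed.

Definition rep E s := #|` [fset x in E | (s - x)%R \in E]|.

Lemma sum_rep E : (\sum_(s <- addS E E) rep E s = #|` E| * #|` E|)%N.
Proof.
rewrite /rep -(double_count (fun x s => s - x \in E)) [X in _ = (X * _)%N]card_fset_sum1 big_distrl /=.
rewrite big_seq [RHS]big_seq; apply: eq_bigr => x xE; rewrite mul1n.
apply/eqP; rewrite eqn_leq; apply/andP; split.
  apply: (@card_le_inj _ _ (fun s => s - x)); first by move=> ? ? _ _ /addIr.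
  by move=> s; rewrite !inE => /andP[].
apply: (@card_le_inj _ _ (fun y => y + x)); first by move=> ? ? _ _ /addIr.
by move=> y yE; rewrite !inE addrK yE addrC mem_addS.
Qed.

Lemma sum_over_pairs E (g : C -> R) :
  \sum_(x <- E) \sum_(y <- E) g (x + y) = \sum_(s <- addS E E) (rep E s)%:R * g s.
Proof.
transitivity (\sum_(x <- E) \sum_(s <- addS E E | s - x \in E) g s).
  rewrite big_seq [RHS]big_seq; apply: eq_bigr => x xE.
  have inj : {in E &, injective (fun y => x + y)} by move=> ? ? _ _ /addrI.
  transitivity (\sum_(s <- [fset x + y | y in E]) g s).
    by rewrite big_imfset.
  rewrite [RHS]big_fset_condE; apply: eq_fbigl => s; rewrite !inE.
  apply/imfsetP/andP => /= [[y yE ->]|[_ h]].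
    by rewrite mem_addS // addrC addKr.
  by exists (s - x); rewrite // addrC subrK.
rewrite (exchange_big_dep xpredT) //=; apply: eq_bigr => s _.
by rewrite big_const_seq iter_addr_0 /rep card_fset_sum1 big_fset /= sum1_count mulr_natl.
Qed.

(** [rep E] is the convolution of the indicator of [E] with itself, so its transform is the square.
    Together with [parseval] this turns the fourth moment of the coefficients into additive
    energy. *)
Lemma power_sq E r : power (fun=> 1) E r ^+ 2 = power (fun s => (rep E s)%:R) (addS E E) r.
Proof.
rewrite /power -!sum_over_pairs.
have e1 : \sum_(x <- E) 1 * chc r x = \sum_(x <- E) chc r x by apply: eq_bigr => x _; rewrite mul1r.
have e2 : \sum_(x <- E) 1 * chs r x = \sum_(x <- E) chs r x by apply: eq_bigr => x _; rewrite mul1r.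
have ad x y : cos (ang R v (r%:Z * k (x + y))) = chc r x * chc r y - chs r x * chs r y
   /\ sin (ang R v (r%:Z * k (x + y))) = chs r x * chc r y + chc r x * chs r y.
  have [|-> ->] := @ang_dvd R v v0 (r%:Z * k (x + y)) (r%:Z * k x + r%:Z * k y).
    by rewrite -mulrDr -mulrBr dvdz_mull.
  by rewrite angD cosD sinD /chc /chs.
have -> : \sum_(x <- E) \sum_(y <- E) chc r (x + y) =
    (\sum_(x <- E) chc r x) ^+ 2 - (\sum_(x <- E) chs r x) ^+ 2.
  rewrite !expr2 !big_distrl -sumrB /=; apply: eq_bigr => x _.
  rewrite !big_distrr -sumrB /=; apply: eq_bigr => y _; exact: (ad x y).1.
have -> : \sum_(x <- E) \sum_(y <- E) chs r (x + y) =
    2 * (\sum_(x <- E) chc r x) * (\sum_(x <- E) chs r x).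
  transitivity (\sum_(x <- E) \sum_(y <- E) (chs r x * chc r y + chc r x * chs r y)).
    by apply: eq_bigr => x _; apply: eq_bigr => y _; exact: (ad x y).2.
  under eq_bigr => x _ do rewrite big_split /=.
  rewrite big_split /=.
  rewrite -[X in X + _]big_distrlr -[X in _ + X]big_distrlr /=; ring.
by rewrite e1 e2; ring.
Qed.

End Fourier.

(** * A large Fourier coefficient gives a well populated half circle *)

Section Layers.
Variables (R : realFieldType) (I : choiceType) (E : {fset I}).
Implicit Types (f : I -> R).

(** The sum of f is the integral over 0 <= t < G of #{f > t} - #{f < -t}. The integral is replaced
    by induction on the support: all non-zero values are moved towards 0 by the least [|f z|], below
    which both counts are constant. *)
Lemma sum_layers f (G M : R) : (forall x, x \in E -> `|f x| <= G) -> 0 <= G -> 0 <= M ->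
  (forall t, 0 <= t -> t < G ->
    (#|` [fset x in E | (t < f x)%R]|%:R <= #|` [fset x in E | (f x < - t)%R]|%:R + M)%R) ->
  \sum_(x <- E) f x <= G * M.
Proof.
have [n] := ubnP #|` [fset x in E | f x != 0]|; elim: n f G => // n IH f G En fG G0 M0 H.
have [Z|Z0] := eqVneq [fset x in E | f x != 0] fset0.
  rewrite big_seq big1 ?mulr_ge0 // => x xE; apply/eqP; apply: contraT => fx.
  by have := in_fset0 x; rewrite -Z !inE xE fx.
have [z /[!inE] /andP[zE fz] hz] := fset_argmax (fun x => - `|f x|) Z0.
pose m := `|f z|; have m0 : 0 < m by rewrite normr_gt0.
have mG : m <= G by exact: fG.
have mf x : x \in E -> f x != 0 -> m <= `|f x|.
  by move=> xE fx; rewrite -lerN2; apply: hz; rewrite !inE xE.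
pose f' x := if f x == 0 then 0 else if 0 < f x then f x - m else f x + m.
have f'P x : x \in E -> [\/ f x = 0 /\ f' x = 0, [/\ 0 < f x, m <= f x & f' x = f x - m] |
    [/\ f x < 0, f x <= - m & f' x = f x + m]].
  move=> xE; rewrite /f'; case: (ltrgtP (f x) 0) => [lt|gt|->]; last by constructor 1.
    constructor 3; have := mf x xE; rewrite lt_eqF // ltr0_norm // => /(_ isT).
    by rewrite lerNr.
  by constructor 2; have := mf x xE; rewrite gt_eqF // gtr0_norm // => /(_ isT).
have hp (t : R) : 0 <= t -> [fset x in E | t < f' x] = [fset x in E | t + m < f x].
  move=> t0; apply/fsetP => x; rewrite !inE; case: (boolP (x \in E)) => //= xE.
  by case: (f'P x xE) => [[-> ->]|[? ? ->]|[? ? ->]]; apply/idP/idP; lra.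
have hn (t : R) : 0 <= t -> [fset x in E | f' x < - t] = [fset x in E | f x < - (t + m)].
  move=> t0; apply/fsetP => x; rewrite !inE; case: (boolP (x \in E)) => //= xE.
  by case: (f'P x xE) => [[-> ->]|[? ? ->]|[? ? ->]]; apply/idP/idP; lra.
have IHf : \sum_(x <- E) f' x <= (G - m) * M.
  apply: IH; rewrite ?subr_ge0 //.
  - apply: (@leq_ltn_trans #|` [fset x in E | f x != 0] `\ z|).
      apply: fsubset_leq_card; apply/fsubsetP => x; rewrite !inE.
      case: (boolP (x \in E)) => //= xE f'x; apply/andP; split.
        apply: contraNneq f'x => ->; rewrite /f' (negbTE fz) /m.
        by case: ltrP => h; [rewrite gtr0_norm // subrr|rewrite ler0_norm // subrr].
      by case: (f'P x xE) f'x => [[-> ->]|[? ? _]|[? ? _]] // _; lra.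
    by move: En; rewrite (cardfsD1 z [fset x in E | f x != 0]) !inE zE fz add1n ltnS.
  - move=> x xE; have := fG x xE; rewrite !ler_norml.
    by case: (f'P x xE) => [[-> ->]|[? ? ->]|[? ? ->]]; lra.
  - move=> t t0 tG; rewrite hp // hn //; apply: H; lra.
have -> : \sum_(x <- E) f x = \sum_(x <- E) f' x +
    m * (#|` [fset x in E | 0 < f x]|%:R - #|` [fset x in E | f x < 0]|%:R).
  rewrite !card_filter_sum !natr_sum -sumrB big_distrr -big_split /=.
  rewrite big_seq [RHS]big_seq; apply: eq_bigr => x xE.
  case: (f'P x xE) => [[-> ->]|[h _ ->]|[h _ ->]]; rewrite ?ltxx ?h ?(lt_gtF h) /=; ring.
have := H 0 (lexx _) (lt_le_trans m0 mG); rewrite oppr0 => h.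
have : m * (#|` [fset x in E | 0 < f x]|%:R - #|` [fset x in E | f x < 0]|%:R) <= m * M.
  by rewrite ler_pM2l //; lra.
lra.
Qed.

End Layers.

Section HalfArc.
Variables (R : realType) (v : nat) (I : choiceType).
Hypothesis v0 : (0 < v)%N.
Local Notation pi := (@pi R).
Variable n : I -> int.

Definition arc (a : int) x := (2 * ((n x - a) %% v%:Z)%Z < v%:Z)%R.

Lemma arc_of_interval (x : I) (y a : int) : (v%:Z %| n x - y)%Z ->
  a <= y -> 2 * (y - a) < v%:Z -> arc a x.
Proof.
move=> /dvdzP[k e] ay h; rewrite /arc (_ : n x - a = k * v%:Z + (y - a)); last by lia.
by rewrite modzMDl modz_small //; lia.
Qed.

Lemma angle_exists (a b : R) : a ^+ 2 + b ^+ 2 = 1 -> exists p, a = cos p /\ b = sin p.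
Proof.
move=> e; have a1 : -1 <= a <= 1 by nra.
have ca : cos (acos a) = a by apply: acosK; rewrite in_itv.
have sa : sin (acos a) = `|b| by rewrite sin_acos // (_ : 1 - _ = b ^+ 2) ?sqrtr_sqr //; lra.
case: (lerP 0 b) => b0.
  by exists (acos a); rewrite sa ger0_norm.
by exists (- acos a); rewrite cosN sinN sa ltr0_norm ?opprK.
Qed.

Lemma reduce_angle (x : R) : exists (m : int) (d : R), [/\ x = d + 2 * pi * m%:~R, - pi <= d & d < pi].
Proof.
have p2 : 0 < 2 * pi by rewrite mulr_gt0 ?pi_gt0.
pose m := Num.floor ((x + pi) / (2 * pi)); exists m, (x - 2 * pi * m%:~R).
have /andP[h1 h2] := floor_itv ((x + pi) / (2 * pi)); rewrite -/m in h1 h2.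
rewrite ler_pdivlMr // in h1; rewrite ltr_pdivrMr // intrD in h2.
by split; nra.
Qed.

(** Let b = acos t and let d be the angle measured from p. The half circles (-b, pi - b] and [b -
    pi, b) both contain |d| < b, where the cosine exceeds t, and together they cover everything up
    to |d| = pi - b, beyond which it is below -t. *)
Lemma arcs_le (E : {fset I}) (N : nat) (p t : R) :
  (forall a, #|` [fset x in E | arc a x]| <= N)%N -> 0 <= t -> t < 1 ->
  (#|` [fset x in E | (t < cos (ang R v (n x) - p))%R]| + #|` E| <=
   #|` [fset x in E | (cos (ang R v (n x) - p) < - t)%R]| + 2 * N)%N.
Proof.
move=> hN t0 t1.
have pi0 : 0 < pi := pi_gt0 R.
have vR : (0 : R) < v%:R by rewrite ltr0n.
have tr : -1 <= t <= 1 by lra.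
pose b := acos t.
have cb : cos b = t by apply: acosK; rewrite in_itv.
have b0 : 0 < b by apply: acos_gt0; lra.
have b2 : b <= pi / 2.
  rewrite leNgt; apply/negP => h.
  have : cos b < cos (pi / 2).
    by rewrite ltr_cos // in_itv /=; have := acos_lepi tr; rewrite -/b; lra.
  by rewrite cb cos_pihalf; lra.
have fun_cos : {in `[0, pi] &, {mono (@cos R) : x y /~ y < x}} by exact: ltr_cos.
have [ds hds] := choice (fun x => reduce_angle (ang R v (n x) - p)).
have [d hd] := choice hds.
have cd x : cos (ang R v (n x) - p) = cos `|d x|.
  have [-> _ _] := hd x; rewrite cos_norm (_ : 2 * pi * _ = pi *+ 2 *~ ds x) ?cos_period //.
  by rewrite -mulrzl mulr2n; ring.
have nd x : 0 <= `|d x| <= pi.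
  by have [_ ? ?] := hd x; rewrite normr_ge0 ler_norml; lra.
have Lt x : (t < cos (ang R v (n x) - p)) = (`|d x| < b).
  by rewrite cd -cb fun_cos // in_itv /= ?nd //; lra.
have Gt x : (cos (ang R v (n x) - p) < - t) = (pi - b < `|d x|).
  have e : - cos b = cos (pi - b) by rewrite addrC cosDpi cosN.
  by rewrite cd -cb e fun_cos // in_itv /= ?nd //; lra.
pose c := v%:R / (2 * pi); have c0 : 0 < c by rewrite divr_gt0 // mulr_gt0.
have cpi : c * pi = v%:R / 2 by rewrite /c; field; lra.
pose y x := n x - v%:Z * ds x.
have yE x : (y x)%:~R = c * (p + d x).
  have [e _ _] := hd x; rewrite /y rmorphB rmorphM /=.
  have -> : p + d x = ang R v (n x) - 2 * pi * (ds x)%:~R by rewrite -[LHS]opprK; lra.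
  rewrite /c /ang -pmulrn; move: (pi) (gt_eqF pi0) => P /negbT Pn.
  by field; rewrite Pn gt_eqF.
have yd x : (v%:Z %| n x - y x)%Z by rewrite /y opprB addrC subrK dvdz_mulr.
(* [arc] is closed at its start and open at its end. So [a1] is the least integer strictly beyond an
   open left end, and [a2] is the ceiling of a closed one. *)
pose a1 := Num.floor (c * (p - b)) + 1.
pose a2 := - Num.floor (- (c * (p - (pi - b)))).
have arc1 x : - b < d x -> d x <= pi - b -> arc a1 x.
  move=> h1 h2; apply: (arc_of_interval (yd x)).
    by rewrite /a1 lezD1 floor_lt_int yE ltr_pM2l //; lra.
  have /andP[f1 f2] := floor_itv (c * (p - b)); rewrite -/a1 in f2.
  rewrite -(ltr_int R) rmorphM rmorphB /= yE -pmulrn.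
  have : c * (p + d x) <= c * (p - b) + v%:R / 2.
    by rewrite -cpi -mulrDr ler_pM2l //; lra.
  lra.
have arc2 x : - (pi - b) <= d x -> d x < b -> arc a2 x.
  move=> h1 h2; apply: (arc_of_interval (yd x)).
    rewrite /a2 lerNl floor_ge_int rmorphN /= yE lerN2 ler_pM2l //; lra.
  have /andP[f1 f2] := floor_itv (- (c * (p - (pi - b)))).
  rewrite -(ltr_int R) rmorphM rmorphB /= yE -pmulrn /a2 rmorphN /=.
  have : c * (p + d x) < c * (p - (pi - b)) + v%:R / 2.
    by rewrite -cpi -mulrDr ltr_pM2l //; lra.
  lra.
have := leq_add (hN a1) (hN a2); rewrite addnn -mul2n => h.
apply: (leq_trans _ (leq_add (leqnn _) h)).
rewrite !card_filter_sum card_fset_sum1 -!big_split /=.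
apply: leq_sum => x _; rewrite Lt Gt.
case: (ltrP `|d x| b) => e1.
  have [h1 h2] : - b < d x /\ d x < b by move: e1; rewrite ltr_norml => /andP.
  by rewrite arc1 ?arc2; try lra; case: (_ < _).
case: (ltrP (pi - b) `|d x|) => e2; first by rewrite add0n leq_addr.
case: (lerP 0 (d x)) => d0.
  by rewrite ger0_norm // in e1 e2; rewrite arc1 //; lra.
by rewrite ltr0_norm // in e1 e2; rewrite arc2 ?addn1 //; lra.
Qed.

(** Rotate by the argument p of the Fourier coefficient, so that its modulus [q] is a sum of
    cosines. If [N] is the largest population of a half circle, [arcs_le] and [sum_layers] give q <=
    2N - |E|. *)
Lemma half_arc (E : {fset I}) (r : R) : 0 <= r ->
  r ^+ 2 <= (\sum_(x <- E) cos (ang R v (n x))) ^+ 2 + (\sum_(x <- E) sin (ang R v (n x))) ^+ 2 ->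
  exists a, r + #|` E|%:R <= 2 * #|` [fset x in E | arc a x]|%:R.
Proof.
set c := (\sum_(x <- E) cos _); set s := (\sum_(x <- E) sin _) => r0 h.
pose q := Num.sqrt (c ^+ 2 + s ^+ 2).
have q0 : 0 <= q := sqrtr_ge0 _.
have q2 : q ^+ 2 = c ^+ 2 + s ^+ 2 by rewrite sqr_sqrtr // addr_ge0 ?sqr_ge0.
have rq : r <= q by rewrite -(@ler_pXn2r _ 2) // q2.
pose f (N : nat) := `[< exists a, N = #|` [fset x in E | arc a x]| >].
have fE : exists N, f N by exists #|` [fset x in E | arc 0 x]|; apply/asboolP; exists 0.
have fb N : f N -> (N <= #|` E|)%N.
  by move=> /asboolP[a ->]; apply: fsubset_leq_card; apply/fsubsetP => x; rewrite !inE => /andP[].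
case: (ex_maxnP fE fb) => N /asboolP[a eN] maxN.
have hN a' : (#|` [fset x in E | arc a' x]| <= N)%N by apply: maxN; apply/asboolP; exists a'.
exists a; rewrite -eN; apply: (@le_trans _ _ (q + #|` E|%:R)); first by rewrite lerD2r.
(* Rotations by 0 and by pi exchange the two cosine counts, so adding the two inequalities cancels
   them. *)
have N2 : (#|` E| <= 2 * N)%N.
  have := @arcs_le E N 0 0 hN (lexx _) ltr01.
  have := @arcs_le E N pi 0 hN (lexx _) ltr01.
  have e x : cos (ang R v (n x) - pi) = - cos (ang R v (n x)).
    by rewrite cosB cospi sinpi; ring.
  have -> : [fset x in E | 0 < cos (ang R v (n x) - pi)] = [fset x in E | cos (ang R v (n x) - 0) < - 0].
    by apply/fsetP => x; rewrite !inE e subr0 oppr0 oppr_gt0.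
  have -> : [fset x in E | cos (ang R v (n x) - pi) < - 0] = [fset x in E | 0 < cos (ang R v (n x) - 0)].
    by apply/fsetP => x; rewrite !inE e subr0 oppr0 oppr_lt0.
  have aux (P Q M : nat) : (P + M <= Q + 2 * N -> Q + M <= P + 2 * N -> M <= 2 * N)%N by lia.
  exact: aux.
have [q00|qn] := eqVneq q 0.
  by rewrite q00 add0r -natrM ler_nat.
have [|p [ep sp]] := @angle_exists (c / q) (s / q).
  by rewrite !expr_div_n -mulrDl -q2 divff // expf_neq0.
have -> : q = \sum_(x <- E) cos (ang R v (n x) - p).
  transitivity (c * cos p + s * sin p).
    by rewrite -ep -sp; apply: (mulIf qn); rewrite -expr2 q2; field.
  rewrite /c /s !big_distrl -big_split /=; apply: eq_bigr => x _.
  by rewrite cosB.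
rewrite -lerBrDr -[leRHS]mul1r; apply: sum_layers => //.
- by move=> x _; exact: cos_max.
- by rewrite subr_ge0 -natrM ler_nat.
- move=> t t0 t1; have := arcs_le p hN t0 t1.
  by rewrite -(ler_nat R) natrD [leRHS]natrD natrM; lra.
Qed.

End HalfArc.

(** * Biased characters of sparse sets with small doubling *)

Section LargeCharacter.
Variables (R : realType) (v : nat) (C : zmodType) (k : C -> int).
Hypothesis v0 : (0 < v)%N.
Hypothesis kD : forall x y, (v%:Z %| k (x + y) - (k x + k y))%Z.
Hypothesis kinj : forall x y, (v%:Z %| k x - k y)%Z -> x = y.
Implicit Types (E K : {fset C}).

(** The annihilator of E - E. Its size is v divided by the order of the subgroup generated by E - E,
    so 11 |trivial_chars| |E| <= v says that [E] has density at most 1/11 relative to that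
    subgroup. *)
Definition trivial_chars E : {set 'I_v} :=
  [set r : 'I_v | all (fun x => all (fun y => v%:Z %| r%:Z * (k x - k y))%Z E) E].

Lemma trivial_charsP E (r : 'I_v) :
  reflect (forall x y, x \in E -> y \in E -> (v%:Z %| r%:Z * (k x - k y))%Z)
    (r \in trivial_chars E).
Proof.
rewrite inE; apply: (iffP allP) => [h x y /h /allP|h x xE]; first exact.
by apply/allP => y yE; exact: h.
Qed.

Lemma sum_sq_ge (E : {fset C}) (g : C -> R) :
  (\sum_(x <- E) g x) ^+ 2 <= #|` E|%:R * \sum_(x <- E) g x ^+ 2.
Proof.
have [->|E0] := eqVneq E fset0.
  by rewrite !big_seq_fset0 cardfs0 mul0r expr0n.
have n0 : (0 : R) < #|` E|%:R by rewrite ltr0n cardfs_gt0.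
set s := \sum_(x <- E) g x; set q := \sum_(x <- E) _; set n := #|` E|%:R in n0 *.
have : 0 <= \sum_(x <- E) (n * g x - s) ^+ 2 by apply: sumr_ge0 => x _; exact: sqr_ge0.
have -> : \sum_(x <- E) (n * g x - s) ^+ 2 = n * (n * q - s ^+ 2).
  transitivity (\sum_(x <- E) (n ^+ 2 * g x ^+ 2 + (- 2 * n * s) * g x + s ^+ 2)).
    by apply: eq_bigr => x _; ring.
  have sc : \sum_(x <- E) s ^+ 2 = n * s ^+ 2.
    by rewrite big_const_seq count_predT iter_addr_0 [RHS]mulr_natl.
  by rewrite !big_split /= sc -!big_distrr /= -/s -/q; ring.
by rewrite pmulr_rge0 // subr_ge0.
Qed.

Lemma power_trivial E (r : 'I_v) : E != fset0 -> r \in trivial_chars E ->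
  power v k (fun=> 1 : R) E r = #|` E|%:R ^+ 2.
Proof.
case/fset0Pn => e eE /trivial_charsP h; rewrite /power.
have hc x : x \in E -> chc R v k r x = chc R v k r e /\ chs R v k r x = chs R v k r e.
  move=> xE; apply: ang_dvd => //.
  by rewrite -mulrBr h.
have sE (g : C -> R) : (forall x, x \in E -> g x = g e) -> \sum_(x <- E) 1 * g x = #|` E|%:R * g e.
  move=> hg; rewrite big_seq (eq_bigr (fun=> g e)) => [|x xE]; last by rewrite mul1r hg.
  by rewrite -big_seq big_const_seq count_predT iter_addr_0 -[g e *+ _]mulr_natl.
rewrite !sE; try by move=> x /hc[].
by rewrite !exprMn -mulrDr /chc /chs cos2Dsin2 mulr1.
Qed.

(** By Cauchy-Schwarz the fourth moment is at least v|E|^3 / 2.01. Trivial characters supply at most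
    v|E|^3 / 11; if all others had squared size below 2/5 |E|^2, they would supply at most 2/5
    v|E|^3. But 2.01 (1/11 + 2/5) < 1. *)
Lemma large_character E : E != fset0 -> (100 * #|` addS E E| <= 201 * #|` E|)%N ->
  (11 * #|trivial_chars E| * #|` E| <= v)%N ->
  exists2 r : 'I_v, r \notin trivial_chars E &
    4 * #|` E|%:R ^+ 2 <= 10 * power v k (fun=> 1 : R) E r.
Proof.
move=> E0 hE hB; apply: contrapT => H.
have N0 : (0 : R) < #|` E|%:R by rewrite ltr0n cardfs_gt0.
set N := #|` E|%:R in N0 *; pose F r := power v k (fun=> 1 : R) E r.
have F0 r : 0 <= F r by exact: power_ge0.
have vR : (0 : R) < v%:R by rewrite ltr0n.
have S1 : \sum_(r < v) F r = v%:R * N.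
  rewrite (parseval v0 kinj); congr (_ * _).
  by rewrite expr1n big_const_seq count_predT iter_addr_0.
have S2 : v%:R * N ^+ 4 <= #|` addS E E|%:R * \sum_(r < v) F r ^+ 2.
  have -> : \sum_(r < v) F r ^+ 2 = v%:R * \sum_(s <- addS E E) (rep E s)%:R ^+ 2.
    by rewrite -(parseval v0 kinj); apply: eq_bigr => r _; rewrite /F (power_sq R v0 kD).
  rewrite [leRHS]mulrCA ler_pM2l //.
  apply: le_trans (sum_sq_ge _ _); rewrite -natr_sum (sum_rep E) natrM -/N.
  by rewrite le_eqVlt; apply/orP; left; apply/eqP; ring.
have S3 : \sum_(r < v) F r ^+ 2 <= #|trivial_chars E|%:R * N ^+ 4 + 4 / 10 * N ^+ 2 * (v%:R * N).
  rewrite (bigID (mem (trivial_chars E))) /=; apply: lerD.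
    rewrite (eq_bigr (fun=> N ^+ 4)) => [|r rB].
      by rewrite sumr_const -[_ *+ #|_|]mulr_natl.
    by rewrite /F power_trivial // -/N; ring.
  rewrite -S1 [in leRHS](bigID (mem (trivial_chars E))) /= mulrDr.
  rewrite -[leLHS]add0r; apply: lerD.
    by rewrite mulr_ge0 ?sumr_ge0 // mulr_ge0 ?sqr_ge0 //; lra.
  rewrite big_distrr /=; apply: ler_sum => r rB; rewrite expr2 ler_wpM2r //.
  rewrite leNgt; apply/negP => lt; apply: H; exists r => //.
  by rewrite -/N -/(F r); lra.
have hB' : 11 * #|trivial_chars E|%:R * N <= v%:R by rewrite -!natrM ler_nat.
have hE' : 100 * #|` addS E E|%:R <= 201 * N by rewrite -!natrM ler_nat.
set S := #|` addS E E|%:R in S2 hE'; set B := #|trivial_chars E|%:R in S3 hB'.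
set Q := \sum_(r < v) F r ^+ 2 in S2 S3.
have N4 : N ^+ 4 = N * N ^+ 3 by rewrite exprS.
have N3 : 0 < N ^+ 3 by rewrite exprn_gt0.
have hQ : Q <= (v%:R / 11 + 4 / 10 * v%:R) * N ^+ 3.
  apply: le_trans S3 _; rewrite N4 [leRHS]mulrDl; apply: lerD.
    by rewrite mulrA ler_wpM2r ?(ltW N3) //; lra.
  by rewrite le_eqVlt; apply/orP; left; apply/eqP; ring.
have S0 : 0 <= S by exact: ler0n.
have : v%:R * N ^+ 4 <= 201 / 100 * N * ((v%:R / 11 + 4 / 10 * v%:R) * N ^+ 3).
  apply: le_trans S2 _; apply: ler_pM => //; last by lra.
  by apply: sumr_ge0 => r _; exact: sqr_ge0.
have : 0 < v%:R * N ^+ 4 by rewrite mulr_gt0 // exprn_gt0.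
have -> : 201 / 100 * N * ((v%:R / 11 + 4 / 10 * v%:R) * N ^+ 3) =
  201 / 100 * (1 / 11 + 4 / 10) * (v%:R * N ^+ 4) by rewrite N4; ring.
lra.
Qed.

(** As 0.63^2 < 2/5, [half_arc] applies with r = 0.63 |E| and (1 + 0.63) / 2 = 0.815. *)
Lemma biased_character E : E != fset0 -> (100 * #|` addS E E| <= 201 * #|` E|)%N ->
  (11 * #|trivial_chars E| * #|` E| <= v)%N ->
  exists (r a : int), (exists x y, [/\ x \in E, y \in E & ~~ (v%:Z %| r * (k x - k y))%Z]) /\
    (815 * #|` E| <= 1000 * #|` [fset x in E | arc v (fun x => (r * k x)%R) a x]|)%N.
Proof.
move=> E0 hE hB; have [r rB hr] := large_character E0 hE hB.
pose N : R := #|` E|%:R.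
have [||a ha] := @half_arc R v C v0 (fun x => r%:Z * k x) E (63 / 100 * N).
- by rewrite mulr_ge0 ?ler0n //; lra.
- move: hr; rewrite /power -/N; set c := \sum_(x <- E) _; set s := \sum_(x <- E) _.
  have -> : \sum_(x <- E) cos (ang R v (r%:Z * k x)) = c by apply: eq_bigr => x _; rewrite mul1r.
  have -> : \sum_(x <- E) sin (ang R v (r%:Z * k x)) = s by apply: eq_bigr => x _; rewrite mul1r.
  have := sqr_ge0 N; rewrite exprMn; lra.
exists r%:Z, a; split; last first.
  rewrite -(ler_nat R) !natrM; move: ha; rewrite -/N.
  by set M := #|` _|%:R; lra.
move: rB; rewrite inE => /allPn[x xE /allPn[y yE h]].
by exists x, y.
Qed.

End LargeCharacter.

(** * Dense sets generate a subgroup quickly *)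

Definition subgroupS (G : zmodType) (H : {fset G}) :=
  0 \in H /\ forall x y, x \in H -> y \in H -> x - y \in H.

Section Dense.
Variable C : zmodType.
Implicit Types (E : {fset C}).

Definition iter_diff E n := iter n (fun Y => subS Y Y) E.

Lemma iter_diff_n0 E n : E != fset0 -> iter_diff E n != fset0.
Proof.
move=> E0; elim: n => //= n /fset0Pn[x xY].
by apply/fset0Pn; exists (x - x); exact: mem_subS.
Qed.

Lemma iter_diff_dif E n x : x \in iter_diff E n.+1 -> dif E (2 ^ n) x.
Proof.
elim: n x => [|n IH] x /subSP[y [z [yY zY ->]]]; first exact: dif1.
by rewrite expnS mul2n -addnn; apply: difD; [|apply: difN]; exact: IH.
Qed.

(** A set whose difference set grows by less than 3/2 has a subgroup as difference set; otherwise a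
    factor 3/2 is gained at each step. *)
Lemma iter_diff_grow E n : E != fset0 ->
  (exists2 j, (j < n)%N & subgroupS (iter_diff E j.+1)) \/
  (3 ^ n * #|` E| <= 2 ^ n * #|` iter_diff E n|)%N.
Proof.
move=> E0; elim: n => [|n [[j jn sj]|IH]]; first by right.
  by left; exists j => //; exact: ltnW.
have [lt|le] := ltnP (2 * #|` iter_diff E n.+1|) (3 * #|` iter_diff E n|).
  left; exists n => //; split; last exact: small_diff_subgroup.
  by have /fset0Pn[x xY] := iter_diff_n0 n E0; apply/subSP; exists x, x; rewrite subrr.
right; rewrite !expnS; move: IH le; move: (3 ^ n)%N (2 ^ n)%N => a b.
by move: #|` iter_diff E n.+1| #|` iter_diff E n| => c d; nia.
Qed.

End Dense.

Lemma dvdzD (d m n : int) : (d %| m)%Z -> (d %| n)%Z -> (d %| m + n)%Z.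
Proof. by move=> /dvdzP[a ->] /dvdzP[b ->]; rewrite -mulrDl dvdz_mull. Qed.

Lemma dvdzN (d m : int) : (d %| - m)%Z = (d %| m)%Z.
Proof. by rewrite !dvdzE abszN. Qed.

Lemma dvdzB (d m n : int) : (d %| m)%Z -> (d %| n)%Z -> (d %| m - n)%Z.
Proof. by move=> dm dn; rewrite dvdzD // dvdzN. Qed.

Section DenseCase.
Variables (R : realType) (v : nat) (C : zmodType) (k : C -> int).
Hypothesis v0 : (0 < v)%N.
Hypothesis kD : forall x y, (v%:Z %| k (x + y) - (k x + k y))%Z.
Hypothesis kinj : forall x y, (v%:Z %| k x - k y)%Z -> x = y.

Lemma kB x y : (v%:Z %| k (x - y) - (k x - k y))%Z.
Proof.
have := kD (x - y) y; rewrite subrK => h.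
rewrite (_ : k (x - y) - (k x - k y) = - (k x - (k (x - y) + k y))); last by ring.
by rewrite dvdzN.
Qed.

(** Six growth steps would give a factor (3/2)^6 > 11, contradicting [card_trivial_characters]. So a
    subgroup appears by the sixth difference set, which lies in 2^5 E - 2^5 E. *)
Lemma dense_subgroup (E : {fset C}) : E != fset0 ->
  (v < 11 * #|trivial_chars v k E| * #|` E|)%N ->
  exists H : {fset C}, [/\ subgroupS H, forall h, h \in H -> dif E 32 h & (#|` E| <= #|` H|)%N].
Proof.
move=> E0 hv; have [[j jn sj]|le] := iter_diff_grow 6 E0.
  exists (iter_diff E j.+1); split=> //.
    move=> h /iter_diff_dif; apply: dif_mono => //.
    by apply: (@leq_trans (2 ^ 5)); rewrite ?leq_exp2l.
  elim: (j.+1) => //= i IH; apply: leq_trans IH _.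
  have /fset0Pn[y yY] := iter_diff_n0 i E0.
  rewrite -(card_translate _ (- y)); apply: fsubset_leq_card.
  by apply/fsubsetP => _ /imfsetP[x /= xY ->]; exact: mem_subS.
have := @card_trivial_characters R v C k v0 kinj (iter_diff E 6) (trivial_chars v k E).
have Ep : (0 < #|` E|)%N by rewrite cardfs_gt0.
suff h : forall (r : 'I_v) x, r \in trivial_chars v k E -> x \in iter_diff E 6 ->
    (v%:Z %| r%:Z * k x)%Z.
  move=> /(_ h); move: hv le; rewrite [iter_diff E 6]lock.
  move: #|` locked _| #|trivial_chars v k E| #|` E| Ep => y b e e0; nia.
move=> r x /trivial_charsP hr.
elim: 5%N x => [|n IH] x /subSP[y [z [yY zY ->]]].
  have /dvdzP[c ec] := kB y z; have h := hr y z yY zY.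
  rewrite (_ : k (y - z) = (k y - k z) + c * v%:Z); last by rewrite -ec; ring.
  by rewrite mulrDr dvdzD // mulrA dvdz_mull.
have /dvdzP[c ec] := kB y z.
rewrite (_ : k (y - z) = k y - k z + c * v%:Z); last by rewrite -ec; ring.
rewrite mulrDr mulrBr; apply: dvdzD; last by rewrite mulrA dvdz_mull.
by apply: dvdzB; exact: IH.
Qed.

End DenseCase.

(** * Reduced bases of planar lattices *)

Definition snorm (x y : int) : int := Num.max `|x| `|y|.

Lemma snormC x y : snorm x y = snorm y x.
Proof. exact: maxC. Qed.

Lemma nearest_multiple (x a : int) : a != 0 -> exists q, 2 * `|x - q * a| <= `|a|.
Proof.
move=> a0; have e := divz_eq x a; have h := ltz_mod x a0; have h' := modz_ge0 x a0.
move: e h h'; set q := (x %/ a)%Z; set m := (x %% a)%Z => e h h'.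
have [le|lt] := lerP (2 * m) `|a|; first by exists q; lia.
case: (ltrgtP a 0) a0 => // sa _.
  by exists (q - 1); rewrite mulrBl mul1r; lia.
by exists (q + 1); rewrite mulrDl mul1r; lia.
Qed.

Definition reduced_basis (L : int -> int -> Prop) (N : int) :=
  exists x1 y1 x2 y2 : int,
  [/\ L x1 y1, L x2 y2, x1 * y2 - x2 * y1 != 0,
      [/\ 0 < snorm x1 y1, 0 < snorm x2 y2, snorm x1 y1 <= 4 * N & snorm x2 y2 <= 4 * N]
    & forall x y, L x y -> exists l1 l2 : int,
      [/\ x = l1 * x1 + l2 * x2, y = l1 * y1 + l2 * y2,
          `|l1| * snorm x1 y1 <= 5 * snorm x y & `|l2| * snorm x2 y2 <= 4 * snorm x y]].

Section Planar.
Variables (L : int -> int -> Prop) (N : int).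
Hypothesis LB : forall x y x' y', L x y -> L x' y' -> L (x - x') (y - y').
Variables f1 g1 f2 g2 : int.
Hypothesis Lf1 : L f1 g1.
Hypothesis Lf2 : L f2 g2.
Hypothesis det0 : f1 * g2 - f2 * g1 != 0.
Hypothesis N1 : snorm f1 g1 <= N.
Hypothesis N2 : snorm f2 g2 <= N.

Let L0 : L 0 0. Proof. by have := LB Lf1 Lf1; rewrite !subrr. Qed.
Let LN x y : L x y -> L (- x) (- y).
Proof. by move=> h; have := LB L0 h; rewrite !add0r. Qed.
Let LD x y x' y' : L x y -> L x' y' -> L (x + x') (y + y').
Proof. by move=> h /LN /(LB h); rewrite !opprK. Qed.
Let LM x y (q : int) : L x y -> L (q * x) (q * y).
Proof.
move=> h; have hn (n : nat) : L (n%:Z * x) (n%:Z * y).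
  elim: n => [|n IH]; first by rewrite !mul0r.
  by rewrite intS !mulrDl !mul1r; exact: LD.
case: q => n //; rewrite NegzE !mulNr; exact: LN.
Qed.

(** [p] is the determinant with the shortest vector (a, b). The second vector has least non-zero
    |p|, and a multiple of (a, b) is subtracted until its first coordinate is at most |a|/2. Then
    |a| times its norm is at most 2|p|, and the coordinates are bounded by Cramer's rule. *)
Lemma planar_reduced (a b : int) : L a b -> 0 < snorm a b -> `|b| <= `|a| ->
  (forall x y, L x y -> 0 < snorm x y -> `|a| <= snorm x y) -> reduced_basis L N.
Proof.
move=> Lab ab0 ba minab.
have a0 : 0 < `|a| by move: ab0; rewrite /snorm; lia.
have na : a != 0 by rewrite -normr_gt0.
have zero x y : L x y -> snorm x y < `|a| -> x = 0 /\ y = 0.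
  move=> Lxy lt; have := minab x y Lxy; rewrite /snorm in lt *; lia.
pose p x y := a * y - b * x.
have pD (q x y x' y' : int) : p (x - q * x') (y - q * y') = p x y - q * p x' y' by rewrite /p; ring.
have ple x y : `|p x y| <= 2 * `|a| * snorm x y.
  rewrite /p; apply: (@le_trans _ _ (`|a| * `|y| + `|b| * `|x|)).
    by rewrite -!normrM ler_normB.
  have : `|a| * `|y| <= `|a| * snorm x y by rewrite ler_wpM2l // /snorm; lia.
  have : `|b| * `|x| <= `|a| * snorm x y by apply: ler_pM => //; rewrite /snorm; lia.
  lra.
have exf : exists x y, [/\ L x y, snorm x y <= N & p x y != 0].
  have [e1|ne1] := eqVneq (p f1 g1) 0; last by exists f1, g1.
  have [e2|ne2] := eqVneq (p f2 g2) 0; last by exists f2, g2.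
  exfalso; move/eqP: det0; apply.
  suff : a * (f1 * g2 - f2 * g1) = 0 by move/eqP; rewrite mulf_eq0 (negbTE na) => /eqP.
  rewrite (_ : a * _ = f1 * p f2 g2 - f2 * p f1 g1); last by rewrite /p; ring.
  by rewrite e1 e2 !mulr0 subrr.
pose P n := `[< exists x y, [/\ L x y, p x y != 0 & `|p x y|%N = n] >].
have exP : exists n, P n.
  by have [x [y [? _ ?]]] := exf; exists `|p x y|%N; apply/asboolP; exists x, y.
case: (ex_minnP exP) => d /asboolP[x2 [y2 [L2 p2 ed]]] mind.
have mult x y : L x y -> exists q, p x y = q * p x2 y2.
  move=> Lxy; exists (p x y %/ p x2 y2)%Z; set q := (_ %/ _)%Z.
  apply/eqP; rewrite -subr_eq0 -pD; apply: contraT => h.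
  have /mind : P `|(p (x - q * x2) (y - q * y2))%R|%N.
    by apply/asboolP; exists (x - q * x2), (y - q * y2); split=> //; apply: LB => //; exact: LM.
  rewrite pD /q {1}(divz_eq (p x y) (p x2 y2)) addrAC subrr add0r -ed.
  by have := ltz_mod (p x y) p2; have := modz_ge0 (p x y) p2; lia.
have [q hq] := nearest_multiple x2 na.
pose x3 := x2 - q * a; pose y3 := y2 - q * b.
have L3 : L x3 y3 by apply: LB => //; exact: LM.
have p3 : p x3 y3 = p x2 y2 by rewrite /x3 /y3 pD /p; ring.
have hx3 : 2 * `|x3| <= `|a| by [].
have n3 : 0 < snorm x3 y3.
  rewrite /snorm; have : p x3 y3 != 0 by rewrite p3.
  rewrite /p; case: (eqVneq x3 0) => [->|? _]; last by lia.
  by case: (eqVneq y3 0) => [->|? _]; [rewrite !mulr0 subrr eqxx|lia].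
have hy3 : snorm x3 y3 = `|y3| /\ `|a| <= `|y3|.
  by have := minab _ _ L3 n3; rewrite /snorm; lia.
have p3ge : `|a| * snorm x3 y3 <= 2 * `|p x3 y3|.
  have [-> ay] := hy3.
  have h1 : `|a| * `|y3| <= `|p x3 y3| + `|b| * `|x3|.
    rewrite -!normrM (_ : a * y3 = p x3 y3 + b * x3); last by rewrite /p; ring.
    exact: ler_normD.
  have h2 : 2 * (`|b| * `|x3|) <= `|a| * `|y3|.
    by rewrite mulrCA; apply: ler_pM => //; exact: le_trans hx3 ay.
  lra.
have coords x y : L x y -> exists l1 l2 : int,
      [/\ x = l1 * a + l2 * x3, y = l1 * b + l2 * y3,
          `|l1| * snorm a b <= 5 * snorm x y & `|l2| * snorm x3 y3 <= 4 * snorm x y].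
  move=> Lxy; have [l2 hl2] := mult x y Lxy; rewrite -p3 in hl2.
  pose x' := x - l2 * x3; pose y' := y - l2 * y3.
  have L' : L x' y' by apply: LB => //; exact: LM.
  have p' : p x' y' = 0 by rewrite /x' /y' pD hl2 subrr.
  have [l1 hl1] := nearest_multiple x' na.
  (* The remainder is parallel to (a, b) and its first coordinate is at most |a|/2, so it is shorter
     than a shortest vector. *)
  have [ex ey] : x' - l1 * a = 0 /\ y' - l1 * b = 0.
    apply: zero; first by apply: LB => //; exact: LM.
    have e : a * (y' - l1 * b) = b * (x' - l1 * a).
      by move: p'; rewrite /p => /eqP; rewrite subr_eq0; move: (x') (y') => X Y /eqP h; rewrite !mulrBr h; ring.
    have : `|y' - l1 * b| <= `|x' - l1 * a|.
      rewrite -(ler_pM2l a0) -normrM e normrM; exact: ler_wpM2r.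
    rewrite /snorm; lia.
  exists l1, l2.
  have e1 : x = l1 * a + l2 * x3 by rewrite -[LHS](subrK (l2 * x3)) -/x' -[x'](subrK (l1 * a)) ex add0r.
  have e2 : y = l1 * b + l2 * y3 by rewrite -[LHS](subrK (l2 * y3)) -/y' -[y'](subrK (l1 * b)) ey add0r.
  have h2 : `|l2| * snorm x3 y3 <= 4 * snorm x y.
    rewrite -(ler_pM2l a0) mulrCA.
    have : `|l2| * (`|a| * snorm x3 y3) <= `|l2| * (2 * `|p x3 y3|) by rewrite ler_wpM2l.
    have : `|l2| * `|p x3 y3| <= 2 * `|a| * snorm x y by rewrite -normrM -hl2.
    lra.
  split=> //.
  have sa : snorm a b = `|a| by rewrite /snorm; lia.
  rewrite sa -normrM (_ : l1 * a = x - l2 * x3); last by rewrite {1}e1 addrK.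
  apply: le_trans (ler_normB _ _) _; rewrite normrM.
  have : `|l2| * `|x3| <= `|l2| * snorm x3 y3 by rewrite ler_wpM2l // /snorm; lia.
  have : `|x| <= snorm x y by rewrite /snorm; lia.
  lra.
exists a, b, x3, y3; split=> //.
- suff -> : a * y3 - x3 * b = p x3 y3 by rewrite p3.
  by rewrite /p; ring.
- have sa : snorm a b = `|a| by rewrite /snorm; lia.
  split=> //.
    have [x [y [Lxy xyN pxy]]] := exf; rewrite sa.
    have : `|a| <= snorm x y.
      apply: minab => //; rewrite /snorm; case: (eqVneq x 0) pxy => [->|? _]; last by lia.
      by case: (eqVneq y 0) => [->|? _]; [rewrite /p !mulr0 subrr eqxx|lia].
    lia.
  have [x [y [Lxy xyN pxy]]] := exf; have [l1 [l2 [ex ey _ h]]] := coords x y Lxy.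
  have l20 : l2 != 0.
    by apply: contraNneq pxy => l20; rewrite ex ey l20 !mul0r !addr0 /p; apply/eqP; ring.
  have : 1 * snorm x3 y3 <= `|l2| * snorm x3 y3 by rewrite ler_pM2r //; lia.
  lra.
Qed.

End Planar.

Lemma exists_reduced_basis (L : int -> int -> Prop) (N f1 g1 f2 g2 : int) :
  (forall x y x' y', L x y -> L x' y' -> L (x - x') (y - y')) ->
  L f1 g1 -> L f2 g2 -> f1 * g2 - f2 * g1 != 0 -> snorm f1 g1 <= N -> snorm f2 g2 <= N ->
  reduced_basis L N.
Proof.
move=> LB L1 L2 det0 N1 N2.
pose P n := `[< exists x y, [/\ L x y, 0 < snorm x y & `|snorm x y|%N = n] >].
have exP : exists n, P n.
  exists `|snorm f1 g1|%N; apply/asboolP; exists f1, g1; split=> //.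
  rewrite /snorm; case: (eqVneq f1 0) det0 => [->|? _]; last by lia.
  by case: (eqVneq g1 0) => [->|? _]; [rewrite mul0r mulr0 subrr eqxx|lia].
case: (ex_minnP exP) => d /asboolP[a [b [Lab ab0 ed]]] mind.
have minab x y : L x y -> 0 < snorm x y -> snorm a b <= snorm x y.
  move=> Lxy xy0; have /mind : P `|snorm x y|%N by apply/asboolP; exists x, y.
  by rewrite -ed; move: ab0 xy0; move: (snorm a b) (snorm x y) => m n; lia.
have [ba|ab] := lerP `|b| `|a|.
  apply: (planar_reduced LB L1 L2 det0 N1 N2 Lab ab0 ba) => x y Lxy /(minab x y Lxy).
  by rewrite /snorm; lia.
pose L' x y := L y x.
have [||||||||||x1 [y1 [x2 [y2 [h1 h2 h3 [h4 h5 h6 h7] h8]]]]] :=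
  @planar_reduced L' N _ g1 f1 g2 f2 _ _ _ _ _ b a.
- by move=> x y x' y' Lx Lx'; exact: LB.
- exact: L1.
- exact: L2.
- by rewrite -oppr_eq0 opprB mulrC (mulrC g1).
- by rewrite snormC.
- by rewrite snormC.
- exact: Lab.
- by rewrite snormC.
- exact: ltW.
- by move=> x y Lxy; rewrite snormC => /(minab y x Lxy); rewrite /snorm; lia.
exists y1, x1, y2, x2; split=> //.
- by rewrite -oppr_eq0 opprB mulrC (mulrC y1).
- by rewrite ![snorm y1 x1]snormC ![snorm y2 x2]snormC.
- move=> x y Lxy; have [l1 [l2 [e1 e2 b1 b2]]] := h8 y x Lxy.
  by exists l1, l2; rewrite snormC (snormC y2) (snormC x).
Qed.

(** * Regular subsets *)

Section Regular.
Variable G : zmodType.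
Implicit Types (X E F : {fset G}).

(** |F + F| / |F| >= |E + E| / |E| - 1/100 for every [F] with |F| >= |E| / s, with denominators
    cleared. *)
Definition regular s E := forall F, F `<=` E -> (#|` E| <= s * #|` F|)%N ->
  (100 * #|` addS E E| * #|` F| <= (100 * #|` addS F F| + #|` F|) * #|` E|)%N.

(** Every violation lowers the doubling by more than 1/100. The doubling is never below 1, so at
    most [n] violations occur, each costing a factor [s] in size. *)
Lemma regular_subset s n X : (0 < s)%N -> X != fset0 ->
  (100 * #|` addS X X| <= (100 + n) * #|` X|)%N ->
  exists E, [/\ E `<=` X, E != fset0, (#|` X| <= s ^ n * #|` E|)%N,
    (100 * #|` addS E E| <= (100 + n) * #|` E|)%N & regular s E].
Proof.
move=> s0; elim: n X => [|n IH] X X0 hX.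
all: have [reg|/existsNP[F /not_implyP[FX /not_implyP[XF /negP]]]] := pselect (regular s X);
  first by exists X; split=> //; rewrite leq_pmull ?expn_gt0 ?s0.
all: rewrite -ltnNge => lt.
all: have X1 : (0 < #|` X|)%N by rewrite cardfs_gt0.
all: have F0 : F != fset0 by rewrite -cardfs_gt0; move: XF X1; case: #|` F|; lia.
  exfalso; have := card_addS_gel F F0; move: lt hX; rewrite addn0.
  move: #|` addS F F| #|` addS X X| #|` F| #|` X| => a b c d; nia.
have hF : (100 * #|` addS F F| <= (100 + n) * #|` F|)%N.
  have F1 : (0 < #|` F|)%N by rewrite cardfs_gt0.
  rewrite -(leq_pmul2r X1); move: lt hX.
  move: #|` addS F F| #|` addS X X| #|` F| #|` X| F1 X1 => a b c d c0 d0 lt hX.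
  have : (100 * b * c <= (100 + n.+1) * d * c)%N by rewrite leq_mul2r hX orbT.
  nia.
have [E [EF E0 cE hE reg]] := IH F F0 hF; exists E; split=> //.
- exact: fsubset_trans EF FX.
- by rewrite expnS -mulnA; apply: leq_trans XF _; rewrite leq_mul2l cE orbT.
- by apply: leq_trans hE _; rewrite leq_mul2r leq_add2l leqnSn orbT.
Qed.

End Regular.

Section FewValues.
Variable G : zmodType.
Implicit Types (E F : {fset G}).

(** A Freiman homomorphism of order 2 into the integers. *)
Definition respects_sums (theta : G -> int) E := forall x y x' y',
  x \in E -> y \in E -> x' \in E -> y' \in E ->
  x + y = x' + y' -> theta x + theta y = theta x' + theta y'.

(** Remove the top fibre [F] and let [F'] be the next one. The values of [theta] separate E' + E',
    F' + F and F + F; the middle set has at least |F'| elements, which pays for the top-fibre term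
    of the induction hypothesis. *)
Lemma top_fiber_growth (theta : G -> int) (c d : nat) E m :
  respects_sums theta E ->
  (forall t, c * #|` fiber theta E t| <= d * #|` addS (fiber theta E t) (fiber theta E t)|)%N ->
  m \in E -> (forall x, x \in E -> theta x <= theta m) ->
  ((c + d) * #|` E| <= d * #|` addS E E| + d * #|` fiber theta E (theta m)|)%N.
Proof.
have [n] := ubnP #|` E|; elim: n E m => // n IH E m En hs hc mE hm.
pose F : {fset G} := fiber theta E (theta m).
pose E' : {fset G} := E `\` F.
have FE : F `<=` E by exact: fiber_sub.
have mF : m \in F by rewrite in_fiber mE eqxx.
have E'E : E' `<=` E by exact: fsubsetDl.
have inE' x : x \in E' -> x \in E /\ theta x < theta m.
  rewrite inE in_fiber => /andP[h xE]; split=> //; move: h; rewrite xE /= => ne.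
  by rewrite lt_neqAle ne hm.
have cE : (#|` E| = #|` E'| + #|` F|)%N.
  by rewrite (cardfsD E F) (fsetIidPr FE) subnK // fsubset_leq_card.
have [E0|E'0] := eqVneq E' fset0.
  have EF : E = F by apply/eqP; rewrite eqEfsubset FE andbT -fsetD_eq0 -/E' E0.
  have := hc (theta m); rewrite -/F -EF mulnDl; lia.
have [m' m'E' hm'] := fset_argmax theta E'0.
have [m'E m'm] := inE' m' m'E'.
pose F' : {fset G} := fiber theta E' (theta m').
have F'0 : F' != fset0 by apply/fset0Pn; exists m'; rewrite in_fiber m'E' eqxx.
have IH' : ((c + d) * #|` E'| <= d * #|` addS E' E'| + d * #|` F'|)%N.
  apply: IH => //.
  - have : (0 < #|` F|)%N by rewrite cardfs_gt0; apply/fset0Pn; exists m.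
    by move: En; rewrite cE; lia.
  - by move=> x y x' y' /inE'[? _] /inE'[? _] /inE'[? _] /inE'[? _]; exact: hs.
  - move=> t; have [->|ne] := eqVneq t (theta m).
      rewrite (_ : fiber theta E' (theta m) = fset0) ?cardfs0 ?muln0 //.
      apply/fsetP => x; rewrite in_fiber; apply/negP => /andP[/inE'[_ lt] /eqP e].
      by rewrite e ltxx in lt.
    suff -> : fiber theta E' t = fiber theta E t by [].
    apply/fsetP => x; rewrite !in_fiber inE in_fiber.
    by case: (theta x =P t) => [->|_]; rewrite ?andbF // (negbTE ne) andbF andbT.
have FF := hc (theta m); rewrite -/F in FF.
suff le : (#|` addS E' E'| + #|` F'| + #|` addS F F| <= #|` addS E E|)%N.
  rewrite cE -/F mulnDr.
  have : (d * (#|` addS E' E'| + #|` F'| + #|` addS F F|) <= d * #|` addS E E|)%N.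
    by rewrite leq_mul2l le orbT.
  move: IH' FF; rewrite !mulnDr !mulnDl; lia.
have cF' : (#|` F'| <= #|` addS F' F|)%N.
  by apply: card_addS_gel; apply/fset0Pn; exists m.
apply: (@leq_trans (#|` addS E' E' `|` (addS F' F `|` addS F F)|)).
  rewrite cardfsU cardfsU.
  have -> : addS F' F `&` addS F F = fset0.
    apply/fsetP => z; rewrite in_fsetI inE; apply/negP => /andP[/addSP[x [y [xF yF ->]]] /addSP[x' [y' [x'F y'F e]]]].
    move: xF yF x'F y'F; rewrite ![_ \in fiber _ _ _]in_fiber => /andP[/inE'[xE _] /eqP tx] /andP[yE /eqP ty] /andP[x'E /eqP tx'] /andP[y'E /eqP ty'].
    have := hs _ _ _ _ xE yE x'E y'E e; rewrite tx ty tx' ty'; clear -m'm; lia.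
  have -> : addS E' E' `&` (addS F' F `|` addS F F) = fset0.
    apply/fsetP => z; rewrite in_fsetI in_fsetU inE; apply/negP => /andP[/addSP[x [y [xF yF ->]]]].
    have [xE _] := inE' x xF; have [yE _] := inE' y yF.
    have tx := hm' x xF; have ty := hm' y yF.
    case/orP => /addSP[x' [y' [+ + e]]]; rewrite ![_ \in fiber _ _ _]in_fiber.
      move=> /andP[/inE'[x'E _] /eqP tx'] /andP[y'E /eqP ty'].
      have := hs _ _ _ _ xE yE x'E y'E e; rewrite tx' ty'; clear -tx ty m'm; lia.
    move=> /andP[x'E /eqP tx'] /andP[y'E /eqP ty'].
    have := hs _ _ _ _ xE yE x'E y'E e; rewrite tx' ty'; clear -tx ty m'm; lia.
  by rewrite !cardfs0 !subn0; lia.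
apply: fsubset_leq_card; rewrite !fsubUset !addSS //.
exact: fsubset_trans (fiber_sub _ _ _) E'E.
Qed.

(* Order the popular fibres by their values: the sums of neighbouring fibres are
   disjoint from the doubled fibres, and if there is only one popular fibre then
   so is its translate by [x]. *)
Lemma regular_many_values s n (theta : G -> int) E E1 : E != fset0 ->
  (100 * #|` addS E E| <= 201 * #|` E|)%N -> regular s E -> E1 `<=` E ->
  (815 * #|` E| <= 1000 * #|` E1|)%N ->
  respects_sums theta E1 ->
  (forall t, exists2 x, x \in E & forall f f' f'', f \in fiber theta E1 t ->
     f' \in fiber theta E1 t -> f'' \in fiber theta E1 t -> x + f <> f' + f'') ->
  (200 * n <= s)%N -> (0 < n)%N -> (n < #|` theta @` E1|)%N.
Proof.
move=> E0 hE reg E1E hE1 hs hx ns n0; rewrite ltnNge; apply/negP => hn.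
have e0 : (0 < #|` E|)%N by rewrite cardfs_gt0.
(* At most [n] fibres are light and each has fewer than |E| / s points, in total at most |E| / 200;
   hence 0.815 drops to 0.81. *)
pose heavy x := (#|` E| <= s * #|` fiber theta E1 (theta x)|)%N.
pose E2 : {fset G} := [fset x in E1 | heavy x].
have inE2 y : (y \in E2) = (y \in E1) && heavy y by rewrite !inE.
have E2E1 : E2 `<=` E1 by apply/fsubsetP => x; rewrite !inE => /andP[].
have hE2 : (81 * #|` E| <= 100 * #|` E2|)%N.
  pose D : {fset G} := E1 `\` E2.
  have cD : (#|` E1| = #|` D| + #|` E2|)%N.
    by rewrite (cardfsD E1 E2) (fsetIidPr E2E1) subnK // fsubset_leq_card.
  have light x : x \in D -> (s * #|` fiber theta D (theta x)| <= #|` E|)%N.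
    rewrite !inE => /andP[+ xE1]; rewrite xE1 /= /heavy -ltnNge => /ltnW; apply: leq_trans.
    rewrite leq_mul2l; apply/orP; right; apply: fsubset_leq_card; apply/fsubsetP => y.
    by rewrite !in_fiber => /andP[]; rewrite inE => /andP[_ ->].
  have sD : (s * #|` D| <= n * #|` E|)%N.
    apply: (@leq_trans (#|` theta @` D| * #|` E|)%N); last first.
      rewrite leq_mul2r; apply/orP; right; apply: leq_trans hn.
      by apply: fsubset_leq_card; apply: subset_imfset => x; rewrite !inE => /andP[].
    rewrite (card_fibers theta D) big_distrr /=.
    apply: (@leq_trans (\sum_(t <- theta @` D) #|` E|)%N).
      rewrite !big_seq; apply: leq_sum => _ /imfsetP[x /= xD ->]; exact: light.
    by rewrite big_const_seq count_predT iter_addn addn0 mulnC.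
  have le200 : (200 * n * #|` D| <= s * #|` D|)%N by rewrite leq_mul2r ns orbT.
  have : (200 * #|` D| <= #|` E|)%N.
    rewrite -(leq_pmul2l n0); move: le200 sD; clear; lia.
  move: cD hE1; lia.
have E20 : E2 != fset0 by rewrite -cardfs_gt0; move: hE2 e0; lia.
have E2E := fsubset_trans E2E1 E1E.
have hs2 : respects_sums theta E2.
  by move=> x y x' y' /(fsubsetP E2E1) ? /(fsubsetP E2E1) ? /(fsubsetP E2E1) ? /(fsubsetP E2E1) ?; exact: hs.
have fibE2 x : x \in E2 -> fiber theta E2 (theta x) = fiber theta E1 (theta x).
  rewrite inE => /andP[xE1 hv]; apply/fsetP => y; rewrite [LHS]in_fiber [RHS]in_fiber inE2.
  by case: (theta y =P theta x) => [e|_]; rewrite ?andbF // /heavy e -/(heavy x) hv !andbT.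
have hc t : (#|` fiber theta E2 t| * (100 * #|` addS E E|) <= 
    (100 * #|` addS (fiber theta E2 t) (fiber theta E2 t)| + #|` fiber theta E2 t|) * #|` E|)%N.
  have [->|/fset0Pn[x]] := eqVneq (fiber theta E2 t) fset0; first by rewrite cardfs0.
  rewrite in_fiber => /andP[xE2 /eqP <-]; rewrite mulnC; apply: reg.
    exact: fsubset_trans (fiber_sub _ _ _) E2E.
  by rewrite fibE2 //; move: xE2; rewrite inE => /andP[].
(* c / d = |E + E| / |E| - 1/100 is the doubling that regularity guarantees for each popular
   fibre. *)
pose c := (100 * #|` addS E E| - #|` E|)%N.
pose d := (100 * #|` E|)%N.
have hcd t : (c * #|` fiber theta E2 t| <= 
    d * #|` addS (fiber theta E2 t) (fiber theta E2 t)|)%N.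
  rewrite /c /d; have := hc t; rewrite mulnBl leq_subLR mulnDl mulnC; lia.
have hEE : (#|` E| <= #|` addS E E|)%N by exact: card_addS_gel.
have mEE : (#|` addS E2 E2| <= #|` addS E E|)%N by apply: fsubset_leq_card; exact: addSS.
have [m mE2 hm] := fset_argmax theta E20.
have [m' m'E2 hm'] := fset_argmax (fun x => - theta x) E20.
have growM := top_fiber_growth hs2 hcd mE2 hm.
(* Reversing the sign of [theta] puts the bottom fibre in place of the top one. Averaging the two
   bounds costs only half of [E2]. *)
have growm : ((c + d) * #|` E2| <= d * #|` addS E2 E2| + d * #|` fiber theta E2 (theta m')|)%N.
  have fibN t : fiber (fun x => - theta x) E2 t = fiber theta E2 (- t).
    by apply/fsetP => x; rewrite !in_fiber eqr_oppLR.
  have := @top_fiber_growth (fun x => - theta x) c d E2 m'.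
  rewrite fibN opprK; apply=> //.
    move=> x y x' y' xE yE x'E y'E e; rewrite -!opprD; congr (- _); exact: hs2.
  by move=> t; rewrite fibN.
have [e|ne] := eqVneq (theta m) (theta m').
  have all_m x : x \in E2 -> theta x = theta m.
    move=> xE; have := hm x xE; have := hm' x xE; rewrite e; lia.
  have fE2 : fiber theta E2 (theta m) = E2.
    by apply/fsetP => x; rewrite in_fiber; case: (boolP (x \in E2)) => //= /all_m ->; rewrite eqxx.
  have fE1 : fiber theta E1 (theta m) = E2 by rewrite -fibE2.
  have [x xE hxE] := hx (theta m).
  have le : (#|` addS E2 E2| + #|` E2| <= #|` addS E E|)%N.
    rewrite -(card_translate E2 x) -cardfsUI.
    rewrite (_ : _ `&` _ = fset0) ?cardfs0 ?addn0.
      apply: fsubset_leq_card; rewrite fsubUset addSS //=; apply/fsubsetP => _ /imfsetP[y /= yE ->].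
      by apply: mem_addS => //; exact: (fsubsetP E2E).
    apply/fsetP => z; rewrite in_fsetI [in RHS]inE; apply/negP => /andP[/addSP[f' [f'' [f'E f''E ->]]] /imfsetP[f /= fE e']].
    by move: f'E f''E fE; rewrite -fE1 => f'E f''E fE; apply: (hxE f f' f'') => //; rewrite addrC.
  have := hcd (theta m); rewrite fE2.
  move: le hE2 hE hEE e0; rewrite /c /d.
  move: #|` addS E2 E2| #|` E2| #|` E| #|` addS E E| => y p q K; clear.
  move=> le hp hK qK q0 h.
  have h1 : (100 * q * (y + p) <= 100 * q * K)%N by rewrite leq_mul2l le orbT.
  have h2 : ((100 * K - q + 100 * q) * (81 * q) <= (100 * K - q + 100 * q) * (100 * p))%N.
    by rewrite leq_mul2l hp orbT.
  have h3 : ((100 * K - q + 100 * q) * p <= 100 * q * K)%N.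
    by rewrite mulnDl; apply: leq_trans h1; rewrite mulnDr leq_add2r.
  have aux w : (w * p <= 100 * q * K)%N -> (w * (81 * q) <= w * (100 * p))%N -> (w * 81 <= 100 * (100 * K))%N.
    by move=> g5 g6; rewrite -(leq_pmul2r q0); lia.
  have := aux _ h3 h2; clear -q0 hK qK; lia.
have ff : (#|` fiber theta E2 (theta m)| + #|` fiber theta E2 (theta m')| <= #|` E2|)%N.
  rewrite -cardfsUI (_ : _ `&` _ = fset0) ?cardfs0 ?addn0.
    by apply: fsubset_leq_card; rewrite fsubUset !fiber_sub.
  apply/fsetP => x; rewrite in_fsetI !in_fiber inE; apply/negP => /andP[/andP[_ /eqP e1] /andP[_ /eqP e2]].
  by rewrite -e1 -e2 eqxx in ne.
move: ff growM growm hE2 hE hEE e0 mEE; rewrite /c /d.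
move: #|` fiber _ _ (theta m)| #|` fiber _ _ (theta m')| => f f'.
move: #|` addS E2 E2| #|` E2| #|` E| #|` addS E E| => y p q K; clear.
move=> ff h1 h2 hp hK qK q0 yK.
have h3 : (100 * q * (f + f') <= 100 * q * p)%N by rewrite leq_mul2l ff orbT.
have h4 : (100 * q * y <= 100 * q * K)%N by rewrite leq_mul2l yK orbT.
(* With D = |E + E| / |E| and |E2| >= 0.81 |E| this becomes 0.81 (2D + 0.98) <= 2D, which fails for
   D <= 2.01. *)
have h5 : ((200 * K - 2 * q + 100 * q) * p <= 200 * q * K)%N by lia.
have h6 : ((200 * K - 2 * q + 100 * q) * (81 * q) <= (200 * K - 2 * q + 100 * q) * (100 * p))%N.
  by rewrite leq_mul2l hp orbT.
have aux w : (w * p <= 200 * q * K)%N -> (w * (81 * q) <= w * (100 * p))%N -> (w * 81 <= 200 * (100 * K))%N.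
  by move=> g5 g6; rewrite -(leq_pmul2r q0); lia.
have := aux _ h5 h6; clear -q0 hK qK; lia.
Qed.

End FewValues.

(** * Progressions of rank two in cyclic groups *)

Section Cyclic.
Variables (v : nat) (C : zmodType) (k : C -> int) (pi : {additive int -> C}).
Hypothesis v0 : (0 < v)%N.
Hypothesis piE : forall x y, pi x = pi y <-> (v%:Z %| x - y)%Z.
Hypothesis kK : forall c, pi (k c) = c.
Hypothesis kb : forall c, 0 <= k c < v%:Z.
Implicit Types (X E : {fset C}).

(** The progression is formed in the integers, not in [C]. The bound 9v ensures that its terms
    differ from lifts in 32A - 32A by boundedly many multiples of v. *)
Definition has_gap M N X := exists x1 x2 : int, exists L1 L2 : nat,
  [/\ (0 < L1)%N /\ (0 < L2)%N,
      forall l1 l2 : int, 1 <= l1 <= L1%:Z -> 1 <= l2 <= L2%:Z ->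
        `|l1 * x1 + l2 * x2| <= 9 * v%:Z /\ dif X 32 (pi (l1 * x1 + l2 * x2)),
      forall l1 l2 m1 m2 : int, 1 <= l1 <= L1%:Z -> 1 <= l2 <= L2%:Z ->
        1 <= m1 <= L1%:Z -> 1 <= m2 <= L2%:Z ->
        l1 * x1 + l2 * x2 = m1 * x1 + m2 * x2 -> l1 = m1 /\ l2 = m2
    & (N <= M * (L1 * L2))%N].

Lemma pi_eq0 x : (pi x = 0) <-> (v%:Z %| x)%Z.
Proof. by rewrite -(raddf0 pi) piE subr0. Qed.

Lemma kD x y : (v%:Z %| k (x + y) - (k x + k y))%Z.
Proof. by apply/piE; rewrite raddfD !kK. Qed.

Lemma kinj x y : (v%:Z %| k x - k y)%Z -> x = y.
Proof. by move/piE; rewrite !kK. Qed.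

(** The preimage of [H] in the integers is generated by a divisor g of v. The second generator is a
    dummy 0 with a single coefficient. *)
Lemma subgroup_gap X (H : {fset C}) : subgroupS H ->
  (forall h, h \in H -> dif X 32 h) -> has_gap 1 #|` H| X.
Proof.
move=> [H0 HB] HX.
have HN x : x \in H -> - x \in H by move=> h; rewrite -sub0r; exact: HB.
have HMn x (n : nat) : x \in H -> x *+ n \in H.
  move=> h; elim: n => [|n IH]; first by rewrite mulr0n.
  by rewrite mulrS -[X in _ + X]opprK; apply: HB => //; exact: HN.
have HM x (q : int) : pi x \in H -> pi (x * q) \in H.
  move=> h; case: q => n.
    by rewrite -[Posz n]natz mulr_natr raddfMn; exact: HMn.
  by rewrite NegzE mulrN raddfN -[Posz n.+1]natz mulr_natr raddfMn; exact/HN/HMn.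
pose P (n : nat) := (0 < n)%N && (pi n%:Z \in H).
have exP : exists n, P n.
  by exists v; rewrite /P v0 (_ : pi v%:Z = 0) //; apply/pi_eq0.
case: (ex_minnP exP) => g /andP[g0 gH] ming.
have mult x : pi x \in H -> (g%:Z %| x)%Z.
  move=> xH; apply/dvdz_mod0P; apply/eqP; apply: contraT => ne.
  have h := ltz_pmod x (d := g%:Z); have h' := modz_ge0 x (d := g%:Z).
  have : P `|(x %% g%:Z)%Z|%N.
    rewrite /P absz_gt0 ne /= gez0_abs; last by apply: h'; lia.
    rewrite (_ : (x %% g%:Z)%Z = x - g%:Z * (x %/ g%:Z)%Z); last by have := divz_eq x g%:Z; lia.
    by rewrite raddfB; apply: HB => //; exact: HM.
  by move/ming; lia.
have gv : (g %| v)%N by apply: (mult v%:Z); rewrite (_ : pi v%:Z = 0) //; apply/pi_eq0.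
exists g%:Z, 0, (v %/ g)%N, 1%N; split.
- by rewrite divn_gt0 // dvdn_leq.
- move=> l1 l2 hl1 _; rewrite mulr0 addr0; split; last by rewrite mulrC; apply/HX/HM.
  have : `|l1 * g%:Z| <= (v %/ g)%N%:Z * g%:Z by rewrite normrM; apply: ler_pM; lia.
  by rewrite -PoszM divnK //; lia.
- move=> l1 l2 m1 m2 _ h _ h'; rewrite !mulr0 !addr0 => e; split; last by lia.
  by apply: (@mulIf _ g%:Z); rewrite ?e //; lia.
rewrite mul1n muln1 -(card_iotaS (v %/ g)).
apply: (@card_le_inj _ _ (fun h => (`|k h| %/ g)%N)); last first.
  move=> h _; rewrite in_iotaS ltn_divLR // divnK //; have := kb h; lia.
move=> x y xH yH /= e; rewrite -(kK x) -(kK y); congr (pi _).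
have dx : (g %| `|k x|)%N by have := mult (k x); rewrite kK; apply.
have dy : (g %| `|k y|)%N by have := mult (k y); rewrite kK; apply.
have : `|k x|%N = `|k y|%N by rewrite -(divnK dx) e divnK.
have := kb x; have := kb y; lia.
Qed.


(** The pairs (x, t) with p(t, pi x) in [H] form a lattice containing (v, 0) and (k c, tau). A box
    in a reduced basis has size comparable to |H|, and its first coordinates are the progression. *)
Lemma lattice_gap X (r tau : int) (c : C) (Q : zmodType) (p : {additive (int * C)%type -> Q})
    (sec : Q -> int * C) (H : {fset Q}) :
  cancel sec p -> (forall y, 0 <= (sec y).1 < tau) -> p (tau, c) = 0 -> tau < v%:Z ->
  subgroupS H ->
  (forall g, p g \in H -> (v%:Z %| g.1 - r * k g.2)%Z) ->
  (forall g, p g \in H -> `|g.1| <= 9 * tau -> dif X 32 g.2) ->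
  has_gap 357 #|` H| X.
Proof.
move=> secK secb pu tauv [H0 HB] Hcong Hdif.
have tau0 : 0 < tau by have := secb 0; lia.
have vp : 0 < v%:Z by lia.
pose Lam (x t : int) := p (t, pi x) \in H.
have LamB (x t x' t' : int) : Lam x t -> Lam x' t' -> Lam (x - x') (t - t').
  move=> h h'; rewrite /Lam [pi _]raddfB.
  have : p ((t, pi x) - (t', pi x')) \in H by rewrite raddfB; exact: HB.
  exact: id.
(* After scaling, the ranges [`|x| <= v] and [`|t| <= tau] become the same. *)
pose L (Y Z : int) := exists x t : int, [/\ Y = tau * x, Z = v%:Z * t & Lam x t].
pose N := v%:Z * tau.
have N0 : 0 < N by rewrite /N; nia.
have norm_le (x t m : int) : snorm (tau * x) (v%:Z * t) <= m * N ->
    `|x| <= m * v%:Z /\ `|t| <= m * tau.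
  rewrite /snorm ge_max !normrM /N => /andP[h1 h2]; split.
    by rewrite -(ler_pM2l tau0); move: h1; rewrite (gtr0_norm tau0); lia.
  by rewrite -(ler_pM2l vp); move: h2; rewrite (gtr0_norm vp); lia.
have [||||||X1 [Y1 [X2 [Y2 [LX1 LX2 det0 [n1 n2 s1 s2] coords]]]]] :=
  @exists_reduced_basis L N (tau * v%:Z) 0 (tau * k c) (v%:Z * tau).
- move=> x y x' y' [a [b [-> -> h]]] [a' [b' [-> -> h']]].
  by exists (a - a'), (b - b'); rewrite !mulrBr; split=> //; exact: LamB.
- exists v%:Z, 0; split=> //; first by rewrite mulr0.
  by rewrite /Lam (_ : pi v%:Z = 0) ?raddf0 //; apply/pi_eq0.
- by exists (k c), tau; split=> //; rewrite /Lam kK pu.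
- by rewrite mulr0 subr0 !mulf_neq0 //; lia.
- by rewrite /snorm /N normr0; nia.
- rewrite /snorm /N ge_max [X in _ && (X <= _)]gtr0_norm ?mulr_gt0 // lexx andbT normrM (gtr0_norm tau0) mulrC.
  by rewrite ler_pM2r //; have := kb c; lia.
case: LX1 => x1 [t1 [eX1 eY1 Lam1]]; case: LX2 => x2 [t2 [eX2 eY2 Lam2]].
set lam1 := snorm X1 Y1 in n1 s1 coords; set lam2 := snorm X2 Y2 in n2 s2 coords.
have LamMn (x t : int) (n : nat) : Lam x t -> Lam (n%:Z * x) (n%:Z * t).
  move=> h; elim: n => [|n IH]; first by rewrite !mul0r /Lam raddf0 -/(0 : int * C) raddf0.
  have z : Lam 0 0 by rewrite /Lam raddf0 raddf0.
  have -> : n.+1%:Z * x = n%:Z * x - (0 - x) by rewrite intS; ring.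
  have -> : n.+1%:Z * t = n%:Z * t - (0 - t) by rewrite intS; ring.
  by apply: (LamB) => //; exact: LamB.
have LamM (x t : int) (n : int) : Lam x t -> Lam (n * x) (n * t).
  case: n => n h; first exact: LamMn.
  have z : Lam 0 0 by rewrite /Lam raddf0 raddf0.
  have h2 := LamMn x t n.+1 h; rewrite NegzE !mulNr.
  by have := LamB _ _ _ _ z h2; rewrite !sub0r.
have LamC (l1 l2 : int) : Lam (l1 * x1 + l2 * x2) (l1 * t1 + l2 * t2).
  by have := LamB _ _ _ _ (LamM _ _ l1 Lam1) (LamM _ _ (- l2) Lam2); rewrite !mulNr !opprK.
have normC (l1 l2 : int) : snorm (tau * (l1 * x1 + l2 * x2)) (v%:Z * (l1 * t1 + l2 * t2)) <=
    `|l1| * lam1 + `|l2| * lam2.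
  have -> : tau * (l1 * x1 + l2 * x2) = l1 * X1 + l2 * X2 by rewrite eX1 eX2; ring.
  have -> : v%:Z * (l1 * t1 + l2 * t2) = l1 * Y1 + l2 * Y2 by rewrite eY1 eY2; ring.
  rewrite /lam1 /lam2 {1}/snorm ge_max; apply/andP; split.
    by apply: le_trans (ler_normD _ _) _; rewrite !normrM lerD // ler_wpM2l // le_max lexx.
  by apply: le_trans (ler_normD _ _) _; rewrite !normrM lerD // ler_wpM2l // le_max lexx orbT.
(* [L0] is the quotient of N by 2 lam, plus 1. Then differences in the box have norm at most N,
   while lam <= 4N gives 2 L0 lam <= N + 8N, the origin of 9. *)
have len (lam : int) : 0 < lam -> lam <= 4 * N -> exists L0 : nat, [/\ (0 < L0)%N,
    2 * (L0%:Z - 1) * lam <= N, 2 * L0%:Z * lam <= 9 * N & N < 2 * L0%:Z * lam].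
  move=> lam0 lam4.
  have h2 : 0 < 2 * lam by lia.
  have e := divz_eq N (2 * lam); have h := ltz_pmod N h2; have h' := modz_ge0 N (lt0r_neq0 h2).
  have q0 : 0 <= (N %/ (2 * lam))%Z by rewrite divz_ge0 // ltW.
  case: (N %/ (2 * lam))%Z e q0 => // n; move: h h'; move: (N %% (2 * lam))%Z => m h h' e _.
  by exists n.+1; rewrite intS; split=> //; clear -e h h' lam4 lam0; nia.
have [L1 [L10 la1 lb1 lc1]] := len _ n1 s1; have [L2 [L20 la2 lb2 lc2]] := len _ n2 s2.
exists x1, x2, L1, L2; split=> //.
- move=> l1 l2 hl1 hl2.
  have [] := norm_le (l1 * x1 + l2 * x2) (l1 * t1 + l2 * t2) 9; last first.
    by move=> hx ht; split=> //; exact: (Hdif _ (LamC l1 l2)).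
  apply: le_trans (normC l1 l2) _.
  have : `|l1| * lam1 <= L1%:Z * lam1 by rewrite ler_pM2r //; lia.
  have : `|l2| * lam2 <= L2%:Z * lam2 by rewrite ler_pM2r //; lia.
  lia.
- move=> l1 l2 m1 m2 hl1 hl2 hm1 hm2 e.
  have ex : (l1 - m1) * x1 + (l2 - m2) * x2 = 0 by lia.
  have [] := norm_le ((l1 - m1) * x1 + (l2 - m2) * x2) ((l1 - m1) * t1 + (l2 - m2) * t2) 1.
    apply: le_trans (normC _ _) _.
    have : `|l1 - m1| * lam1 <= (L1%:Z - 1) * lam1 by rewrite ler_pM2r //; lia.
    have : `|l2 - m2| * lam2 <= (L2%:Z - 1) * lam2 by rewrite ler_pM2r //; lia.
    lia.
  (* If the first coordinate of the difference is 0, the congruence makes v divide the second, which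
     is at most tau < v in absolute value. So the difference vanishes. *)
  move=> _ ht; have := Hcong _ (LamC (l1 - m1) (l2 - m2)); rewrite /= ex raddf0.
  have /dvdzP[q eq0] : (v%:Z %| k 0)%Z by apply/pi_eq0; rewrite kK.
  rewrite eq0 => /dvdzP[q' eq'].
  have et : (l1 - m1) * t1 + (l2 - m2) * t2 = 0.
    have : (l1 - m1) * t1 + (l2 - m2) * t2 = (q' + r * q) * v%:Z.
      by rewrite [RHS]mulrDl -eq'; ring.
    move: ht; move: ((l1 - m1) * t1 + _) (q' + r * q) => t q0; rewrite mul1r => ht et.
    have : `|q0| * v%:Z < 1 * v%:Z by rewrite -{1}(gtr0_norm vp) -normrM -et; lia.
    by rewrite ltr_pM2r // => hq; rewrite et (_ : q0 = 0) ?mul0r //; lia.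
  have d12 : x1 * t2 - x2 * t1 != 0.
    apply: contraNneq det0 => d0; rewrite eX1 eX2 eY1 eY2; apply/eqP.
    by transitivity (tau * v%:Z * (x1 * t2 - x2 * t1)); [ring|rewrite d0 mulr0].
  split; apply/eqP; rewrite -subr_eq0 -[_ == 0]orbF -[false](negbTE d12) -mulf_eq0; apply/eqP.
    transitivity (t2 * ((l1 - m1) * x1 + (l2 - m2) * x2) - x2 * ((l1 - m1) * t1 + (l2 - m2) * t2)).
      by ring.
    by rewrite ex et !mulr0 subrr.
  transitivity (x1 * ((l1 - m1) * t1 + (l2 - m2) * t2) - t1 * ((l1 - m1) * x1 + (l2 - m2) * x2)).
    by ring.
  by rewrite ex et !mulr0 subrr.
have repr y : exists l : int * int, y \in H -> [/\ `|l.1| <= 10 * L1%:Z, `|l.2| <= 8 * L2%:Z &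
    y = p (l.1 * t1 + l.2 * t2, pi (l.1 * x1 + l.2 * x2))].
  have [yH|nyH] := boolP (y \in H); last by exists (0, 0).
  have [eyp hb] := (secK y, secb y); case: (sec y) eyp hb => t d /= eyp hb.
  have [|l1 [l2 [e1 e2 b1 b2]]] := coords (tau * k d) (v%:Z * t).
    by exists (k d), t; split=> //; rewrite /Lam kK eyp.
  have hN : snorm (tau * k d) (v%:Z * t) <= N.
    rewrite /snorm ge_max !normrM (gtr0_norm tau0) (gtr0_norm vp) /N.
    by rewrite [v%:Z * tau]mulrC ler_pM2l // [tau * v%:Z]mulrC ler_pM2l //; have := kb d; lia.
  exists (l1, l2) => _ /=; split.
  - rewrite -(ler_pM2r n1); apply: le_trans b1 _; lia.
  - rewrite -(ler_pM2r n2); apply: le_trans b2 _; lia.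
  have -> : l1 * t1 + l2 * t2 = t.
    by apply: (@mulfI _ v%:Z); [lia|rewrite e2 eY1 eY2; ring].
  have -> : l1 * x1 + l2 * x2 = k d.
    by apply: (@mulfI _ tau); [lia|rewrite e1 eX1 eX2; ring].
  by rewrite kK.
have [l hl] := choice repr.
(* The counts of integers in [-10 L1, 10 L1] and [-8 L2, 8 L2]; their product is at most 21 * 17 =
   357 times L1 L2. *)
pose n1' := (20 * L1 + 1)%N; pose n2' := (16 * L2 + 1)%N.
apply: (@leq_trans (n1' * n2')); last by rewrite /n1' /n2'; nia.
pose Z : {fset (nat * nat)%type} := iotaS n1' `*` iotaS n2'.
have -> : (n1' * n2' = #|` Z|)%N.
  by rewrite card_dep_pairs big_const_seq count_predT iter_addn addn0 !card_iotaS mulnC.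
pose enc (y : Q) : nat * nat := (`|((l y).1 + 10 * L1%:Z)%R|%N, `|((l y).2 + 8 * L2%:Z)%R|%N).
have := @card_le_inj Q _ enc H Z; apply.
  move=> y z yH zH [].
  have [a1 a2 ey] := hl y yH; have [b1 b2 ez] := hl z zH => e1 e2.
  have l1 : (l y).1 = (l z).1 by clear -a1 b1 e1; lia.
  have l2 : (l y).2 = (l z).2 by clear -a2 b2 e2; lia.
  by rewrite ey [RHS]ez l1 l2.
move=> y yH; have [a1 a2 _] := hl y yH; rewrite in_fsetM !in_iotaS /n1' /n2' /enc /=; apply/andP; split.
  by clear -a1; lia.
by clear -a2; lia.
Qed.

End Cyclic.

Lemma dif_ind (G : zmodType) (A : {fset G}) (P : G -> Prop) n x : P 0 ->
  (forall y z, P y -> P z -> P (y + z)) -> (forall a b, a \in A -> b \in A -> P (a - b)) ->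
  dif A n x -> P x.
Proof.
move=> P0 PD Pab; elim: n x => [|n IH] x.
  by move=> [s [t [/size0nil -> /size0nil -> _ _ ->]]]; rewrite !big_nil subrr.
move=> /difS[y [z [/IH Py /dif1E/subSP[a [b [aA bA ->]]] ->]]].
by apply: PD => //; exact: Pab.
Qed.

Lemma dif_bound (G : zmodType) (f : {additive G -> int}) (A : {fset G}) (c : int) n x :
  (forall a b, a \in A -> b \in A -> `|f (a - b)| <= c) -> dif A n x -> `|f x| <= c * n%:Z.
Proof.
move=> h; elim: n x => [|n IH] x.
  by move=> [s [t [/size0nil -> /size0nil -> _ _ ->]]]; rewrite !big_nil subrr raddf0 normr0 mulr0.
move=> /difS[y [z [/IH hy /dif1E/subSP[a [b [aA bA ->]]] ->]]].
rewrite raddfD intS mulrDr mulr1 addrC; apply: le_trans (ler_normD _ _) _.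
by apply: lerD => //; exact: h.
Qed.

(** * The half circle as a subset of [int * C] *)

Section Sparse.
Variables (v : nat) (C : zmodType) (k : C -> int) (pi : {additive int -> C}).
Hypothesis v0 : (0 < v)%N.
Hypothesis piE : forall x y, pi x = pi y <-> (v%:Z %| x - y)%Z.
Hypothesis kK : forall c, pi (k c) = c.
Hypothesis kb : forall c, 0 <= k c < v%:Z.
Variables (r a : int) (E : {fset C}).

Local Notation V := (v%:Z).
Let Vp : 0 < V. Proof. by []. Qed.
Definition residue (x : C) : int := ((r * k x - a) %% V)%Z.
Definition half_set : {fset C} := [fset x in E | arc v (fun x => r * k x) a x].
Definition lifted : {fset (int * C)%type} := [fset (residue x, x) | x in half_set].
Local Notation theta := residue.
Local Notation E1 := half_set.
Local Notation Et := lifted.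

Lemma residue_ge0 x : 0 <= theta x. Proof. by rewrite /residue modz_ge0 // (lt0r_neq0 Vp). Qed.

Lemma residue_half x : x \in E1 -> 2 * theta x < V.
Proof. by rewrite !inE /arc => /andP[]. Qed.

Lemma residue_mod x : (V %| theta x - (r * k x - a))%Z.
Proof.
apply/dvdzP; exists (- (((r * k x - a) %/ V)%Z)); rewrite /residue.
by have := divz_eq (r * k x - a) V; lia.
Qed.

(** The two sums of residues are congruent modulo v and both lie in [0, v), because each residue is
    below v/2. *)
Lemma lift_respects_sums : respects_sums theta E1.
Proof.
have hm := residue_mod; move=> x y x' y' xE yE x'E y'E e.
have hx := residue_half xE; have hy := residue_half yE; have hx' := residue_half x'E; have hy' := residue_half y'E.
have : (V %| theta x + theta y - (theta x' + theta y'))%Z.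
  have h1 := kD piE kK x y; have h2 := kD piE kK x' y'; rewrite -e in h2.
  rewrite (_ : _ - _ = (theta x - (r * k x - a)) + (theta y - (r * k y - a))
     - (theta x' - (r * k x' - a)) - (theta y' - (r * k y' - a))
     + r * ((k (x + y) - (k x' + k y')) - (k (x + y) - (k x + k y)))); last by ring.
  apply: dvdzD; last by apply: dvdz_mull; exact: dvdzB.
  by apply: dvdzB => //; apply: dvdzB => //; exact: dvdzD.
move/dvdzP => [q eq].
suff q0 : q = 0 by move: eq; rewrite q0 mul0r; lia.
have := residue_ge0 x; have := residue_ge0 y; have := residue_ge0 x'; have := residue_ge0 y' => p1 p2 p3 p4.
have : `|q| * V < 1 * V by rewrite -{1}(gtr0_norm Vp) -normrM -eq; lia.
by rewrite ltr_pM2r //; lia.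
Qed.

Lemma card_lift : #|` Et| = #|` E1|.
Proof. by apply: card_imfset => x y []. Qed.

Lemma lift_add : (#|` addS Et Et| <= #|` addS E1 E1|)%N.
Proof.
apply: (@card_le_inj _ _ snd).
  move=> _ _ /addSP[_ [_ [/imfsetP[x /= xE ->] /imfsetP[y /= yE ->] ->]]]
     /addSP[_ [_ [/imfsetP[x' /= x'E ->] /imfsetP[y' /= y'E ->] ->]]] /= e.
  by congr (_, _) => //; exact: lift_respects_sums.
move=> _ /addSP[_ [_ [/imfsetP[x /= xE ->] /imfsetP[y /= yE ->] ->]]] /=.
exact: mem_addS.
Qed.

Lemma lift_snd : snd @` Et = E1.
Proof.
apply/fsetP => x; apply/imfsetP/idP => /= [[_ /imfsetP[y /= yE ->] ->] //|xE].
by exists (theta x, x) => //; apply/imfsetP; exists x.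
Qed.

Lemma lift_cong n g : dif Et n g -> (V %| g.1 - r * k g.2)%Z.
Proof.
move=> hg; apply: (@dif_ind _ Et (fun g => (V %| g.1 - r * k g.2)%Z) n) hg => [|y z hy hz|_ _ /imfsetP[x /= xE ->] /imfsetP[y /= yE ->]] /=.
- by rewrite sub0r dvdzN dvdz_mull //; apply/(pi_eq0 piE); rewrite kK.
- rewrite (_ : _ - _ = (y.1 - r * k y.2) + (z.1 - r * k z.2) -
     r * (k (y.2 + z.2) - (k y.2 + k z.2))); last by ring.
  by apply: dvdzB; [exact: dvdzD|apply/dvdz_mull/(kD piE kK)].
- have hm := residue_mod; have := kD piE kK (x - y) y; rewrite subrK => h.
  rewrite (_ : _ - _ = (theta x - (r * k x - a)) - (theta y - (r * k y - a)) +
     r * (k x - (k (x - y) + k y))); last by ring.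
  by apply: dvdzD; [exact: dvdzB|exact: dvdz_mull].
Qed.

Lemma lift_small g : dif Et 2 g -> `|g.1| < V.
Proof.
have h x y : x \in Et -> y \in Et -> `|(x - y).1 *+ 2| <= V - 1.
  move=> /imfsetP[x' /= xE ->] /imfsetP[y' /= yE ->] /=.
  have := residue_half xE; have := residue_half yE; have := residue_ge0 x'; have := residue_ge0 y'; lia.
have h2 x y : x \in Et -> y \in Et -> `|(x - y).1| <= ((V - 1) %/ 2)%Z.
  move=> xE yE; have := h x y xE yE; lia.
move=> hg; have := dif_bound (f := fst) h2 hg; rewrite /=.
have := divz_eq (V - 1) 2; have := @modz_ge0 (V - 1) 2 isT. move: (_ %/ 2)%Z (_ %% 2)%Z => q m. lia.
Qed.

(** [S] lies in the kernel of the first coordinate, so its translates by representatives of distinct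
    residues are disjoint. All lie in 3Et - 2Et, which has at most 5^5 |Et| elements. *)
Lemma few_values MS (S : {fset (int * C)%type}) : E1 != fset0 ->
  (#|` addS Et Et| <= 5 * #|` Et|)%N -> (#|` Et| <= MS * #|` S|)%N ->
  (forall s, s \in S -> dif Et 2 s) -> (forall s, s \in S -> s.1 = 0) ->
  (#|` theta @` E1| <= 5 ^ 5 * MS)%N.
Proof.
move=> E10 h5 hS S2 Sz.
have Et0 : Et != fset0 by rewrite -cardfs_gt0 card_lift cardfs_gt0.
have S0 : (0 < #|` S|)%N.
  by move: hS; rewrite card_lift; move: E10; rewrite -cardfs_gt0; case: #|` S|; lia.
have hr t : exists x, t \in theta @` E1 -> x \in E1 /\ theta x = t.
  have [/imfsetP[x /= xE ->]|_] := boolP (t \in theta @` E1); first by exists x.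
  by exists 0.
have [rep hrep] := choice hr.
rewrite -(leq_pmul2r S0); apply: (@leq_trans (5 ^ 5 * #|` Et|)%N); last by rewrite -mulnA leq_mul2l hS orbT.
apply: leq_trans (plunnecke 3 2 Et0 h5).
apply: (@card_prod_le _ _ _ (fun t s => ((theta (rep t), rep t) : int * C) + s)).
  move=> t s /hrep[rE _] /S2/dif_nS/subSP[y [z [yA zA ->]]].
  rewrite addrA; apply: mem_subS => //; rewrite (nSS 2); apply: mem_addS => //.
  by apply/imfsetP; exists (rep t).
move=> t s t' s' tE sS t'E s'S e.
have et : t = t'.
  have [_ <-] := hrep t tE; have [_ <-] := hrep t' t'E.
  by move: (congr1 fst e) => /=; rewrite (Sz s sS) (Sz s' s'S) !addr0.
by split=> //; move: e; rewrite et; exact: addrI.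
Qed.

End Sparse.

(** * Progressions in cyclic groups: dense and sparse cases combined *)

Lemma has_gap_weaken (v : nat) (C : zmodType) (pi : {additive int -> C}) c M M' N N' (E X : {fset C}) :
  E `<=` X -> (N' <= c * N)%N -> (c * M <= M')%N -> has_gap v pi M N E -> has_gap v pi M' N' X.
Proof.
move=> EX hN hM [x1 [x2 [L1 [L2 [L0 hP inj hL]]]]]; exists x1, x2, L1, L2; split=> //.
  by move=> l1 l2 h1 h2; have [? h] := hP l1 l2 h1 h2; split=> //; exact: dif_sub h.
apply: leq_trans hN _; apply: leq_trans (leq_mul hM (leqnn _)).
by rewrite -mulnA leq_mul2l hL orbT.
Qed.

Lemma cyclic_gap (R : realType) : exists M, forall (v : nat) (C : zmodType) (k : C -> int)
    (pi : {additive int -> C}) (X : {fset C}),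
  (0 < v)%N -> (forall x y, pi x = pi y <-> (v%:Z %| x - y)%Z) -> (forall c, pi (k c) = c) ->
  (forall c, 0 <= k c < v%:Z) -> X != fset0 -> (100 * #|` addS X X| <= 201 * #|` X|)%N ->
  has_gap v pi M #|` X| X.
Proof.
have [T [T0 hT]] := window_step 5 247 100.
have [MS hMS] := many_multiples 5 (9 + T).
have [M2 hM2] := hT MS.
(* [n0] exceeds the number of values that [few_values] allows, and [s] is what [regular_many_values]
   then requires. *)
pose n0 := (5 ^ 5 * MS).+1; pose s := (200 * n0)%N.
exists (s ^ 101 * (714 * M2 + 1))%N => v C k pi X v0 piE kK kb X0 hX.
have s0 : (0 < s)%N by [].
have [E [EX E0 cE hE reg]] := regular_subset (n := 101) s0 X0 hX.
have kD' := kD piE kK; have kinj' := kinj piE kK.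
have [dense|sparse] := ltnP v (11 * #|trivial_chars v k E| * #|` E|).
  have [H [sH HE le]] := dense_subgroup R v0 kD' kinj' E0 dense.
  apply: (has_gap_weaken (c := (s ^ 101)%N) EX _ _ (subgroup_gap v0 piE kK kb sH HE)).
    by apply: leq_trans cE _; rewrite leq_mul2l le orbT.
  by rewrite leq_mul2l; apply/orP; right; rewrite addnS ltnS leq0n.
have [r [a [[x0 [y0 [x0E y0E nontriv]]]]]] := biased_character R v0 kD' kinj' E0 hE sparse.
rewrite -/(half_set v k r a E) => hE1.
set E1 := half_set v k r a E in hE1; pose Et := lifted v k r a E.
have E1E : E1 `<=` E by apply/fsubsetP => x; rewrite !inE => /andP[].
have Ep : (0 < #|` E|)%N by rewrite cardfs_gt0.
have E1p : (0 < #|` E1|)%N by move: hE1 Ep; clear; lia.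
have E10 : E1 != fset0 by rewrite -cardfs_gt0.
have cEt : #|` Et| = #|` E1| by exact: card_lift.
have Et0 : Et != fset0 by rewrite -cardfs_gt0 cEt.
have sumEt : (#|` addS Et Et| <= #|` addS E E|)%N.
  by apply: leq_trans (lift_add v0 piE kK r a E) _; apply: fsubset_leq_card; exact: addSS.
have h247 : (100 * #|` addS Et Et| <= 247 * #|` Et|)%N by rewrite cEt; move: sumEt hE hE1; clear; lia.
have h5 : (#|` addS Et Et| <= 5 * #|` Et|)%N by move: h247; clear; lia.
have [S [cS hS]] := hMS _ Et Et0 h5.
have S2 t : t \in S -> dif Et 2 t by move=> tS; have := hS t 1%N tS isT; rewrite mulr1n.
have S0 : S != fset0.
  by rewrite -cardfs_gt0; move: cS; rewrite cEt; case: #|` S| => //; rewrite muln0; move: E1p; clear; lia.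
have [w wS wmax] := fset_argmax (fun t : int * C => `|t.1|) S0.
have [w0|w0] := eqVneq w.1 0.
  have Sz t : t \in S -> t.1 = 0 by move=> /wmax; rewrite w0 normr0 normr_le0 => /eqP.
  have := few_values v0 E10 h5 cS S2 Sz; rewrite -ltnS ltnNge => /negP[].
  apply: ltnW; apply: (regular_many_values (n := n0) E0 hE reg E1E hE1 (lift_respects_sums v0 piE kK (r := r) (a := a) (E := E))) => //.
  move=> t; have hm := @residue_mod v C k v0 r a.
  have key z f f' f'' : f \in fiber (residue v k r a) E1 t -> f' \in fiber (residue v k r a) E1 t ->
      f'' \in fiber (residue v k r a) E1 t -> z + f = f' + f'' -> (v%:Z %| r * k z - a - t)%Z.
    rewrite ![_ \in fiber _ _ _]in_fiber => /andP[_ /eqP e] /andP[_ /eqP e'] /andP[_ /eqP e''] eq.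
    have d1 := kD' z f; have d2 := kD' f' f''; rewrite -eq in d2.
    have m := hm f; have m' := hm f'; have m'' := hm f''; rewrite e in m; rewrite e' in m'; rewrite e'' in m''.
    rewrite (_ : _ - t = r * ((k (z + f) - (k f' + k f'')) - (k (z + f) - (k z + k f))) +
       (t - (r * k f - a)) - (t - (r * k f' - a)) - (t - (r * k f'' - a))); last by ring.
    apply: dvdzB => //; apply: dvdzB => //; apply: dvdzD => //; apply: dvdz_mull; exact: dvdzB.
  (* A relation x + f = f' + f'' within the fibre over [t] forces r k(x) = a + t modulo v. As the
     character separates [x0] from [y0], one of them violates this. *)
  have [dx|ndx] := boolP (v%:Z %| r * k x0 - a - t)%Z; last first.
    by exists x0 => // f f' f'' hf hf' hf'' eq; move: ndx; rewrite (key _ _ _ _ hf hf' hf'' eq).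
  exists y0 => // f f' f'' hf hf' hf'' eq; case/negP: nontriv.
  rewrite (_ : r * _ = (r * k x0 - a - t) - (r * k y0 - a - t)); last by ring.
  exact: dvdzB dx (key _ _ _ _ hf hf' hf'' eq).
pose u := if 0 < w.1 then w else - w.
have hu j : (j <= 9 + T)%N -> dif Et 2 (u *+ j).
  by move=> jT; rewrite /u; case: ifP => _; rewrite ?mulNrn; [|apply: difN]; exact: hS.
have hu2 : dif Et 2 u by have := hu 1%N isT; rewrite mulr1n.
have uw : u.1 = `|w.1|.
  by rewrite /u; case: ltrP => h; [rewrite gtr0_norm|rewrite ler0_norm].
have up : 0 < u.1 by rewrite uw normr_gt0.
have huT j : (j < T)%N -> dif Et 2 (u *+ j).
  by move=> jT; apply: hu; apply: leq_trans (ltnW jT) _; rewrite leq_addl.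
have Su t : t \in S -> `|t.1| <= u.1 by rewrite uw; exact: wmax.
have [Q [p [sec [X2 [[secK pE secb] cX2 sumX2 lift2]]]]] :=
  hM2 _ (fst : {additive (int * C)%type -> int}) Et S u Et0 h5 h247 cS S2 huT up Su.
have X2p : (0 < #|` X2|)%N.
  by move: cX2 E1p; rewrite cEt; case: #|` X2| => //; rewrite muln0; clear; lia.
have X20 : X2 != fset0 by rewrite -cardfs_gt0.
have sH : subgroupS (subS X2 X2).
  split; first by case/fset0Pn: X20 => x xX; apply/subSP; exists x, x; rewrite subrr.
  (* Here the doubling is at most 248 / 200, below 3/2. *)
  by apply: small_sum_subgroup; move: sumX2 X2p; clear; lia.
have lift g : p g \in subS X2 X2 -> exists d j, [/\ dif Et 1 d, g = d + u *~ j & `|d.1| < T%:Z * u.1].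
  move=> /lift2[x [x' [xE x'E e b]]]; have /pE[j ej] := esym e.
  by exists (x - x'), j; split=> //; [exact: dif1|rewrite -ej addrC subrK].
have multu1 (j : int) : (u *~ j).1 = j * u.1.
  by rewrite (raddfMz (fst : {additive (int * C)%type -> int})) -mulrzr mulrC intz.
have Hcong g : p g \in subS X2 X2 -> (v%:Z %| g.1 - r * k g.2)%Z.
  move=> /lift[d [j [d1 -> _]]].
  have dn (n : nat) : exists m, dif Et m (u *+ n).
    elim: n => [|n [m hm]]; first by exists 0%N; rewrite mulr0n; exact: dif0.
    by exists (2 + m)%N; rewrite mulrS; exact: difD.
  have [m hm] : exists m, dif Et m (u *~ j).
    by case: j => n; [exact: dn|have [m hm] := dn n.+1; exists m; exact: difN].
  exact: (lift_cong v0 piE kK (difD d1 hm)).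
have Hdif g : p g \in subS X2 X2 -> `|g.1| <= 9 * u.1 -> dif E 32 g.2.
  move=> /lift[d [j [d1 eg db]]] gb.
  have jb : `|j| < 9 + T%:Z.
    rewrite -(ltr_pM2r up) -{1}(gtr0_norm up) -normrM -multu1.
    have -> : (u *~ j).1 = g.1 - d.1 by rewrite eg addrAC /= subrr add0r.
    by apply: le_lt_trans (ler_normB _ _) _; rewrite mulrDl; exact: ler_ltD gb db.
  have dj : dif Et 2 (u *~ j).
    case: j jb {eg} => j jb; first by apply: hu; clear -jb; lia.
    by rewrite NegzE mulrNz; apply/difN/hu; clear -jb; lia.
  have d3 : dif Et 3 g by rewrite eg; exact: (difD d1 dj).
  apply: (dif_sub E1E); rewrite /E1 -(lift_snd v k r a E).
  apply: (dif_mono _ (k := 3)) => //; last exact: (dif_img (snd : {additive (int * C)%type -> C}) d3).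
  by rewrite lift_snd.
have pu : p (u.1, u.2) = 0.
  by rewrite -surjective_pairing -(raddf0 p); apply/pE; exists 1; rewrite subr0 mulr1z.
have uv : u.1 < v%:Z by have := lift_small v0 hu2; rewrite gtr0_norm.
have gap := lattice_gap v0 piE kK kb secK secb pu uv sH Hcong Hdif.
apply: (has_gap_weaken (c := (s ^ 101 * (2 * M2))%N) EX _ _ gap).
  have le2 : (#|` X2| <= #|` subS X2 X2|)%N.
    case/fset0Pn: X20 => x xX; rewrite -(card_translate X2 (- x)).
    by apply: fsubset_leq_card; apply/fsubsetP => _ /imfsetP[y /= yX ->]; exact: mem_subS.
  apply: leq_trans cE _; rewrite -mulnA leq_mul2l; apply/orP; right.
  have : (M2 * #|` X2| <= M2 * #|` subS X2 X2|)%N by rewrite leq_mul2l le2 orbT.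
  by move: cX2 hE1; rewrite cEt -mulnA; clear; lia.
by rewrite -mulnA leq_mul2l; apply/orP; right; clear; lia.
Qed.

(** * From the cyclic quotient back to the integers *)

Lemma dif_lift (G Q : zmodType) (p : {additive G -> Q}) (theta : {additive G -> int})
    (A : {fset G}) (X : {fset Q}) (B : int) n y :
  (forall y, y \in subS X X -> exists x x', [/\ x \in A, x' \in A, p (x - x') = y
     & `|theta (x - x')| < B]) ->
  dif X n y -> exists z, [/\ dif A n z, p z = y & `|theta z| <= n%:Z * B].
Proof.
move=> lift; elim: n y => [|n IH] y.
  move=> [s [t [/size0nil -> /size0nil -> _ _ ->]]]; rewrite !big_nil subrr.
  by exists 0; rewrite !raddf0 normr0 mul0r; split=> //; exact: dif0.
move=> /difS[y' [y'' [/IH[z [dz <- bz]] /dif1E/lift[x [x' [xA x'A <- bx]]] ->]]].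
exists (z + (x - x')); split; first by rewrite -addn1; apply: difD => //; exact: dif1.
  by rewrite raddfD.
rewrite raddfD intS mulrDl mul1r addrC; apply: le_trans (ler_normD _ _) _.
by apply: lerD => //; exact: ltW.
Qed.

Lemma integer_gap (R : realType) : exists M, forall A : {fset int}, A != fset0 ->
  (100 * #|` addS A A| <= 401 * #|` A|)%N ->
  exists x1 x2 : int, exists L1 L2 : nat,
  [/\ (0 < L1)%N /\ (0 < L2)%N,
      forall l1 l2 : int, 1 <= l1 <= L1%:Z -> 1 <= l2 <= L2%:Z -> dif A 40 (l1 * x1 + l2 * x2),
      forall l1 l2 m1 m2 : int, 1 <= l1 <= L1%:Z -> 1 <= l2 <= L2%:Z ->
        1 <= m1 <= L1%:Z -> 1 <= m2 <= L2%:Z ->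
        l1 * x1 + l2 * x2 = m1 * x1 + m2 * x2 -> l1 = m1 /\ l2 = m2
    & (#|` A| <= M * (L1 * L2))%N].
Proof.
have [T [T0 hT]] := window_step 5 401 100.
have [Mc hMc] := cyclic_gap R.
(* A term z with |z| <= 9v and its lift in 32A - 32A, of size at most 32Tv, differ by at most 9 +
   32T multiples of v. *)
have [MS hMS] := many_multiples 5 (9 + 32 * T).
have [M1 hM1] := hT MS.
exists (M1 * Mc + MS)%N => A A0 hA.
have h5 : (#|` addS A A| <= 5 * #|` A|)%N by move: hA; clear; lia.
have Ap : (0 < #|` A|)%N by rewrite cardfs_gt0.
have [S [cS hS]] := hMS _ A A0 h5.
have S2 t : t \in S -> dif A 2 t by move=> tS; have := hS t 1%N tS isT; rewrite mulr1n.
have S0 : S != fset0.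
  by rewrite -cardfs_gt0; move: cS; case: #|` S| => //; rewrite muln0 leqNgt Ap.
have [w wS wmax] := fset_argmax (fun t : int => `|t|) S0.
have [w0|w0] := eqVneq w 0.
  (* If [S] contains only 0, then |A| <= MS and a single point is large enough. *)
  exists 0, 0, 1%N, 1%N; split=> //.
  - by move=> l1 l2 _ _; rewrite !mulr0 addr0; exact: dif_n0.
  - by move=> l1 l2 m1 m2; lia.
  have : S `<=` [fset 0].
    by apply/fsubsetP => t /wmax; rewrite w0 normr0 normr_le0 inE.
  move/fsubset_leq_card; rewrite cardfs1 => S1; apply: leq_trans cS _.
  by rewrite !muln1; apply: leq_trans (leq_mul (leqnn MS) S1) _; rewrite muln1 leq_addl.
pose v := `|w|%N; pose u : int := v%:Z.
have v0 : (0 < v)%N by rewrite absz_gt0.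
have hu j : (j <= 9 + 32 * T)%N -> dif A 2 (u *+ j).
  move=> jT; have := hS w j wS jT; rewrite /u /v abszE.
  by case: (ger0P w) => // _ /difN; rewrite mulNrn.
have up : 0 < u by [].
have huT j : (j < T)%N -> dif A 2 (u *+ j) by move=> jT; apply: hu; clear -jT; lia.
have Su t : t \in S -> `|t| <= u by move/wmax; rewrite /u /v abszE.
have [Q [p [sec [X [[secK pE secb] cX sumX lift]]]]] :=
  hM1 _ (idfun : {additive int -> int}) A S u A0 h5 hA cS S2 huT up Su.
have X0 : X != fset0.
  by rewrite -cardfs_gt0; move: cX Ap; case: #|` X| => //; rewrite muln0 leqNgt => /negP h /h.
have pE' x y : p x = p y <-> (v%:Z %| x - y)%Z.
  split; first by move/pE => [j ->]; rewrite -mulrzr dvdz_mulr.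
  by move/dvdzP => [j e]; apply/pE; exists j; rewrite e -mulrzr intz mulrC.
have hX : (100 * #|` addS X X| <= 201 * #|` X|)%N by move: sumX; clear; lia.
have [x1 [x2 [L1 [L2 [L0 hP inj hL]]]]] := hMc v Q sec p X v0 pE' secK secb X0 hX.
exists x1, x2, L1, L2; split=> //; last first.
  apply: leq_trans cX _; apply: (@leq_trans (M1 * (Mc * (L1 * L2)))%N); first by rewrite leq_mul2l hL orbT.
  by rewrite mulnA leq_mul2r leq_addr orbT.
move=> l1 l2 h1 h2; have [] := hP l1 l2 h1 h2; move: (l1 * x1 + l2 * x2) => z zb /(dif_lift lift)[z' [dz' ez' bz']].
have /pE[j ej] := esym ez'.
have jb : `|j| <= 9 + 32 * T%:Z.
  rewrite -(ler_pM2r up) -{1}(gtr0_norm up) -normrM.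
  have -> : j * u = z - z' by rewrite ej -mulrzr intz mulrC.
  by apply: le_trans (ler_normB _ _) _; rewrite mulrDl -mulrA; exact: lerD.
have dj : dif A 2 (u *~ j).
  case: j jb {ej} => j jb; first by apply: hu; clear -jb; lia.
  by rewrite NegzE mulrNz; apply/difN/hu; clear -jb; lia.
have d34 : dif A (2 + 32) z by rewrite -(subrK z' z) ej; exact: difD.
exact: (dif_mono A0 _ d34).
Qed.

Lemma mem_nfold_sumset (s : seq int) h (A : {fset int}) : size s = h -> {subset s <= A} ->
  \sum_(x <- s) x \in nfold_sumset h A.
Proof.
move=> sh sA; have hn (i : 'I_h) : nth 0 s i \in A by apply: sA; rewrite mem_nth ?sh.
apply/imfsetP; exists [ffun i : 'I_h => [` hn i]] => //=.
by rewrite (big_nth 0) big_mkord sh; apply: eq_bigr => i _; rewrite ffunE.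
Qed.

Theorem corollary1p4 (R : realType) :
  exists delta0 : R, 0 < delta0 /\
    forall delta : R, 0 < delta -> delta < delta0 ->
      exists c : R, 0 < c /\
        forall A : {fset int},
          A != fset0 ->
          #|` sumset A A|%:R <= (4 + delta) * #|` A|%:R ->
          exists (d : nat) (P : {fset int}),
            (1 <= d <= 2)%N /\
            is_progression d P /\
            P `<=` diffset (nfold_sumset 41 A) (nfold_sumset 40 A) /\
            c * #|` A|%:R <= #|` P|%:R.
Proof.
have [M hM] := integer_gap R.
exists 100%:R^-1; split; first by rewrite invr_gt0 ltr0n.
move=> delta delta_gt0 delta_lt.
(* [M.+1] rather than [M] makes the inverse positive without knowing that [M] is. *)
exists M.+1%:R^-1; split; first by rewrite invr_gt0 ltr0n.
move=> A A0 hA.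
have hA' : (100 * #|` addS A A| <= 401 * #|` A|)%N.
  rewrite -(ler_nat R) !natrM; move: hA delta_lt; rewrite -/(addS A A).
  have := ler0n R #|` A|; move: #|` A|%:R #|` addS A A|%:R => x y x0 hA.
  by rewrite -[_^-1]mul1r ltr_pdivlMr ?ltr0n // => hd; nra.
have [x1 [x2 [L1 [L2 [[L10 L20] hP inj hL]]]]] := hM A A0 hA'.
have /fset0Pn[a0 a0A] := A0.
(* Translating by [a0] adds one summand on the positive side of 40A - 40A. Successors convert
   indices starting at 0 into coefficients starting at 1. *)
pose f (q : nat * nat) : int := a0 + (q.1.+1%:Z * x1 + q.2.+1%:Z * x2).
pose P : {fset int} := f @` (iotaS L1 `*` iotaS L2).
have inP x : x \in P -> exists l1 l2 : int,
    [/\ 1 <= l1 <= L1%:Z, 1 <= l2 <= L2%:Z & x = a0 + (l1 * x1 + l2 * x2)].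
  move=> /imfsetP[[i j]] /=; rewrite in_fsetM !in_iotaS => /= /andP[iL jL] ->.
  by exists i.+1%:Z, j.+1%:Z; split=> //; lia.
have Pin l1 l2 : 1 <= l1 <= L1%:Z -> 1 <= l2 <= L2%:Z -> a0 + (l1 * x1 + l2 * x2) \in P.
  move=> h1 h2; apply/imfsetP; exists (`|l1|%N.-1, `|l2|%N.-1) => /=.
    by rewrite in_fsetM !in_iotaS /=; apply/andP; split; lia.
  rewrite /f /=; congr (_ + (_ * _ + _ * _)); lia.
have cP : #|` P| = (L1 * L2)%N.
  rewrite card_in_imfset /=; last first.
    move=> [i j] [i' j']; rewrite !in_fsetM !in_iotaS /= => /andP[iL jL] /andP[iL' jL'] /addrI e.
    have [||||e1 e2] := inj i.+1%:Z j.+1%:Z i'.+1%:Z j'.+1%:Z _ _ _ _ e. 1-4: lia.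
    by congr (_, _); lia.
  by rewrite card_dep_pairs big_const_seq count_predT iter_addn addn0 !card_iotaS mulnC.
exists 2, P; split=> //; split; [|split].
- exists a0, (fun i : 'I_2 => if i == ord0 then x1 else x2),
    (fun i : 'I_2 => if i == ord0 then L1 else L2); split; first by move=> i; case: ifP.
  move=> x; split=> [/inP[l1 [l2 [h1 h2 ->]]]|[l [hl ->]]].
    exists (fun i : 'I_2 => if i == ord0 then l1 else l2); split; first by move=> i; case: ifP.
    by rewrite big_ord_recl big_ord1.
  rewrite big_ord_recl big_ord1 /=; apply: Pin.
    by have := hl ord0.
  by have := hl (lift ord0 ord0).
- apply/fsubsetP => _ /inP[l1 [l2 [h1 h2 ->]]].
  have [s [t [sk tk sA tA ->]]] := hP l1 l2 h1 h2.
  rewrite addrA -(big_cons _ _ a0 s xpredT id) /diffset.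
  apply/imfset2P; exists (\sum_(x <- a0 :: s) x).
    apply: mem_nfold_sumset; first by rewrite /= sk.
    by move=> x; rewrite inE => /orP[/eqP ->//|/sA].
  by exists (\sum_(x <- t) x) => //; exact: mem_nfold_sumset.
rewrite cP mulrC ler_pdivrMr ?ltr0n // -natrM ler_nat.
by apply: leq_trans hL _; rewrite mulnC leq_mul2l leqnSn orbT.
Qed.
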